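(* Let $\mathbb{E}$ be a holomorphic family of rank $k$ $[\Lambda]$-primitive frescos parametrized by a reduced complex space $X$, and let $\theta\in\mathbb{C}[[a]]$ be a change of variable. Then the family $(\theta_*(\mathbb{E}(x)))_{x\in X}$ is holomorphic.
   Context: **Frescos.** $\hat A$ is the $\mathbb{C}$-algebra of series $\sum_{\nu\ge 0}P_\nu(a)b^\nu$, $P_\nu\in\mathbb{C}[[a]]$, with $ab-ba=b^2$ and with left and right multiplication by any $T\in\mathbb{C}[[a]]$ continuous for the $b$-adic filtration; $\tilde{\mathcal A}\subset\hat A$ is the subalgebra where all $P_\nu\in\mathbb{C}[a]$. An (a,b)-module is a left $\tilde{\mathcal A}$-module free of finite rank over $\mathbb{C}[[b]]$. It has a simple pole if $aE\subset bE$, and is regular if contained in a simple pole (a,b)-module; a regular (a,b)-module is canonically a left $\hat A$-module. For $E$ regular, $E^\sharp\subset E[b^{-1}]$ is the smallest simple pole (a,b)-module containing $E$, and the Bernstein polynomial of $E$ is the minimal polynomial of $-b^{-1}a$ on $E^\sharp/bE^\sharp$. $E$ is geometric if it is regular and all roots of its Bernstein polynomial are negative rationals. A fresco is a geometric (a,b)-module generated by one element over $\tilde{\mathcal A}$ (equivalently over $\hat A$). For $[\Lambda]\subset\mathbb{Q}/\mathbb{Z}$, $E$ is $[\Lambda]$-primitive if the opposite of every root of its Bernstein polynomial has class in $[\Lambda]$. **Change of variable.** A change of variable is $\theta\in\mathbb{C}[[a]]$ with $\theta(0)=0$, $\chi(\theta):=\theta'(0)\ne0$. There is a unique continuous algebra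 automorphism $\Theta$ of $\hat A$ with $\Theta(a)=\theta(a)$, $\Theta(b)=b\,\theta'(a)$. For a left $\hat A$-module $E$, $\theta_*(E)$ is the vector space $E$ with $u\in\hat A$ acting as $\Theta(u)$ acts on $E$. **Holomorphic families.** For $\lambda\in\,]0,1]\cap\mathbb{Q}$, $\Xi_\lambda^{(N)}$ is the free $\mathbb{C}[[b]]$-module with basis $e_0,\dots,e_N$ and $a e_0=\lambda b e_0$, $a e_j=\lambda b e_j+b e_{j-1}$ for $j\ge1$. For $[\Lambda]\subset\mathbb{Q}/\mathbb{Z}$ finite, $\Xi_\Lambda^{(N)}$ is the direct sum of the $\Xi_{\lambda_i}^{(N)}$ over the representatives $\lambda_i\in\,]0,1]$ of the elements of $[\Lambda]$. For $V$ a finite dimensional complex vector space, $a,b$ act on $\Xi_\Lambda^{(N)}\otimes V$ as $a\otimes\mathrm{id}$, $b\otimes\mathrm{id}$. For a reduced complex space $X$, $\Xi_{\Lambda,X}^{(N)}\otimes V$ is the corresponding free sheaf of $\mathcal{O}_X[[b]]$-modules, with the same formulas for $a$ (which commutes with $\mathcal{O}_X$). An $\hat A_X$-sheaf is a sheaf with compatible structures of $\mathcal{O}_X[[b]]$-module and left $\hat A$-module. For $x\in X$, $ev_x:\Xi_{\Lambda,X}^{(N)}\otimes V\to\Xi_\Lambda^{(N)}\otimes V$ is evaluation at $x$. A section $\varphi$ of $\Xi_{\Lambda,X}^{(N)}\otimes V$ is $k$-admissible if the sub-$\hat A_X$-sheaf $\mathbb{E}=\hat A_X\varphi$ it generates is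 a free rank $k$ $\mathcal{O}_X[[b]]$-module with basis $\varphi,a\varphi,\dots,a^{k-1}\varphi$ and, for each $x\in X$, $ev_x(\mathbb{E})$ is a rank $k$ fresco. An $\hat A_X$-sheaf $\mathbb{E}$ is a holomorphic family of rank $k$ frescos parametrized by $X$ if it is locally on $X$ isomorphic to an $\hat A_X$-sheaf generated by a $k$-admissible section of some $\Xi_{\Lambda,X}^{(N)}\otimes V$. Its value at $x$ is $\mathbb{E}(x):=\mathbb{E}/\mathfrak{M}_x\mathbb{E}$, $\mathfrak{M}_x$ being the maximal ideal of $x$. A family of frescos indexed by $X$ is called holomorphic when it is the family of values of such a sheaf; here the sheaf in question is $\theta_*(\mathbb{E})$, i.e. the sheaf $\mathbb{E}$ with unchanged $\mathcal{O}_X$-structure and with $\hat A$ acting through $\Theta$. *)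

(* Defs.v *)
From HB Require Import structures.
From mathcomp Require Import all_boot all_order all_algebra.
From mathcomp Require Import all_classical reals topology normedtype derive.
From mathcomp Require Import ring zify.
Set Implicit Arguments.
Unset Strict Implicit.
Unset Printing Implicit Defensive.
Import Order.TTheory GRing.Theory Num.Theory numFieldNormedType.Exports.
Local Open Scope classical_set_scope.
Local Open Scope quotient_scope.
Local Open Scope ring_scope.

(* Power series in one variable; an alias is needed because [nat -> K] already
   carries the pointwise product, whereas [pseries K] carries the Cauchy product. *)
Definition pseries (K : comPzRingType) : Type := nat -> K.
HB.instance Definition _ (K : comPzRingType) :=
  GRing.Zmodule.copy (pseries K) (nat -> K).

Section PowerSeries.
Variable K : comPzRingType.
Implicit Types f g h : pseries K.

Definition psconst (c : K) : pseries K := fun n => if n == 0%N then c else 0.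
Definition psmul f g : pseries K := fun n => \sum_(i < n.+1) f i * g (n - i)%N.

Lemma psmulE N f g n : (n < N)%N ->
  psmul f g n = \sum_(i < N) \sum_(j < N) (f i * g j) *+ (i + j == n)%N.
Proof.
move=> nN; rewrite /psmul (big_ord_widen N (fun i => f i * g (n - i)%N))// big_mkcond.
apply: eq_bigr => i _; case: ifPn => iN.
  have jN : (n - i < N)%N by lia.
  have ini : (i + (n - i) = n)%N by lia.
  rewrite (bigD1 (Ordinal jN))//= ini eqxx big1 ?addr0// => j; rewrite -val_eqE /= => jni.
  by have -> : (i + j == n)%N = false by lia.
by rewrite big1// => j _; have -> : (i + j == n)%N = false by lia.
Qed.

Lemma psmulC : commutative psmul.
Proof.
move=> f g; apply/funext => n; rewrite !(@psmulE n.+1)// exchange_big.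
by apply: eq_bigr => i _; apply: eq_bigr => j _; rewrite mulrC addnC.
Qed.

Lemma psmulA : associative psmul.
Proof.
move=> f g h; apply/funext => n; rewrite [LHS](@psmulE n.+1)// [RHS](@psmulE n.+1)//.
transitivity (\sum_(i < n.+1) \sum_(j < n.+1) \sum_(k < n.+1)
    (f i * g j * h k) *+ (i + j + k == n)%N).
  apply: eq_bigr => i _.
  under eq_bigr => l _ do rewrite (@psmulE n.+1)// mulr_sumr -sumrMnl.
  under eq_bigr => l _ do under eq_bigr => j _ do rewrite mulr_sumr -sumrMnl.
  rewrite exchange_big; apply: eq_bigr => j _.
  rewrite exchange_big; apply: eq_bigr => k _.
  have [jk|jk] := ltnP (j + k) n.+1.
    rewrite (bigD1 (Ordinal jk))//= eqxx mulr1n mulrA big1 ?addr0 ?addnA// => l.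
    by rewrite -val_eqE /= eq_sym => /negbTE->; rewrite mulr0n mulr0 mul0rn.
  have -> : (i + j + k == n)%N = false by lia.
  rewrite mulr0n big1// => l _.
  have -> : (j + k == l)%N = false by have := ltn_ord l; lia.
  by rewrite mulr0n mulr0 mul0rn.
symmetry; under eq_bigr => l _ do under eq_bigr => k _ do
  rewrite (@psmulE n.+1)// mulr_suml -sumrMnl.
under eq_bigr => l _ do under eq_bigr => k _ do under eq_bigr => i _ do
  rewrite mulr_suml -sumrMnl.
under eq_bigr => l _ do rewrite exchange_big.
rewrite exchange_big; apply: eq_bigr => i _.
under eq_bigr => l _ do rewrite exchange_big.
rewrite exchange_big; apply: eq_bigr => j _.
rewrite exchange_big; apply: eq_bigr => k _.
have [ij|ij] := ltnP (i + j) n.+1.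
  rewrite (bigD1 (Ordinal ij))//= eqxx mulr1n big1 ?addr0// => l.
  by rewrite -val_eqE /= eq_sym => /negbTE->; rewrite mulr0n mul0r mul0rn.
have -> : (i + j + k == n)%N = false by lia.
rewrite mulr0n big1// => l _.
have -> : (i + j == l)%N = false by have := ltn_ord l; lia.
by rewrite mulr0n mul0r mul0rn.
Qed.

Lemma psmul1 : left_id (psconst 1) psmul.
Proof.
move=> f; apply/funext => n; rewrite /psmul big_ord_recl /psconst /= mul1r subn0.
by rewrite big1 ?addr0// => i _; rewrite mul0r.
Qed.

Lemma psmulDl : left_distributive psmul +%R.
Proof.
move=> f g h; apply/funext => n.
transitivity (psmul f h n + psmul g h n); last by [].
by rewrite /psmul -big_split; apply: eq_bigr => i _; rewrite [LHS]mulrDl.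
Qed.

HB.instance Definition _ :=
  GRing.Zmodule_isComPzRing.Build (pseries K) psmulA psmulC psmul1 psmulDl.
End PowerSeries.

(* [u : Ahat K] is the series [\sum_(m, n) u m n a^m b^n], i.e. P_n(a) is the
   power series with coefficients [u ^~ n].  The product is determined by
   ab - ba = b^2 and continuity, see [ahat_mul] and [ahat_comm]. *)
Definition Ahat (K : fieldType) : Type := nat -> nat -> K.
HB.instance Definition _ (K : fieldType) :=
  GRing.Lmodule.copy (Ahat K) (nat -> nat -> K^o).

Section Fsum.
Variables (K : fieldType) (V : lmodType K) (I : Type) (d : I -> nat).
Implicit Types (u v : Ahat K) (F : nat -> nat -> I -> V).

Definition fsum u F : I -> V := fun i =>
  \sum_(m < (d i).+1) \sum_(n < (d i).+1) u m n *: F m n i.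

Definition raises F := forall m n i, (d i < m + n)%N -> F m n i = 0.

Lemma big_rect (f : nat -> nat -> V) D M N :
  (forall m n, (D < m + n)%N -> f m n = 0) -> (D < M)%N -> (D < N)%N ->
  \sum_(m < M) \sum_(n < N) f m n = \sum_(m < D.+1) \sum_(n < D.+1) f m n.
Proof.
move=> f0 DM DN.
have H P Q (g : nat -> V) : (P <= Q)%N -> (forall n, (P <= n)%N -> g n = 0) ->
    \sum_(n < Q) g n = \sum_(n < P) g n.
  move=> PQ g0; rewrite -(subnKC PQ) big_split_ord /= [X in _ + X]big1 ?addr0//.
  by move=> i _; rewrite g0 //= leq_addr.
rewrite (H D.+1 M (fun m => \sum_(n < N) f m n))//; last first.
  by move=> n Dn; apply: big1 => i _; rewrite f0 ?scaler0 //; lia.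
apply: eq_bigr => m _; apply: (H D.+1 N (f m)) => // n Dn; rewrite f0//; lia.
Qed.

Lemma fsumE u F i M N : raises F -> (d i < M)%N -> (d i < N)%N ->
  fsum u F i = \sum_(m < M) \sum_(n < N) u m n *: F m n i.
Proof.
move=> rF dM dN; rewrite (@big_rect (fun m n => u m n *: F m n i) (d i))// => m n dmn.
by rewrite rF ?scaler0.
Qed.

Lemma fsumD u v F : fsum (u + v) F = fsum u F + fsum v F.
Proof.
apply/funext => i; rewrite fctE /fsum -big_split; apply: eq_bigr => m _ /=.
by rewrite -big_split; apply: eq_bigr => n _ /=; rewrite -scalerDl.
Qed.

Lemma fsumDr u F G : fsum u (fun m n => F m n + G m n) = fsum u F + fsum u G.
Proof.
apply/funext => i; rewrite fctE /fsum -big_split; apply: eq_bigr => m _ /=.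
by rewrite -big_split; apply: eq_bigr => n _ /=; rewrite -scalerDr.
Qed.

Lemma fsumZr c u F : fsum u (fun m n => c *: F m n) = c *: fsum u F.
Proof.
apply/funext => i; rewrite fctE /fsum scaler_sumr; apply: eq_bigr => m _ /=.
rewrite scaler_sumr; apply: eq_bigr => n _ /=.
by rewrite !scalerA mulrC.
Qed.

Lemma fsumZl c u F : fsum (c *: u) F = c *: fsum u F.
Proof.
apply/funext => i; rewrite fctE /fsum scaler_sumr; apply: eq_bigr => m _ /=.
by rewrite scaler_sumr; apply: eq_bigr => n _ /=; rewrite -scalerA.
Qed.

End Fsum.

Section Mul.
Variable K : fieldType.
Implicit Types u v w : Ahat K.

(* Right multiplication by a and by b: ba = ab - b^2 gives
   b^n a = a b^n - n b^(n+1). *)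
Definition rmula u : Ahat K := fun s t =>
  (if s is s'.+1 then u s' t else 0) - (if t is t'.+1 then u s t' *+ t' else 0).
Definition rmulb u : Ahat K := fun s t => if t is t'.+1 then u s t' else 0.

(* u v = \sum_(p, q) v_pq (u a^p) b^q; the sum is finite in each coefficient since
   right multiplication by a or b raises the total degree by one. *)
Definition ahat_mul u v : Ahat K := fun s t =>
  \sum_(p < (s + t).+1) \sum_(q < (s + t).+1)
    v p q * iter q rmulb (iter p rmula u) s t.
Definition ahat_one : Ahat K := fun s t => ((s == 0%N) && (t == 0%N))%:R.

Section F2.
Variables (V : lmodType K) (I : Type) (d : I -> nat).

Lemma fsum_rmulb u (F : nat -> nat -> I -> V) : raises d F ->
  fsum d (rmulb u) F = fsum d u (fun m n => F m n.+1).
Proof.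
move=> rF; apply/funext => i.
rewrite (fsumE (M := (d i).+1) (N := (d i).+2) _ rF)//.
apply: eq_bigr => m _; rewrite big_ord_recl /= scale0r add0r.
by apply: eq_bigr.
Qed.

Lemma fsum_rmula u (F : nat -> nat -> I -> V) : raises d F ->
  fsum d (rmula u) F = fsum d u (fun m n => F m.+1 n - F m n.+1 *+ n).
Proof.
move=> rF; apply/funext => i.
transitivity (\sum_(m < (d i).+1) \sum_(n < (d i).+1) u m n *: F m.+1 n i -
   \sum_(m < (d i).+1) \sum_(n < (d i).+1) (u m n *+ n) *: F m n.+1 i); last first.
  rewrite /fsum -sumrB; apply: eq_bigr => m _; rewrite -sumrB.
  apply: eq_bigr => n _; rewrite [in RHS]/= scalerBr; congr (_ - _).
  by rewrite -scalerMnl scalerMnr natmulfctE.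
rewrite /fsum /rmula.
under eq_bigr do under eq_bigr do rewrite scalerBl.
under eq_bigr do rewrite sumrB.
rewrite sumrB; congr (_ - _).
  rewrite -(big_rect (M := (d i).+2) (N := (d i).+1)
    (f := fun m n => (if m is s'.+1 then u s' n else 0) *: F m n i))//; last first.
    by move=> m n /rF->; rewrite scaler0.
  rewrite big_ord_recl [X in X + _]big1 ?add0r//.
  by move=> j _; rewrite scale0r.
rewrite -(big_rect (M := (d i).+1) (N := (d i).+2)
  (f := fun m n => (if n is t'.+1 then u m t' *+ t' else 0) *: F m n i))//; last first.
  by move=> m n /rF->; rewrite scaler0.
by apply: eq_bigr => m _; rewrite big_ord_recl /= scale0r add0r.
Qed.
End F2.

Definition vanishes_below (N : nat) u := forall s t, (s + t < N)%N -> u s t = 0.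

Lemma vanishes_rmula N u : vanishes_below N u -> vanishes_below N.+1 (rmula u).
Proof.
move=> H [|s] [|t] L; rewrite /rmula ?subr0 ?sub0r ?subrr// ?H ?mul0rn ?subr0 ?oppr0 //; try lia.
Qed.
Lemma vanishes_rmulb N u : vanishes_below N u -> vanishes_below N.+1 (rmulb u).
Proof. move=> H s [|t] L //=; apply: H; lia. Qed.
Lemma vanishes_iter p q N u : vanishes_below N u -> vanishes_below (p + q + N) (iter q rmulb (iter p rmula u)).
Proof.
move=> H; elim: q => [|q IH].
  rewrite addn0 /=; elim: p => // p IH; exact: vanishes_rmula.
by rewrite addnS; apply: vanishes_rmulb.
Qed.

Definition tdeg (i : nat * nat) := (i.1 + i.2)%N.
Definition rmon u p q (i : nat * nat) : K^o := iter q rmulb (iter p rmula u) i.1 i.2.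

Lemma raises_rmon u : raises tdeg (rmon u).
Proof. by move=> m n i L; apply: (@vanishes_iter _ _ 0); rewrite // addn0. Qed.

Lemma ahat_mulE u v : ahat_mul u v = fun s t => fsum tdeg v (rmon u) (s, t).
Proof. by []. Qed.

Lemma ahatDE u v s t : (u + v) s t = u s t + v s t. Proof. by []. Qed.
Lemma ahatZE c u s t : (c *: u) s t = c * u s t. Proof. by []. Qed.

Lemma ahatMnE u n s t : (u *+ n) s t = u s t *+ n.
Proof. by elim: n => // n IH; rewrite !mulrS ahatDE IH. Qed.

Lemma rmulaD u v : rmula (u + v) = rmula u + rmula v.
Proof.
apply/funext => s; apply/funext => t; rewrite /rmula.
case: s => [|s]; case: t => [|t] /=; rewrite !ahatDE /= ?mulrnDl; ring.
Qed.
Lemma rmulaZ c u : rmula (c *: u) = c *: rmula u.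
Proof.
apply/funext => s; apply/funext => t; rewrite /rmula.
case: s => [|s]; case: t => [|t] /=; rewrite !ahatZE /= ?mulrBr ?mulrnAr ?mulr0; ring.
Qed.
Lemma rmulbD u v : rmulb (u + v) = rmulb u + rmulb v.
Proof.
by apply/funext => s; apply/funext => -[|t]; rewrite !ahatDE /= ?addr0.
Qed.
Lemma rmulbZ c u : rmulb (c *: u) = c *: rmulb u.
Proof.
by apply/funext => s; apply/funext => -[|t]; rewrite !ahatZE /= ?mulr0.
Qed.

Lemma rmonD u v p q : rmon (u + v) p q = rmon u p q + rmon v p q.
Proof.
apply/funext => -[s t]; rewrite /rmon fctE/=.
have -> : iter p rmula (u + v) = iter p rmula u + iter p rmula v.
  by elim: p => //= p ->; rewrite rmulaD.
suff -> : forall x y : Ahat K, iter q rmulb (x + y) = iter q rmulb x + iter q rmulb y by [].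
by move=> x y; elim: q => //= q ->; rewrite rmulbD.
Qed.
Lemma rmonZ c u p q : rmon (c *: u) p q = c *: rmon u p q.
Proof.
apply/funext => -[s t]; rewrite /rmon.
have -> : iter p rmula (c *: u) = c *: iter p rmula u.
  by elim: p => //= p ->; rewrite rmulaZ.
suff -> : forall x : Ahat K, iter q rmulb (c *: x) = c *: iter q rmulb x by [].
by move=> x; elim: q => //= q ->; rewrite rmulbZ.
Qed.

Lemma rmul_comm u : rmulb (rmula u) = rmula (rmulb u) + rmulb (rmulb u).
Proof.
apply/funext => s; apply/funext => t; rewrite !ahatDE /rmulb/= /rmula.
case: s => [|s]; case: t => [|[|t]] /=; rewrite ?mulr0n ?mulrS; ring.
Qed.

Lemma rmul_commn q u :
  rmula (iter q rmulb u) = iter q rmulb (rmula u) - iter q.+1 rmulb u *+ q.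
Proof.
elim: q => [|q IH] /=; first by rewrite mulr0n subr0.
have -> : forall x, rmula (rmulb x) = rmulb (rmula x) - rmulb (rmulb x).
  by move=> x; rewrite rmul_comm addrK.
have rmulbN x : rmulb (- x) = - rmulb x by rewrite -!scaleN1r rmulbZ.
have rmulbMn x n : rmulb (x *+ n) = rmulb x *+ n.
  by rewrite -!scaler_nat rmulbZ.
by rewrite IH rmulbD rmulbN rmulbMn mulrSr /= opprD addrA.
Qed.

Lemma ahat_mul_rmulb u v : ahat_mul u (rmulb v) = rmulb (ahat_mul u v).
Proof.
rewrite !ahat_mulE fsum_rmulb; last exact: raises_rmon.
apply/funext => s; apply/funext => -[|t].
  by rewrite /rmulb /fsum; do 2 (apply: big1 => ? _); rewrite /rmon/= scaler0.
rewrite /rmulb /= (fsumE (M := (s + t.+1).+1) (N := (s + t.+1).+1) _ (raises_rmon u))//=; rewrite /tdeg/=; lia.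
Qed.

Lemma ahat_mul_rmula u v : ahat_mul u (rmula v) = rmula (ahat_mul u v).
Proof.
rewrite !ahat_mulE fsum_rmula; last exact: raises_rmon.
apply/funext => s; apply/funext => t.
set M := (s + t).+1.
have E x y : (x + y <= s + t)%N ->
    fsum tdeg v (rmon u) (x, y) = \sum_(p < M) \sum_(q < M) v p q * rmon u p q (x, y).
  by move=> L; rewrite (fsumE (M := M) (N := M) _ (raises_rmon u))// /tdeg /M/=; lia.
transitivity (\sum_(p < M) \sum_(q < M) v p q * rmula (fun x y => rmon u p q (x, y)) s t).
  rewrite /fsum /tdeg /= -/M; apply: eq_bigr => p _; apply: eq_bigr => q _.
  congr (_ * _); rewrite fctE /=.
  have -> : (fun x y => rmon u p q (x, y)) = iter q rmulb (iter p rmula u) :> Ahat K.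
    by [].
  rewrite rmul_commn ahatDE; congr (_ + _).
  rewrite !opprfctE natmulfctE; congr (- _).
  by rewrite -ahatMnE.
rewrite /rmula.
under eq_bigr do under eq_bigr do rewrite mulrBr.
under eq_bigr do rewrite sumrB.
rewrite sumrB; congr (_ - _).
  case: s @M E => [|s] M E; first by do 2 (rewrite big1// => ? _); rewrite mulr0.
  by rewrite E//; lia.
case: t @M E => [|t] M E; first by do 2 (rewrite big1// => ? _); rewrite mulr0.
rewrite E; last lia.
rewrite -sumrMnl; apply: eq_bigr => p _; rewrite -sumrMnl; apply: eq_bigr => q _.
by rewrite mulrnAr.
Qed.

Lemma ahat_mul_mon u v p q :
  ahat_mul u (iter q rmulb (iter p rmula v)) = iter q rmulb (iter p rmula (ahat_mul u v)).
Proof.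
elim: q => [|q IH] /=; last by rewrite ahat_mul_rmulb IH.
by elim: p => //= p IH; rewrite ahat_mul_rmula IH.
Qed.

Lemma fsum_exchange (V : lmodType K) (J : Type) (d : J -> nat)
    (F : nat -> nat -> J -> V) (c : nat -> nat -> K) (w : nat -> nat -> Ahat K) x i M :
  raises d F -> (forall s t, (s + t <= (d i).*2)%N ->
     x s t = \sum_(p < M) \sum_(q < M) c p q * w p q s t) ->
  fsum d x F i = \sum_(p < M) \sum_(q < M) c p q *: fsum d (w p q) F i.
Proof.
move=> rF E; rewrite /fsum.
under [RHS]eq_bigr do under eq_bigr do rewrite scaler_sumr.
under [RHS]eq_bigr do rewrite exchange_big.
rewrite [RHS]exchange_big; apply: eq_bigr => m _.
under [RHS]eq_bigr do under eq_bigr do rewrite scaler_sumr.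
under [RHS]eq_bigr do rewrite exchange_big.
rewrite [RHS]exchange_big; apply: eq_bigr => n _.
rewrite E; last by have := ltn_ord m; have := ltn_ord n; lia.
rewrite scaler_suml; apply: eq_bigr => p _; rewrite scaler_suml; apply: eq_bigr => q _.
by rewrite scalerA.
Qed.

Lemma ahat_mulA u v w : ahat_mul u (ahat_mul v w) = ahat_mul (ahat_mul u v) w.
Proof.
apply/funext => s; apply/funext => t.
rewrite [LHS](@fsum_exchange K^o _ tdeg (rmon u) w (fun p q => iter q rmulb (iter p rmula v))
  _ (s, t) ((s + t).*2.+1)); first last.
- move=> x y L; rewrite ahat_mulE.
  by rewrite (fsumE (M := (s + t).*2.+1) (N := (s + t).*2.+1) _ (raises_rmon v)).
- exact: raises_rmon.
rewrite [RHS](@fsumE _ _ _ tdeg w (rmon (ahat_mul u v)) (s,t) ((s + t).*2.+1) ((s + t).*2.+1));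
  [|exact: raises_rmon|rewrite /tdeg/=; lia|rewrite /tdeg/=; lia].
apply: eq_bigr => p _; apply: eq_bigr => q _; congr (_ * _).
by rewrite {2}/rmon -ahat_mul_mon.
Qed.

Lemma ahat_mulDl u v w : ahat_mul (u + v) w = ahat_mul u w + ahat_mul v w.
Proof.
rewrite !ahat_mulE.
have -> : rmon (u + v) = (fun m n => rmon u m n + rmon v m n).
  by apply/funext => p; apply/funext => q; rewrite rmonD.
by rewrite fsumDr.
Qed.
Lemma ahat_mulDr u v w : ahat_mul u (v + w) = ahat_mul u v + ahat_mul u w.
Proof. by rewrite !ahat_mulE fsumD. Qed.
Lemma ahat_mulZl c u w : ahat_mul (c *: u) w = c *: ahat_mul u w.
Proof.
rewrite !ahat_mulE.
have -> : rmon (c *: u) = (fun m n => c *: rmon u m n).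
  by apply/funext => p; apply/funext => q; rewrite rmonZ.
by rewrite fsumZr.
Qed.
Lemma ahat_mulZr c u w : ahat_mul u (c *: w) = c *: ahat_mul u w.
Proof. by rewrite !ahat_mulE fsumZl. Qed.

Lemma ahat_mulr1 u : ahat_mul u ahat_one = u.
Proof.
apply/funext => s; apply/funext => t; rewrite /ahat_mul big_ord_recl big_ord_recl /=.
rewrite /ahat_one /= mul1r !big1 ?addr0// => i _; last by rewrite mul0r.
by rewrite big1// => j _; rewrite mul0r.
Qed.

Lemma rmon1 p q s t : rmon ahat_one p q (s, t) = ((s == p) && (t == q))%:R.
Proof.
rewrite /rmon /=; elim: q s t => [|q IH] s t /=; last first.
  by case: t => [|t] /=; rewrite ?andbF//= IH eqSS.
elim: p s t => [|p IH] s t //=; rewrite /rmula.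
case: s => [|s]; case: t => [|t]; rewrite ?IH ?eqSS //= ?subr0 ?andbF ?mul0rn ?subr0//.
all: case: t => [|t]; rewrite ?mulr0n ?andbF ?mul0rn ?subr0 ?andbT //.
Qed.

Lemma ahat_mul1r u : ahat_mul ahat_one u = u.
Proof.
apply/funext => s; apply/funext => t.
have E p q : rmon ahat_one p q (s, t) = ((s == p) && (t == q))%:R by exact: rmon1.
rewrite ahat_mulE /fsum /tdeg /=.
have sM : (s < (s + t).+1)%N by lia.
have tM : (t < (s + t).+1)%N by lia.
rewrite (bigD1 (Ordinal sM))//= [X in _ + X]big1 ?addr0; last first.
  move=> i; rewrite -val_eqE /= => /negbTE iN; apply: big1 => j _.
  by rewrite E eq_sym iN scaler0.
rewrite (bigD1 (Ordinal tM))//= [X in _ + X]big1 ?addr0; last first.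
  by move=> i; rewrite -val_eqE /= => /negbTE iN; rewrite E [t == _]eq_sym iN andbF scaler0.
by rewrite E !eqxx; exact: mulr1.
Qed.

Lemma ahat_one_neq0 : ahat_one != 0.
Proof.
apply/eqP => /(congr1 (fun f : Ahat K => f 0%N 0%N)); rewrite /ahat_one /=.
by apply/eqP; exact: oner_neq0.
Qed.

End Mul.

HB.instance Definition _ (K : fieldType) := GRing.Zmodule_isNzRing.Build (Ahat K)
  (@ahat_mulA K) (@ahat_mul1r K) (@ahat_mulr1 K) (@ahat_mulDl K) (@ahat_mulDr K)
  (@ahat_one_neq0 K).
HB.instance Definition _ (K : fieldType) :=
  GRing.Lmodule_isLalgebra.Build K (Ahat K) (fun c u v => esym (ahat_mulZl c u v)).
HB.instance Definition _ (K : fieldType) :=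
  GRing.Lalgebra_isAlgebra.Build K (Ahat K) (fun c u v => esym (ahat_mulZr c u v)).

Section Elements.
Variable K : fieldType.
Implicit Types (u : Ahat K) (S T : pseries K).

Definition psvar : pseries K := fun n => (n == 1%N)%:R.
Definition psderiv S : pseries K := fun n => S n.+1 *+ n.+1.

(* The embeddings of K[[a]] and K[[b]]. *)
Definition aser S : Ahat K := fun m n => if n == 0%N then S m else 0.
Definition bser S : Ahat K := fun m n => if m == 0%N then S n else 0.
Definition ahat_a := aser psvar.
Definition ahat_b := bser psvar.

Lemma rmulbE u : u * ahat_b = rmulb u.
Proof.
have -> : ahat_b = rmulb 1.
  apply/funext => -[|m]; apply/funext => -[|[|n]]//=.
exact: etrans (ahat_mul_rmulb u 1) (congr1 _ (mulr1 u)).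
Qed.

Lemma rmulaE u : u * ahat_a = rmula u.
Proof.
have -> : ahat_a = rmula 1.
  apply/funext => -[|[|m]]; apply/funext => -[|[|n]]//=;
  by rewrite /rmula /GRing.one /= /ahat_one /= ?mul0rn ?mulr0n ?subr0.
exact: etrans (ahat_mul_rmula u 1) (congr1 _ (mulr1 u)).
Qed.

Lemma ahat_comm : ahat_a * ahat_b - ahat_b * ahat_a = ahat_b ^+ 2 :> Ahat K.
Proof.
have -> : ahat_b * ahat_a = rmula (rmulb 1) by rewrite -rmulaE -rmulbE mul1r.
have -> : ahat_a * ahat_b = rmulb (rmula 1) by rewrite -rmulaE -rmulbE mul1r.
by rewrite rmul_comm addrAC subrr add0r expr2 -!rmulbE mul1r.
Qed.

Lemma iter_rmulb q u s t :
  iter q (@rmulb K) u s t = if (q <= t)%N then u s (t - q)%N else 0.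
Proof.
elim: q t => [|q IH] [|t] //=; by rewrite IH ltnS subSS.
Qed.

Lemma mul_bser u T s t : (u * bser T) s t = \sum_(q < t.+1) u s (t - q)%N * T q.
Proof.
rewrite [LHS]/(ahat_mul u (bser T) s t) /ahat_mul big_ord_recl.
rewrite [X in _ + X]big1 ?addr0; last first.
  by move=> i _; rewrite big1// => j _; rewrite /bser /= mul0r.
rewrite (big_ord_widen (s + t).+1 (fun q => u s (t - q)%N * T q)) ?ltnS ?leq_addl//.
rewrite [RHS]big_mkcond; apply: eq_bigr => q _; rewrite /bser /= iter_rmulb ltnS.
by case: ifP; rewrite ?mulr0// mulrC.
Qed.

Lemma mul_aser_bser S T : aser S * bser T = (fun m n => S m * T n) :> Ahat K.
Proof.
apply/funext => m; apply/funext => n; rewrite mul_bser (bigD1 ord_max)//= subnn /aser eqxx.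
rewrite big1 ?addr0// => i; rewrite -val_eqE /= => ni.
have -> : (n - i == 0)%N = false by have := ltn_ord i; lia.
exact: mul0r.
Qed.

Lemma bserM S T : bser (S * T) = bser S * bser T.
Proof.
apply/funext => m; apply/funext => n; rewrite mul_bser {1}/bser.
case: eqP => [->|m0]; last first.
  by rewrite big1// => i _; rewrite /bser; case: eqP => // _; rewrite mul0r.
rewrite mulrC [LHS]/(psmul T S n); apply: eq_bigr => i _; rewrite mulrC.
by congr (_ * _).
Qed.
Lemma bserD S T : bser (S + T) = bser S + bser T.
Proof.
apply/funext => m; apply/funext => n; rewrite ahatDE /bser; case: eqP => //; rewrite addr0//.
Qed.
Lemma bser_const c : bser (psconst c) = c%:A.
Proof.
apply/funext => -[|m]; apply/funext => -[|n]; rewrite ahatZE /bser/psconst /= ?mulr1 ?mulr0//.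
Qed.

(* All the P_n are polynomials. *)
Definition tilde : {pred Ahat K} := fun u =>
  `[< forall n, exists d, forall m, (d <= m)%N -> u m n = 0 >].

Lemma tildeP u : reflect (forall n, exists d, forall m, (d <= m)%N -> u m n = 0)
  (u \in tilde).
Proof. exact: asboolP. Qed.

Lemma tilde_bound u : u \in tilde -> forall n, exists d, forall m k, (k <= n)%N -> (d <= m)%N -> u m k = 0.
Proof.
move/tildeP => H; elim=> [|n [d dP]].
  by have [d dP] := H 0%N; exists d => m k; rewrite leqn0 => /eqP->; apply: dP.
have [e eP] := H n.+1; exists (maxn d e) => m k.
rewrite leq_eqVlt => /orP[/eqP->|kn]; rewrite geq_max => /andP[dm em]; first exact: eP.
exact: dP.
Qed.

Lemma tilde_subalg : GRing.subalg_closed tilde.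
Proof.
split.
- apply/tildeP => -[|n]; [exists 1%N|exists 0%N] => -[|m]//.
- move=> c u v /tildeP uT /tildeP vT; apply/tildeP => n.
  have [d dP] := uT n; have [e eP] := vT n; exists (maxn d e) => m.
  rewrite geq_max => /andP[dm em]; rewrite ahatDE ahatZE dP// eP// mulr0 addr0//.
- move=> u v uT vT; apply/tildeP => n.
  have [d dP] := tilde_bound uT n; have [e eP] := tilde_bound vT n.
  exists (d + e)%N => m dem.
  rewrite [LHS]/(ahat_mul u v m n) /ahat_mul.
  apply: big1 => p _; apply: big1 => q _.
  rewrite iter_rmulb; case: ifPn => [qn|]; last by rewrite mulr0.
  have [ep|pe] := leqP e p; first by rewrite eP// mul0r.
  suff H k : forall x y, (d + k <= x)%N -> (y <= n)%N -> iter k (@rmula K) u x y = 0.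
    rewrite H ?mulr0//; lia.
  elim: k => [|k IH] x y; first by rewrite addn0 => ? ?; apply: dP.
  case: x => [|x]; first by lia.
  case: y => [|y] L yn /=; rewrite /rmula !IH ?mul0rn ?subr0//; lia.
Qed.
HB.instance Definition _ := GRing.isSubalgClosed.Build K (Ahat K) tilde tilde_subalg.

Record Atilde := MkAtilde { atval :> Ahat K; _ : atval \in tilde }.
HB.instance Definition _ := [isSub for atval].
HB.instance Definition _ := [Choice of Atilde by <:].
HB.instance Definition _ := [SubChoice_isSubAlgebra of Atilde by <:].

Lemma tilde_a : ahat_a \in tilde.
Proof. by apply/tildeP => -[|n]; [exists 2%N => -[|[|m]]|exists 0%N]. Qed.
Lemma tilde_bser S : bser S \in tilde.
Proof. by apply/tildeP => n; exists 1%N => -[|m]. Qed.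
Definition at_a : Atilde := MkAtilde tilde_a.
Definition at_bser S : Atilde := MkAtilde (tilde_bser S).
Definition at_b : Atilde := at_bser psvar.
End Elements.
Arguments ahat_a {K}.
Arguments ahat_b {K}.
Arguments at_a {K}.
Arguments at_b {K}.

(* Restriction of scalars along [atval]. *)
Definition tildem (K : fieldType) (M : lmodType (Ahat K)) : Type := M.
Section TildeM.
Variables (K : fieldType) (M : lmodType (Ahat K)).
HB.instance Definition _ := GRing.Zmodule.on (tildem M).
Definition tildem_scale (u : Atilde K) (x : tildem M) : tildem M := (u : Ahat K) *: (x : M).
Program Definition tildem_lmod := @GRing.Zmodule_isLmodule.Build (Atilde K) (tildem M)
  tildem_scale _ _ _ _.
Next Obligation. by move=> u v x; rewrite /tildem_scale scalerA. Qed.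
Next Obligation. by move=> x; rewrite /tildem_scale scale1r. Qed.
Next Obligation. by move=> u x y; rewrite /tildem_scale scalerDr. Qed.
Next Obligation. by move=> u x y; rewrite /tildem_scale scalerDl. Qed.
HB.instance Definition _ := tildem_lmod.
End TildeM.

(* theta_*(M): the same group, on which u acts as Theta(u) acts on M. *)
Definition pushm (K : fieldType) (Theta : {lrmorphism Ahat K -> Ahat K})
  (M : lmodType (Ahat K)) : Type := M.
Section PushM.
Variables (K : fieldType) (Theta : {lrmorphism Ahat K -> Ahat K}) (M : lmodType (Ahat K)).
HB.instance Definition _ := GRing.Zmodule.on (pushm Theta M).
Definition pushm_scale (u : Ahat K) (x : pushm Theta M) : pushm Theta M := Theta u *: (x : M).
Program Definition pushm_lmod := @GRing.Zmodule_isLmodule.Build (Ahat K) (pushm Theta M)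
  pushm_scale _ _ _ _.
Next Obligation. by move=> u v x; rewrite /pushm_scale scalerA -rmorphM. Qed.
Next Obligation. by move=> x; rewrite /pushm_scale rmorph1 scale1r. Qed.
Next Obligation. by move=> u x y; rewrite /pushm_scale scalerDr. Qed.
Next Obligation. by move=> x u v; rewrite /pushm_scale rmorphD scalerDl. Qed.
HB.instance Definition _ := pushm_lmod.
End PushM.

Definition is_submodule (A : pzRingType) (M : lmodType A) (G : set M) : Prop :=
  G 0 /\ forall (u : A) x y, G x -> G y -> G (u *: x + y).

Section ABModules.
Variable K : numClosedFieldType.

Section Lattices.
Variable L : lmodType (Atilde K).
Implicit Types (G : set L).

Definition b_comb k (e : 'I_k -> L) (S : {ffun 'I_k -> pseries K}) : L :=
  \sum_(i < k) at_bser (S i) *: e i.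

(* G is a submodule of L which is free of rank k over K[[b]]; an (a,b)-module E
   of rank k is the case [G = setT]. *)
Definition ab_module k G : Prop := is_submodule G /\
  exists e : 'I_k -> L, injective (b_comb e) /\ range (b_comb e) = G.

(* a G is contained in b G. *)
Definition simple_pole G : Prop :=
  forall x, G x -> exists2 y, G y & at_a *: x = at_b *: y.
End Lattices.

Definition regular (E : lmodType (Atilde K)) : Prop :=
  exists (F : lmodType (Atilde K)) (f : {linear E -> F}),
    [/\ exists k, ab_module k [set: F], simple_pole [set: F] & injective f].

(* j : E -> L identifies L with E[b^-1]. *)
Definition b_localization (E L : lmodType (Atilde K)) (j : {linear E -> L}) : Prop :=
  [/\ injective j, bijective (fun y : L => at_b *: y)
    & forall y : L, exists n, range j (at_b ^+ n *: y)].

(* The smallest simple pole (a,b)-module of E[b^-1] containing E. *)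
Definition sharp (E L : lmodType (Atilde K)) (j : {linear E -> L}) : set L :=
  [set y | forall G k, ab_module k G -> simple_pole G -> range j `<=` G -> G y].

(* P(T) induces 0 on G / bG. *)
Definition annihilates (L : lmodType (Atilde K)) (G : set L) (T : L -> L) (P : {poly K}) :=
  forall x, G x ->
    exists2 y, G y & \sum_(i < size P) (P`_i)%:A *: iter i T x = at_b *: y.

(* P is the minimal polynomial of T = - b^-1 a acting on E^sharp / b E^sharp,
   i.e. the monic generator of the ideal of polynomials annihilating T there. *)
Definition bernstein (E : lmodType (Atilde K)) (P : {poly K}) : Prop :=
  exists (L : lmodType (Atilde K)) (j : {linear E -> L}) (T : L -> L),
  [/\ b_localization j, forall y, at_b *: T y = - (at_a *: y), P \is monic
    & forall Q, annihilates (sharp j) T Q <-> P %| Q].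

Definition geometric (E : lmodType (Atilde K)) : Prop := regular E /\
  forall P r, bernstein E P -> root P r -> exists2 q : rat, q < 0 & r = ratr q.

Definition fresco k (E : lmodType (Atilde K)) : Prop :=
  [/\ ab_module k [set: E], geometric E & exists e : E, forall x, exists u, x = u *: e].

(* [Lam] stands for its image in Q/Z. *)
Definition primitive (Lam : set rat) (E : lmodType (Atilde K)) : Prop :=
  forall P r, bernstein E P -> root P r ->
    exists q n, Lam q /\ - r = ratr (q + n%:~R).
End ABModules.

Section Xi.
Variables (K : numClosedFieldType) (m : nat) (lam : 'I_m -> rat) (N : nat) (V : vectType K).

Definition Xi_index : Type := nat * 'I_m * 'I_N.+1.
(* [x : Xi_fun m N V] is the element
   \sum_(n, i, j) b^n e_(i,j) (x) x (n, i, j) of the direct sum over i of the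
   K[[b]]-modules with bases e_(i,0), ..., e_(i,N), tensored with V.  From
   a b^n = b^n a + n b^(n+1) and a e_(i,j) = lam_i b e_(i,j) + b e_(i,j-1), one gets
   a (b^n e_(i,j)) = (lam_i + n) b^(n+1) e_(i,j) + b^(n+1) e_(i,j-1). *)
Definition Xi_fun : Type := Xi_index -> V.
HB.instance Definition _ := GRing.Lmodule.copy Xi_fun (Xi_index -> V).

Definition Xi_a (x : Xi_fun) : Xi_fun := fun '(n, i, j) =>
  if n is n'.+1 then
    (ratr (lam i) + n'%:R) *: x (n', i, j)
      + (if insub j.+1 is Some j' then x (n', i, j') else 0)
  else 0.
Definition Xi_b (x : Xi_fun) : Xi_fun := fun '(n, i, j) =>
  if n is n'.+1 then x (n', i, j) else 0.

(* u x = \sum_(p, q) u_pq a^p b^q x, a finite sum in each coefficient since a and b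
   raise the b-degree by one. *)
Definition Xi_scale (u : Ahat K) (x : Xi_fun) : Xi_fun := fun idx =>
  \sum_(p < idx.1.1.+1) \sum_(q < idx.1.1.+1)
    u p q *: iter p Xi_a (iter q Xi_b x) idx.

Let d (i : Xi_index) := i.1.1.
Let F x p q : Xi_fun := iter p Xi_a (iter q Xi_b x).
Let ge n (x : Xi_fun) := forall i, (d i < n)%N -> x i = 0.

Lemma Xi_scaleE u x : Xi_scale u x = fsum d u (F x).
Proof. by []. Qed.

Lemma Xi_vanish_a n x : ge n x -> ge n.+1 (Xi_a x).
Proof.
move=> H [[[|k] i] j] //= L; rewrite H// scaler0 add0r.
by case: insub => // j'; rewrite H.
Qed.
Lemma Xi_vanish_b n x : ge n x -> ge n.+1 (Xi_b x).
Proof. by move=> H [[[|k] i] j] //= L; rewrite H. Qed.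
Lemma Xi_vanish_mon n x p q : ge n x -> ge (p + q + n) (F x p q).
Proof.
move=> H; rewrite /F; elim: p => [|p IH]; last exact: Xi_vanish_a.
by elim: q => [|q IH] //; exact: Xi_vanish_b.
Qed.
Lemma Xi_raises x : raises d (F x).
Proof. move=> p q i L; apply: (@Xi_vanish_mon 0) => //; by rewrite addn0. Qed.

Lemma Xi_aD x y : Xi_a (x + y) = Xi_a x + Xi_a y.
Proof.
apply/funext => -[[[|n] i] j]; rewrite !addrfctE /= ?addr0// scalerDr addrACA.
by case: insub => [j'|]; rewrite ?addr0.
Qed.
Lemma Xi_aZ c x : Xi_a (c *: x) = c *: Xi_a x.
Proof.
apply/funext => -[[[|n] i] j]; rewrite !scalrfctE /= ?scaler0// scalerDr !scalerA mulrC.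
by case: insub => [j'|]; rewrite ?scaler0.
Qed.
Lemma Xi_bD x y : Xi_b (x + y) = Xi_b x + Xi_b y.
Proof. by apply/funext => -[[[|n] i] j]; rewrite !addrfctE /= ?addr0. Qed.
Lemma Xi_bZ c x : Xi_b (c *: x) = c *: Xi_b x.
Proof. by apply/funext => -[[[|n] i] j]; rewrite !scalrfctE /= ?scaler0. Qed.
Lemma Xi_monD x y p q : F (x + y) p q = F x p q + F y p q.
Proof.
rewrite /F; have -> : iter q Xi_b (x + y) = iter q Xi_b x + iter q Xi_b y.
  by elim: q => //= q ->; rewrite Xi_bD.
by elim: p => //= p ->; rewrite Xi_aD.
Qed.
Lemma Xi_monZ c x p q : F (c *: x) p q = c *: F x p q.
Proof.
rewrite /F; have -> : iter q Xi_b (c *: x) = c *: iter q Xi_b x.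
  by elim: q => //= q ->; rewrite Xi_bZ.
by elim: p => //= p ->; rewrite Xi_aZ.
Qed.
Lemma Xi_mon0 p q : F 0 p q = 0.
Proof. by rewrite -[0 in LHS](scale0r 0) Xi_monZ scale0r. Qed.
Lemma Xi_ab x : Xi_a (Xi_b x) = Xi_b (Xi_a x) + Xi_b (Xi_b x).
Proof.
apply/funext => -[[[|[|n]] i] j]; rewrite !addrfctE /= ?addr0 ?scaler0 ?add0r//.
  by case: insub.
rewrite addrAC; congr (_ + _).
by rewrite mulrSr addrA scalerDl scale1r.
Qed.

Lemma Xi_aMn x n : Xi_a (x *+ n) = Xi_a x *+ n.
Proof.
elim: n => [|n IH]; last by rewrite !mulrS Xi_aD IH.
by rewrite !mulr0n -[0 in LHS](scale0r 0) Xi_aZ scale0r.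
Qed.
Lemma Xi_bMn x n : Xi_b (x *+ n) = Xi_b x *+ n.
Proof.
elim: n => [|n IH]; last by rewrite !mulrS Xi_bD IH.
by rewrite !mulr0n -[0 in LHS](scale0r 0) Xi_bZ scale0r.
Qed.

Lemma Xi_mon_a x p q : F (Xi_a x) p q = F x p.+1 q - F x p q.+1 *+ q.
Proof.
have H : iter q Xi_b (Xi_a x) = Xi_a (iter q Xi_b x) - iter q.+1 Xi_b x *+ q.
  elim: q => [|q IH]; first by rewrite mulr0n subr0.
  rewrite iterS IH.
  have bB y z : Xi_b (y - z) = Xi_b y - Xi_b z.
    by rewrite Xi_bD -scaleN1r Xi_bZ scaleN1r.
  rewrite bB Xi_bMn.
  have -> y : Xi_b (Xi_a y) = Xi_a (Xi_b y) - Xi_b (Xi_b y) by rewrite Xi_ab addrK.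
  by rewrite -!iterS mulrSr opprD addrA addrAC.
rewrite /F H; elim: p => //= p ->.
by rewrite Xi_aD -scaleN1r Xi_aZ scaleN1r Xi_aMn.
Qed.
Lemma Xi_mon_b x p q : F (Xi_b x) p q = F x p q.+1.
Proof. by rewrite /F iterSr. Qed.

Lemma Xi_scale_rmula u x : Xi_scale (rmula u) x = Xi_scale u (Xi_a x).
Proof.
rewrite !Xi_scaleE fsum_rmula; last exact: Xi_raises.
by congr (fsum d u _); apply/funext => p; apply/funext => q; rewrite Xi_mon_a.
Qed.
Lemma Xi_scale_rmulb u x : Xi_scale (rmulb u) x = Xi_scale u (Xi_b x).
Proof.
rewrite !Xi_scaleE fsum_rmulb; last exact: Xi_raises.
by congr (fsum d u _); apply/funext => p; apply/funext => q; rewrite Xi_mon_b.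
Qed.
Lemma Xi_scale_mon u x p q :
  Xi_scale (iter q (@rmulb K) (iter p (@rmula K) u)) x = Xi_scale u (F x p q).
Proof.
elim: q x => [|q IH] x; last by rewrite [iter q.+1 _ _]/= Xi_scale_rmulb IH Xi_mon_b.
by elim: p x => [|p IH] x //; rewrite [iter 0 _ _]/= Xi_scale_rmula [LHS]IH Xi_mon_a mulr0n subr0.
Qed.

Lemma Xi_scaleDr u : {morph Xi_scale u : x y / x + y}.
Proof.
move=> x y; rewrite !Xi_scaleE -fsumDr.
by congr (fsum d u _); apply/funext => p; apply/funext => q; rewrite Xi_monD.
Qed.
Lemma Xi_scaleDl x : {morph Xi_scale^~ x : u v / u + v}.
Proof. by move=> u v; rewrite !Xi_scaleE fsumD. Qed.
Lemma Xi_scaleZr u c x : Xi_scale u (c *: x) = c *: Xi_scale u x.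
Proof.
rewrite !Xi_scaleE -fsumZr.
by congr (fsum d u _); apply/funext => p; apply/funext => q; rewrite Xi_monZ.
Qed.

Lemma Xi_scale_ext u x y i : (forall i', (d i' <= d i)%N -> x i' = y i') ->
  Xi_scale u x i = Xi_scale u y i.
Proof.
move=> H; suff: Xi_scale u (x - y) i = 0.
  rewrite Xi_scaleDr -[- y]scaleN1r Xi_scaleZr scaleN1r => /eqP.
  by rewrite addrfctE opprfctE subr_eq0 => /eqP.
rewrite /Xi_scale; apply: big1 => p _; apply: big1 => q _.
rewrite -/(F (x - y) p q) (@Xi_vanish_mon (d i).+1) ?scaler0//; last lia.
by move=> i' L; rewrite addrfctE opprfctE H ?subrr.
Qed.

Lemma Xi_scaleA u v x : Xi_scale u (Xi_scale v x) = Xi_scale (u * v) x.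
Proof.
apply/funext => i.
pose M := (d i).*2.+1.
rewrite [X in _ = X i]Xi_scaleE (@fsum_exchange _ _ _ d (F x) (fun p q => v p q)
  (fun p q => iter q (@rmulb K) (iter p (@rmula K) u)) _ i M); first last.
- move=> s t L; transitivity (fsum tdeg v (rmon u) (s, t)); first by [].
  rewrite (fsumE (M := M) (N := M) _ (raises_rmon u))// /tdeg/M/=; lia.
- exact: Xi_raises.
have -> : \sum_(p < M) \sum_(q < M) v p q *:
     fsum d (iter q (@rmulb K) (iter p (@rmula K) u)) (F x) i =
   Xi_scale u (\sum_(p < M) \sum_(q < M) v p q *: F x p q) i.
  have S0 : Xi_scale u 0 = 0 by rewrite -[0 in LHS](scale0r 0) Xi_scaleZr scale0r.
  have S J (r : seq J) (G : J -> Xi_fun) :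
      Xi_scale u (\sum_(j <- r) G j) = \sum_(j <- r) Xi_scale u (G j).
    by elim/big_rec2: _ => [|j y z _ <-]; rewrite ?S0 ?Xi_scaleDr.
  rewrite S fct_sumE; apply: eq_bigr => p _.
  rewrite S fct_sumE; apply: eq_bigr => q _.
  by rewrite Xi_scaleZr scalrfctE -Xi_scaleE Xi_scale_mon.
apply: Xi_scale_ext => i' L; rewrite Xi_scaleE.
rewrite (fsumE (M := M) (N := M) _ (Xi_raises x)); [|rewrite /M; lia|rewrite /M; lia].
rewrite fct_sumE; apply: eq_bigr => p _.
by rewrite fct_sumE; apply: eq_bigr => q _.
Qed.

Lemma Xi_scale1 x : Xi_scale 1 x = x.
Proof.
apply/funext => i; rewrite /Xi_scale big_ord_recl big_ord_recl /=.
have o p q : (1 : Ahat K) p q = ((p == 0%N) && (q == 0%N))%:R by [].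
rewrite o scale1r !big1 ?addr0// => k _; last by rewrite o scale0r.
by apply: big1 => l _; rewrite o scale0r.
Qed.
End Xi.

(* The same group, as an Ahat-module depending on [lam]. *)
Definition Xi (K : numClosedFieldType) m (lam : 'I_m -> rat) N (V : vectType K) : Type :=
  Xi_fun m N V.
Section XiModule.
Variables (K : numClosedFieldType) (m : nat) (lam : 'I_m -> rat) (N : nat) (V : vectType K).
HB.instance Definition _ := GRing.Zmodule.on (Xi lam N V).
HB.instance Definition _ := GRing.Zmodule_isLmodule.Build (Ahat K)
  (Xi lam N V) (@Xi_scaleA K m lam N V) (@Xi_scale1 K m lam N V)
  (@Xi_scaleDr K m lam N V) (@Xi_scaleDl K m lam N V).

Lemma ahat_a_Xi (x : Xi lam N V) : ahat_a *: x = Xi_a lam x :> Xi_fun m N V.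
Proof.
rewrite -[ahat_a]mul1r rmulaE.
exact: etrans (Xi_scale_rmula lam (1 : Ahat K) (x : Xi_fun m N V)) (Xi_scale1 lam _).
Qed.
Lemma ahat_b_Xi (x : Xi lam N V) : ahat_b *: x = Xi_b x :> Xi_fun m N V.
Proof.
rewrite -[ahat_b]mul1r rmulbE.
exact: etrans (Xi_scale_rmulb lam (1 : Ahat K) (x : Xi_fun m N V)) (Xi_scale1 lam _).
Qed.
End XiModule.

Section Opens.
Variable X : topologicalType.
Record opens := Opens { oset :> set X; oset_open : open oset }.
Definition opensI (U V : opens) : opens := Opens (openI (@oset_open U) (@oset_open V)).
Lemma opensIl U V : opensI U V `<=` U. Proof. exact: subIsetl. Qed.
Lemma opensIr U V : opensI U V `<=` V. Proof. exact: subIsetr. Qed.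
Definition pt (U : set X) x (Ux : U x) : U := exist _ x (mem_set Ux).
Definition incl (U V : set X) (VU : V `<=` U) (x : V) : U :=
  pt (VU _ (set_mem (valP x))).
End Opens.

Section CSpace.
Variable K : numClosedFieldType.

(* Differentiability is K-linear Frechet differentiability: for K = R[i] and W open
   this is holomorphy. *)
Definition holomorphic_on n (W : set 'rV[K]_n) (F : 'rV[K]_n -> K) : Prop :=
  forall p, W p -> differentiable F p.

(* Z is a (closed) analytic subset of the open set W of K^n. *)
Definition analytic_subset n (W Z : set 'rV[K]_n) : Prop :=
  [/\ open W, Z `<=` W & forall p, W p -> exists W' : set 'rV[K]_n,
    [/\ open W', W' p, W' `<=` W & exists r (F : 'I_r -> 'rV[K]_n -> K),
      (forall i, holomorphic_on W' (F i)) /\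
      (forall q, W' q -> (Z q <-> forall i, F i q = 0))]].

(* h is an isomorphism from U, with its sheaf of functions, onto an analytic subset Z
   of an open set of K^n, equipped with the functions which are locally restrictions
   of holomorphic functions on K^n; g is the inverse of h. *)
Definition local_chart (X : topologicalType) (hol : forall U : opens X, set (U -> K))
    (U : opens X) : Prop :=
  exists n (W Z : set 'rV[K]_n) (h : X -> 'rV[K]_n) (g : 'rV[K]_n -> X),
  [/\ analytic_subset W Z, h @` U = Z,
      forall x, oset U x -> g (h x) = x,
      {within U, continuous h} /\ {within Z, continuous g}
    & forall (V : opens X), V `<=` U -> forall f : V -> K,
      hol V f <-> forall x : V, exists (W' : set 'rV[K]_n) (F : 'rV[K]_n -> K),
        [/\ open W', W' (h (\val x)), holomorphic_on W' F
          & forall y : V, W' (h (\val y)) -> f y = F (h (\val y))]].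

(* As the spaces are reduced, the structure sheaf is a sheaf of K-valued functions;
   [hol f] means that f : U -> K is a section of it over U.  The complex spaces are
   obtained for K = R[i] with R : realType. *)
Record complexSpace := ComplexSpace {
  cs_top :> topologicalType;
  hol : forall U : opens cs_top, set (U -> K);
  hol_const : forall (U : opens cs_top) (c : K), hol (fun _ : U => c);
  hol_sub : forall (U : opens cs_top) (f g : U -> K),
    hol f -> hol g -> hol (fun x => f x - g x);
  hol_mul : forall (U : opens cs_top) (f g : U -> K),
    hol f -> hol g -> hol (fun x => f x * g x);
  hol_res : forall (U V : opens cs_top) (VU : V `<=` U) (f : U -> K),
    hol f -> hol (f \o incl VU);
  hol_glue : forall (U : opens cs_top) (f : U -> K),
    (forall x, oset U x -> exists (V : opens cs_top) (VU : V `<=` U),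
        oset V x /\ hol (f \o incl VU)) -> hol f;
  cs_hausdorff : hausdorff_space cs_top;
  cs_chart : forall x : cs_top, exists2 U : opens cs_top, oset U x & local_chart hol U
}.

Definition holb (X : complexSpace) (U : opens X) : {pred U -> K} :=
  fun f => `[< hol f >].

Lemma hol_subring (X : complexSpace) (U : opens X) : GRing.subring_closed (@holb X U).
Proof.
split; first by apply/asboolP; exact: hol_const.
  by move=> f g /asboolP fh /asboolP gh; apply/asboolP; exact: hol_sub.
by move=> f g /asboolP fh /asboolP gh; apply/asboolP; exact: hol_mul.
Qed.

Section OX.
Variables (X : complexSpace) (U : opens X).
HB.instance Definition _ := GRing.isSubringClosed.Build (U -> K) (@holb X U) (@hol_subring X U).

Record OX := MkOX { ofun :> U -> K; _ : ofun \in @holb X U }.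
HB.instance Definition _ := [isSub for ofun].
HB.instance Definition _ := [Choice of OX by <:].
HB.instance Definition _ := GRing.SubChoice_isSubComPzRing.Build (U -> K) (@holb X U) OX (@hol_subring X U).
End OX.

Lemma OXP (X : complexSpace) (U : opens X) (f : OX U) : hol f.
Proof. by case: f => f /= /asboolP. Qed.
Definition mkOX (X : complexSpace) (U : opens X) (f : U -> K) (fh : hol f) : OX U :=
  MkOX (asboolT fh : f \in @holb X U).
Definition ores (X : complexSpace) (U V : opens X) (VU : V `<=` U) (f : OX U) : OX V :=
  mkOX (hol_res VU (OXP f)).
Definition ocst (X : complexSpace) (U : opens X) (c : K) : OX U := mkOX (hol_const U c).

Definition is_action (R : pzRingType) (M : zmodType) (act : R -> M -> M) : Prop :=
  [/\ forall x, act 1 x = x, forall r s x, act (r * s) x = act r (act s x),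
      forall r, {morph act r : x y / x + y} & forall x, {morph act^~ x : r s / r + s}].

(* [oact] is the action of O_X[[b]].  The two module structures are compatible when
   they agree on K[[b]] and when O_X commutes with Ahat. *)
Record AXsheaf (X : complexSpace) := AXSheaf {
  sec : opens X -> lmodType (Ahat K);
  res : forall (U V : opens X), V `<=` U -> {linear sec U -> sec V};
  res_id : forall (U : opens X) (UU : U `<=` U) s, res UU s = s;
  res_comp : forall (U V W : opens X) (VU : V `<=` U) (WV : W `<=` V) (WU : W `<=` U) s,
    res WV (res VU s) = res WU s;
  sec_sep : forall (U : opens X) (s t : sec U),
    (forall x, oset U x -> exists (V : opens X) (VU : V `<=` U), oset V x /\ res VU s = res VU t) ->
    s = t;
  sec_glue : forall (U : opens X) (I : Type) (V : I -> opens X)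
    (VU : forall i, V i `<=` U) (s : forall i, sec (V i)),
    (forall x, oset U x -> exists i, oset (V i) x) ->
    (forall i j (W : opens X) (Wi : W `<=` V i) (Wj : W `<=` V j),
        res Wi (s i) = res Wj (s j)) ->
    exists t : sec U, forall i, res (VU i) t = s i;
  oact : forall U : opens X, pseries (OX U) -> sec U -> sec U;
  oact_action : forall U, is_action (@oact U);
  oact_res : forall (U V : opens X) (VU : V `<=` U) (S : pseries (OX U)) (s : sec U),
    res VU (oact S s) = oact (fun n => ores VU (S n)) (res VU s);
  oact_b : forall (U : opens X) (S : pseries K) (s : sec U),
    oact (fun n => ocst U (S n)) s = bser S *: s;
  oact_comm : forall (U : opens X) (g : OX U) (u : Ahat K) (s : sec U),
    oact (psconst g) (u *: s) = u *: oact (psconst g) s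
}.

End CSpace.

Section HolTheory.
Variables (K : numClosedFieldType) (X : complexSpace K) (U : opens X).
Implicit Types f g : U -> K.
Lemma hol_opp f : hol f -> hol (fun x => - f x).
Proof.
move=> fh; have := hol_sub (hol_const U 0) fh.
by congr (hol _); apply/funext => x; rewrite sub0r.
Qed.
Lemma hol_add f g : hol f -> hol g -> hol (fun x => f x + g x).
Proof.
move=> fh gh; have := hol_sub fh (hol_opp gh).
by congr (hol _); apply/funext => x; rewrite opprK.
Qed.
Lemma hol_scale c f : hol f -> hol (fun x => c * f x).
Proof. exact: hol_mul (hol_const U c). Qed.
Lemma hol_sum (J : Type) (r : seq J) (F : J -> U -> K) :
  (forall j, hol (F j)) -> hol (fun x => \sum_(j <- r) F j x).
Proof.
move=> Fh; elim: r => [|j r IH].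
  have -> : (fun x => \sum_(j <- [::]) F j x) = (fun=> 0).
    by apply/funext => x; rewrite big_nil.
  exact: hol_const.
have -> : (fun x => \sum_(j <- j :: r) F j x) =
    (fun x => F j x + \sum_(j <- r) F j x).
  by apply/funext => x; rewrite big_cons.
exact: hol_add.
Qed.
End HolTheory.

Section XiSheaf.
Variables (K : numClosedFieldType) (X : complexSpace K).
Variables (m : nat) (lam : 'I_m -> rat) (N : nat) (V : vectType K).
Local Notation XiLNV := (Xi lam N V).
Local Notation idx := (Xi_index m N).

Section Sections.
Variable U : opens X.
Definition xhol : {pred U -> XiLNV} := fun phi =>
  `[< forall (i : idx) (l : {linear V -> K^o}), hol (fun x : U => l (phi x i)) >].

Lemma xholP (phi : U -> XiLNV) : reflect
  (forall (i : idx) (l : {linear V -> K^o}), hol (fun x : U => l (phi x i)))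
  (phi \in xhol).
Proof. exact: asboolP. Qed.

Lemma xhol_a phi : phi \in xhol -> (fun x => Xi_a lam (phi x)) \in xhol.
Proof.
move=> /xholP H; apply/xholP => -[[[|n] i] j] l /=.
  have -> : (fun x : U => l 0) = (fun x : U => 0) by apply/funext => x; rewrite raddf0.
  exact: hol_const.
case: insub => [j'|].
  have -> : (fun x : U => l ((ratr (lam i) + n%:R) *: phi x (n, i, j) + phi x (n, i, j'))) =
    (fun x : U => (ratr (lam i) + n%:R) * l (phi x (n, i, j)) + l (phi x (n, i, j'))).
    by apply/funext => x; rewrite linearP.
  by apply: hol_add; [apply: hol_scale|]; apply: H.
have -> : (fun x : U => l ((ratr (lam i) + n%:R) *: phi x (n, i, j) + 0)) =
    (fun x : U => (ratr (lam i) + n%:R) * l (phi x (n, i, j))).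
  by apply/funext => x; rewrite addr0 linearZ.
by apply: hol_scale; apply: H.
Qed.

Lemma xhol_b phi : phi \in xhol -> (fun x => Xi_b (phi x) : XiLNV) \in xhol.
Proof.
move=> /xholP H; apply/xholP => -[[[|n] i] j] l /=; last exact: H.
have -> : (fun x : U => l 0) = (fun x : U => 0) by apply/funext => x; rewrite raddf0.
exact: hol_const.
Qed.

Lemma xhol_submod : GRing.submod_closed xhol.
Proof.
split.
  apply/xholP => i l.
  have -> : (fun x : U => l ((0 : U -> XiLNV) x i)) = (fun x : U => 0).
    by apply/funext => x; rewrite raddf0.
  exact: hol_const.
move=> u phi psi ph /xholP sh; apply/xholP => i l.
have -> : (fun x : U => l ((u *: phi + psi) x i)) = (fun x : U =>
   \sum_(p < i.1.1.+1) \sum_(q < i.1.1.+1)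
     u p q * l (iter p (@Xi_a K m lam N V) (iter q (@Xi_b K m N V) (phi x)) i) + l (psi x i)).
  apply/funext => x.
  transitivity (l ((u *: phi x) i) + l (psi x i)); first exact: raddfD.
  congr (_ + _); rewrite [(u *: phi x) i]/(Xi_scale lam u (phi x) i) /Xi_scale.
  rewrite raddf_sum; apply: eq_bigr => p _; rewrite raddf_sum; apply: eq_bigr => q _.
  exact: linearZ.
apply: hol_add => //; apply: hol_sum => p; apply: hol_sum => q; apply: hol_scale.
suff /xholP : (fun x => iter p (@Xi_a K m lam N V) (iter q (@Xi_b K m N V) (phi x)) : XiLNV) \in xhol.
  exact.
elim: (nat_of_ord p) => [|p' IH]; last exact: xhol_a IH.
elim: (nat_of_ord q) => [|q' IH] //; exact: xhol_b IH.
Qed.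

Record XiSec := MkXiSec { xfun :> U -> XiLNV; _ : xfun \in xhol }.
HB.instance Definition _ := [isSub for xfun].
HB.instance Definition _ := [Choice of XiSec by <:].
HB.instance Definition _ :=
  GRing.SubChoice_isSubLmodule.Build (Ahat K) (U -> XiLNV) xhol XiSec xhol_submod.

Lemma XiSecP (s : XiSec) : xfun s \in xhol. Proof. by case: s. Qed.
Lemma XiSec_inj (s t : XiSec) : xfun s = xfun t -> s = t.
Proof. exact: val_inj. Qed.

Lemma bser_scaleE (S : pseries K) (x : XiLNV) n i j :
  (bser S *: x : XiLNV) (n, i, j) = \sum_(q < n.+1) S q *: x ((n - q)%N, i, j).
Proof.
rewrite [LHS]/(Xi_scale lam (bser S) x (n, i, j)) /Xi_scale big_ord_recl /=.
rewrite [X in _ + X]big1 ?addr0; last first.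
  by move=> p _; rewrite big1// => q _; rewrite /bser /= scale0r.
apply: eq_bigr => q _; rewrite /bser /=; congr (_ *: _).
have : (q <= n)%N by rewrite -ltnS.
elim: (nat_of_ord q) x => [|k IH] x kn; first by rewrite subn0.
rewrite iterSr IH ?(ltnW kn)// -(subnSK kn) //=.
Qed.

(* The series S = \sum_n S_n b^n of O_X(U)[[b]] acts on the value of a section at x as
   \sum_n S_n(x) b^n, see [bser_scaleE]. *)
Definition xi_oact_fun (S : pseries (OX U)) (s : XiSec) : U -> XiLNV :=
  fun x => bser (fun n => S n x) *: s x.

Lemma xi_oact_hol S s : xi_oact_fun S s \in xhol.
Proof.
apply/xholP => -[[n i] j] l.
have -> : (fun x => l (xi_oact_fun S s x (n, i, j))) =
   (fun x => \sum_(q < n.+1) S q x * l (s x ((n - q)%N, i, j))).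
  apply/funext => x; rewrite [X in l X](bser_scaleE _ (s x)) raddf_sum; apply: eq_bigr => q _.
  exact: linearZ.
by apply: hol_sum => q; apply: hol_mul; [exact: OXP|have /xholP := XiSecP s; exact].
Qed.
Definition xi_oact S s : XiSec := MkXiSec (xi_oact_hol S s).
End Sections.

Definition xi_res (U W : opens X) (WU : W `<=` U) (s : XiSec U) : XiSec W.
Proof.
apply: (@MkXiSec _ (fun x => s (incl WU x))); apply/xholP => i l.
have /xholP := XiSecP s => /(_ i l) H; exact: (hol_res WU H).
Defined.

Lemma xi_res_linear (U W : opens X) (WU : W `<=` U) : linear (xi_res WU).
Proof. by move=> u s t; apply: XiSec_inj; apply/funext => x. Qed.
HB.instance Definition _ (U W : opens X) (WU : W `<=` U) :=
  GRing.isLinear.Build (Ahat K) (XiSec U) (XiSec W) _ (xi_res WU) (xi_res_linear WU).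

Lemma pt_irr (U : set X) (x y : U) : \val x = \val y -> x = y.
Proof. exact: val_inj. Qed.

Lemma xi_sep (U : opens X) (s t : XiSec U) :
  (forall x, oset U x -> exists (W : opens X) (WU : W `<=` U),
     oset W x /\ xi_res WU s = xi_res WU t) -> s = t.
Proof.
move=> H; apply: XiSec_inj; apply/funext => x.
have [W [WU [Wx /(congr1 (fun s : XiSec W => s (pt Wx)))]]] := H _ (set_mem (valP x)).
have e : incl WU (pt Wx) = x by exact: pt_irr.
by rewrite /= e.
Qed.

Lemma xi_glue (U : opens X) (I : Type) (W : I -> opens X)
    (WU : forall i, W i `<=` U) (s : forall i, XiSec (W i)) :
    (forall x, oset U x -> exists i, oset (W i) x) ->
    (forall i j (Y : opens X) (Yi : Y `<=` W i) (Yj : Y `<=` W j),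
        xi_res Yi (s i) = xi_res Yj (s j)) ->
    exists t : XiSec U, forall i, xi_res (WU i) t = s i.
Proof.
move=> cov comp.
have /(_ _)/cid ci (x : U) := cov _ (set_mem (valP x)).
pose phi (x : U) : XiLNV := s (projT1 (ci x)) (pt (projT2 (ci x))).
have phiE i (y : W i) : phi (incl (WU i) y) = s i y.
  rewrite /phi; set j := projT1 _; set e := projT2 _.
  have oY : open (oset (W i) `&` oset (W j)) by apply: openI; [case: (W i)|case: (W j)].
  have Y1 : Opens oY `<=` W i by move=> z [].
  have Y2 : Opens oY `<=` W j by move=> z [].
  have Yy : oset (Opens oY) (\val y) by split; [exact: set_mem (valP y)|].
  have /(congr1 (fun t : XiSec (Opens oY) => t (pt Yy))) := comp i j _ Y1 Y2.
  rewrite /=; have -> : incl Y1 (pt Yy) = y by exact: pt_irr.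
  by have -> : incl Y2 (pt Yy) = pt e by exact: pt_irr.
have ph : phi \in @xhol U.
  apply/xholP => k l; apply: hol_glue => x Ux.
  have [i Wx] := cov x Ux; exists (W i), (WU i); split=> //.
  have -> : (fun x : U => l (phi x k)) \o incl (WU i) = (fun y => l (s i y k)).
    by apply/funext => y /=; rewrite phiE.
  by have /xholP := XiSecP (s i); exact.
exists (MkXiSec ph) => i; apply: XiSec_inj; apply/funext => y; exact: phiE.
Qed.

Lemma xi_oact_action (U : opens X) : is_action (@xi_oact U).
Proof.
split.
- move=> s; apply: XiSec_inj; apply/funext => x /=; rewrite /xi_oact_fun.
  have -> : (fun n => (1 : pseries (OX U)) n x) = psconst 1 :> pseries K.
    apply/funext => n; transitivity ((psconst 1 : pseries (OX U)) n x); first by [].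
    by rewrite /psconst; case: eqP.
  by rewrite bser_const scale1r scale1r.
- move=> S T s; apply: XiSec_inj; apply/funext => x /=; rewrite /xi_oact_fun /= /xi_oact_fun.
  rewrite scalerA -bserM; congr (bser _ *: _); apply/funext => n.
  transitivity (psmul S T n x); first by [].
  transitivity (psmul (fun n => S n x) (fun n => T n x) n); last by [].
  rewrite /psmul.
  have ofun_sum (r : seq 'I_n.+1) (G : 'I_n.+1 -> OX U) :
      (\sum_(j <- r) G j) x = \sum_(j <- r) G j x.
    by elim: r => [|j r IH]; rewrite ?big_nil ?big_cons //= -IH.
  exact: ofun_sum.
- move=> S s t; apply: XiSec_inj; apply/funext => x.
  exact: scalerDr.
- move=> s S T; apply: XiSec_inj; apply/funext => x.
  rewrite [LHS]/(bser _ *: _) -[RHS]/(bser _ *: s x + bser _ *: s x) -scalerDl -bserD.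
  by congr (bser _ *: _).
Qed.

Definition XiX : AXsheaf X.
Proof.
refine (@AXSheaf K X (fun U => XiSec U) (fun U W WU => xi_res WU) _ _ xi_sep xi_glue
  xi_oact xi_oact_action _ _ _).
- by move=> U UU s; apply: XiSec_inj; apply/funext => x /=; congr (s _); exact: pt_irr.
- by move=> U W Y WU YW YU s; apply: XiSec_inj; apply/funext => x /=; congr (s _); exact: pt_irr.
- by move=> U W WU S s; apply: XiSec_inj; apply/funext => x.
- by move=> U S s; apply: XiSec_inj; apply/funext => x.
- move=> U g u s; apply: XiSec_inj; apply/funext => x /=.
  have E : (fun n => psconst g n x) = psconst (g x) :> pseries K.
    by apply/funext => n; rewrite /psconst; case: eqP.
  rewrite [LHS]/(bser (fun n => psconst g n x) *: (u *: s x)).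
  rewrite [RHS]/(u *: (bser (fun n => psconst g n x) *: s x)).
  rewrite E bser_const; apply: etrans (scalerA _ _ _) _; apply: etrans _ (esym (scalerA _ _ _)).
  by congr (_ *: _); rewrite mulr_algl mulr_algr.
Defined.

End XiSheaf.

(* The value E(x) = E / M_x E: germs at x of sections of E, modulo the finite sums of
   g t with g a germ of O_X vanishing at x and t a germ of E. *)
Section Value.
Variables (K : numClosedFieldType) (X : complexSpace K) (E : AXsheaf X) (x : X).

Definition in_maximal (U : opens X) (Ux : oset U x) (s : sec E U) : Prop :=
  exists r (g : 'I_r -> OX U) (t : 'I_r -> sec E U),
    (forall i, g i (pt Ux) = 0) /\ s = \sum_(i < r) oact (psconst (g i)) (t i).

Record germ := Germ { gset : opens X; gpt : oset gset x; gsec : sec E gset }.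
HB.instance Definition _ := gen_eqMixin germ.
HB.instance Definition _ := gen_choiceMixin germ.

Definition value_eq (p q : germ) : Prop :=
  exists (W : opens X) (Wx : oset W x) (Wp : W `<=` gset p) (Wq : W `<=` gset q),
    in_maximal Wx (res E Wp (gsec p) - res E Wq (gsec q)).

Lemma oact0 (U : opens X) (S : pseries (OX U)) : oact S (0 : sec E U) = 0.
Proof.
have [_ _ H _] := oact_action E U; have := H S 0 0; rewrite addr0 => h.
by apply: (addrI (oact S (0 : sec E U))); rewrite addr0 -h.
Qed.
Lemma oactN (U : opens X) (S : pseries (OX U)) (s : sec E U) : oact S (- s) = - oact S s.
Proof.
have [_ _ H _] := oact_action E U; apply: (addrI (oact S s)).
by rewrite -H !subrr oact0.
Qed.

Lemma ores_const (U W : opens X) (WU : W `<=` U) (g : OX U) :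
  (fun n => ores WU (psconst g n)) = psconst (ores WU g).
Proof.
apply/funext => n; rewrite /psconst; case: eqP => // _.
by apply: val_inj; apply/funext => y.
Qed.

Lemma in_maximal_res (U W : opens X) (WU : W `<=` U) (Ux : oset U x) (Wx : oset W x) s :
  in_maximal Ux s -> in_maximal Wx (res E WU s).
Proof.
move=> [r [g [t [g0 ->]]]].
exists r, (fun i => ores WU (g i)), (fun i => res E WU (t i)); split.
  by move=> i; rewrite /= -[RHS](g0 i); congr (g i _); exact: pt_irr.
rewrite raddf_sum; apply: eq_bigr => i _; rewrite /= oact_res; congr (oact _ _).
exact: ores_const.
Qed.

Lemma in_maximal0 (U : opens X) (Ux : oset U x) : in_maximal Ux (0 : sec E U).
Proof.
exists 0%N, (fun=> 0), (fun=> 0); split; first by case.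
by rewrite big_ord0.
Qed.

Lemma in_maximalD (U : opens X) (Ux : oset U x) (s t : sec E U) :
  in_maximal Ux s -> in_maximal Ux t -> in_maximal Ux (s + t).
Proof.
move=> [r [g [s' [g0 ->]]]] [r' [h [t' [h0 ->]]]].
exists (r + r')%N,
  (fun i => match fintype.split i with inl j => g j | inr j => h j end),
  (fun i => match fintype.split i with inl j => s' j | inr j => t' j end); split.
  by move=> i; case: (fintype.split i).
rewrite big_split_ord /=; congr (_ + _); apply: eq_bigr => i _.
  by rewrite -[lshift _ _]/(unsplit (inl i)) unsplitK.
by rewrite -[rshift _ _]/(unsplit (inr i)) unsplitK.
Qed.

Lemma in_maximalZ (U : opens X) (Ux : oset U x) (u : Ahat K) (s : sec E U) :
  in_maximal Ux s -> in_maximal Ux (u *: s).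
Proof.
move=> [r [g [t [g0 ->]]]]; exists r, g, (fun i => u *: t i); split => //.
by rewrite scaler_sumr; apply: eq_bigr => i _; rewrite oact_comm.
Qed.
Lemma in_maximalN (U : opens X) (Ux : oset U x) (s : sec E U) :
  in_maximal Ux s -> in_maximal Ux (- s).
Proof. by rewrite -scaleN1r; exact: in_maximalZ. Qed.

Lemma value_eq_refl : forall p, value_eq p p.
Proof.
move=> [U Ux s]; exists U, Ux, (@subset_refl _ _), (@subset_refl _ _).
by rewrite subrr; exact: in_maximal0.
Qed.
Lemma value_eq_sym p q : value_eq p q -> value_eq q p.
Proof.
move=> [W [Wx [Wp [Wq H]]]]; exists W, Wx, Wq, Wp.
by rewrite -opprB; exact: in_maximalN.
Qed.
Lemma value_eq_trans q p r : value_eq p q -> value_eq q r -> value_eq p r.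
Proof.
move=> [W [Wx [Wp [Wq H]]]] [Y [Yx [Yq [Yr H']]]].
have I1 : opensI W Y `<=` W by move=> z [].
have I2 : opensI W Y `<=` Y by move=> z [].
exists (opensI W Y), (conj Wx Yx : oset (opensI W Y) x), (subset_trans I1 Wp), (subset_trans I2 Yr).
have := in_maximalD (in_maximal_res I1 (conj Wx Yx : oset (opensI W Y) x) H)
  (in_maximal_res I2 (conj Wx Yx : oset (opensI W Y) x) H').
rewrite !raddfB /=.
rewrite (res_comp Wp I1 (subset_trans I1 Wp)) (res_comp Wq I1 (subset_trans I1 Wq)).
rewrite (res_comp Yq I2 (subset_trans I1 Wq)) (res_comp Yr I2 (subset_trans I2 Yr)).
by rewrite addrA subrK.
Qed.

Definition value_eqb : rel germ := fun p q => `[< value_eq p q >].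
Lemma value_eqb_equiv : equiv_class_of value_eqb.
Proof.
split.
- by move=> p; apply/asboolP; exact: value_eq_refl.
- by move=> p q; apply/asboolP/asboolP; exact: value_eq_sym.
- move=> q p r /asboolP pq /asboolP qr; apply/asboolP; exact: value_eq_trans pq qr.
Qed.
Canonical value_equiv := EquivRelPack value_eqb_equiv.

Definition value : Type := {eq_quot value_eqb}.
HB.instance Definition _ := Choice.on value.

Definition cls (U : opens X) (Ux : oset U x) (s : sec E U) : value := \pi_value (Germ Ux s).

Lemma clsE (U W : opens X) (Ux : oset U x) (Wx : oset W x) s t :
  cls Ux s = cls Wx t <-> value_eq (Germ Ux s) (Germ Wx t).
Proof.
split; first by move/eqP; rewrite eqmodE => /asboolP.
by move=> H; apply/eqP; rewrite eqmodE; apply/asboolP.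
Qed.

Lemma cls_res (U W : opens X) (WU : W `<=` U) (Ux : oset U x) (Wx : oset W x) s :
  cls Wx (res E WU s) = cls Ux s.
Proof.
apply/clsE; exists W, Wx, (@subset_refl _ _), WU => /=.
by rewrite res_id subrr; exact: in_maximal0.
Qed.

Lemma cls_surj (v : value) : exists (U : opens X) (Ux : oset U x) s, v = cls Ux s.
Proof.
elim/quotW: v => -[U Ux s]; by exists U, Ux, s.
Qed.

Lemma cls_surj2 (v w : value) : exists (U : opens X) (Ux : oset U x) s t,
  v = cls Ux s /\ w = cls Ux t.
Proof.
have [U [Ux [s ->]]] := cls_surj v; have [W [Wx [t ->]]] := cls_surj w.
have I1 : opensI U W `<=` U by move=> z [].
have I2 : opensI U W `<=` W by move=> z [].
pose Ix : oset (opensI U W) x := conj Ux Wx.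
by exists (opensI U W), Ix, (res E I1 s), (res E I2 t); rewrite !cls_res.
Qed.

Lemma cls_eq (U : opens X) (Ux : oset U x) s t :
  cls Ux s = cls Ux t <-> exists (W : opens X) (Wx : oset W x) (WU : W `<=` U),
    in_maximal Wx (res E WU (s - t)).
Proof.
rewrite clsE; split => [[W [Wx [Wp [Wq]]]]|[W [Wx [WU H]]]].
  by rewrite /= (Prop_irrelevance Wq Wp) -raddfB => H; exists W, Wx, Wp.
by exists W, Wx, WU, WU; rewrite /= -raddfB.
Qed.

Definition germ_add (p q : germ) : germ :=
  Germ (conj (gpt p) (gpt q) : oset (opensI (gset p) (gset q)) x)
    (res E (@opensIl _ (gset p) (gset q)) (gsec p) + res E (@opensIr _ (gset p) (gset q)) (gsec q)).
Definition germ_scale (u : Ahat K) (p : germ) : germ := Germ (gpt p) (u *: gsec p).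

Definition value_zero : value := @cls (Opens openT) I 0.
Definition value_add (v w : value) : value := \pi_value (germ_add (repr v) (repr w)).
Definition value_scale (u : Ahat K) (v : value) : value := \pi_value (germ_scale u (repr v)).
Definition value_opp (v : value) : value := value_scale (- 1) v.

Lemma cls_repr (v : value) : cls (gpt (repr v)) (gsec (repr v)) = v.
Proof. by rewrite /cls; case: (repr v) (reprK v) => U Ux s /= ->. Qed.

Lemma cls_add (U : opens X) (Ux : oset U x) s t :
  value_add (cls Ux s) (cls Ux t) = cls Ux (s + t).
Proof.
rewrite /value_add; set p := repr _; set q := repr _.
have : cls (gpt p) (gsec p) = cls Ux s by rewrite cls_repr.
have : cls (gpt q) (gsec q) = cls Ux t by rewrite cls_repr.
move=> /clsE[W [Wx [Wq [WU H]]]] /clsE[Y [Yx [Yp [YU H']]]].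
rewrite -[LHS]/(cls _ _); apply/clsE.
have I1 : opensI W Y `<=` W by move=> z [].
have I2 : opensI W Y `<=` Y by move=> z [].
have I3 : opensI W Y `<=` gset (germ_add p q) by move=> z [/Wq ? /Yp ?].
pose Ix : oset (opensI W Y) x := conj Wx Yx.
exists (opensI W Y), Ix, I3, (subset_trans I1 WU) => /=.
have := in_maximalD (in_maximal_res I2 Ix H') (in_maximal_res I1 Ix H).
rewrite !raddfB /= raddfD /= raddfD /=.
rewrite (res_comp YU I2 (subset_trans I1 WU)) (res_comp WU I1 (subset_trans I1 WU)).
rewrite (res_comp Yp I2 (subset_trans I2 Yp)) (res_comp Wq I1 (subset_trans I1 Wq)).
rewrite (res_comp _ I3 (subset_trans I2 Yp)) (res_comp _ I3 (subset_trans I1 Wq)).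
by rewrite addrACA opprD.
Qed.

Lemma cls_scale u (U : opens X) (Ux : oset U x) s :
  value_scale u (cls Ux s) = cls Ux (u *: s).
Proof.
rewrite /value_scale; set p := repr _.
have : cls (gpt p) (gsec p) = cls Ux s by rewrite cls_repr.
move=> /clsE[W [Wx [Wp [WU H]]]]; apply/clsE; exists W, Wx, Wp, WU => /=.
have -> : res E Wp (u *: gsec p) - res E WU (u *: s) =
    u *: (res E Wp (gsec p) - res E WU s) by rewrite scalerBr !linearZ.
exact: in_maximalZ.
Qed.

Lemma cls_surj3 (v w z : value) : exists (U : opens X) (Ux : oset U x) s t r,
  [/\ v = cls Ux s, w = cls Ux t & z = cls Ux r].
Proof.
have [U [Ux [s [t [-> ->]]]]] := cls_surj2 v w; have [W [Wx [r ->]]] := cls_surj z.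
have I1 : opensI U W `<=` U by move=> y [].
have I2 : opensI U W `<=` W by move=> y [].
pose Ix : oset (opensI U W) x := conj Ux Wx.
by exists (opensI U W), Ix, (res E I1 s), (res E I1 t), (res E I2 r); rewrite !cls_res.
Qed.

Lemma cls_zero (U : opens X) (Ux : oset U x) : cls Ux 0 = value_zero.
Proof.
by rewrite /value_zero -(@cls_res (Opens openT) U (fun _ _ => I) I Ux) raddf0.
Qed.

Lemma value_addA : associative value_add.
Proof.
move=> v w z; have [U [Ux [s [t [r [-> -> ->]]]]]] := cls_surj3 v w z.
by rewrite !cls_add addrA.
Qed.
Lemma value_addC : commutative value_add.
Proof.
by move=> v w; have [U [Ux [s [t [-> ->]]]]] := cls_surj2 v w; rewrite !cls_add addrC.
Qed.
Lemma value_add0 : left_id value_zero value_add.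
Proof.
by move=> v; have [U [Ux [s ->]]] := cls_surj v; rewrite -(cls_zero Ux) cls_add add0r.
Qed.
Lemma value_addN : left_inverse value_zero value_opp value_add.
Proof.
move=> v; have [U [Ux [s ->]]] := cls_surj v.
by rewrite /value_opp cls_scale cls_add scaleN1r addNr cls_zero.
Qed.
HB.instance Definition _ :=
  GRing.isZmodule.Build value value_addA value_addC value_add0 value_addN.

Lemma value_scaleA u v p : value_scale u (value_scale v p) = value_scale (u * v) p.
Proof. by have [U [Ux [s ->]]] := cls_surj p; rewrite !cls_scale scalerA. Qed.
Lemma value_scale1 : left_id 1 value_scale.
Proof. by move=> p; have [U [Ux [s ->]]] := cls_surj p; rewrite !cls_scale scale1r. Qed.
Lemma value_scaleDr : right_distributive value_scale +%R.
Proof.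
move=> u v w; have [U [Ux [s [t [-> ->]]]]] := cls_surj2 v w.
rewrite -[_ + _]/(value_add _ _) -[RHS]/(value_add _ _).
by rewrite !(cls_add, cls_scale) scalerDr.
Qed.
Lemma value_scaleDl p : {morph value_scale^~ p : u v / u + v}.
Proof.
move=> u v; have [U [Ux [s ->]]] := cls_surj p.
by rewrite -[RHS]/(value_add _ _) !(cls_add, cls_scale) scalerDl.
Qed.
HB.instance Definition _ := GRing.Zmodule_isLmodule.Build (Ahat K) value
  value_scaleA value_scale1 value_scaleDr value_scaleDl.
End Value.

Section Families.
Variables (K : numClosedFieldType) (X : complexSpace K).

(* [G U], for U contained in U0, are the sections over U of a sub-Ahat_X-sheaf of the
   restriction of F to U0; the values of G at other open sets are irrelevant. *)
Definition sub_sheaf (F : AXsheaf X) (U0 : opens X)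
    (G : forall U : opens X, set (sec F U)) : Prop :=
  forall U : opens X, U `<=` U0 ->
  [/\ is_submodule (G U),
      forall (S : pseries (OX U)) s, G U s -> G U (oact S s),
      forall (V : opens X) (VU : V `<=` U) s, G U s -> G V (res F VU s)
    & forall s, (forall x, oset U x -> exists (V : opens X) (VU : V `<=` U),
        oset V x /\ G V (res F VU s)) -> G U s].

Definition generated (F : AXsheaf X) (U0 : opens X) (phi : sec F U0)
    (U : opens X) : set (sec F U) :=
  [set s | forall G, sub_sheaf U0 G -> G U0 phi -> G U s].

Definition O_comb (F : AXsheaf X) (U : opens X) (phi : sec F U) k
    (S : 'I_k -> pseries (OX U)) : sec F U :=
  \sum_(i < k) oact (S i) (ahat_a ^+ i *: phi).

Section Admissible.
Variables (m : nat) (lam : 'I_m -> rat) (N : nat) (V : vectType K).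

Definition xi_ev (U : opens X) (x : X) (Ux : oset U x)
    (s : sec (XiX X lam N V) U) : Xi lam N V := xfun s (pt Ux).

(* ev_x of the sheaf generated by phi: values at x of its sections near x. *)
Definition ev_image (U0 : opens X) (phi : sec (XiX X lam N V) U0) (x : X) :
    set (Xi lam N V) :=
  [set y | exists (U : opens X) (Ux : oset U x) (s : sec (XiX X lam N V) U),
    [/\ U `<=` U0, generated phi s & y = xi_ev Ux s]].

Definition k_admissible k (U0 : opens X) (phi : sec (XiX X lam N V) U0) : Prop :=
  (forall (U : opens X) (UU0 : U `<=` U0),
     injective (@O_comb _ U (res _ UU0 phi) k) /\
     range (@O_comb _ U (res _ UU0 phi) k) = generated phi (U:=U)) /\
  (forall x, oset U0 x ->
     exists (M : lmodType (Ahat K)) (f : {linear M -> Xi lam N V}),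
       [/\ injective f, range f = ev_image phi x & fresco k (tildem M)]).
End Admissible.

(* G, a sub-sheaf of F over U0, is isomorphic to the restriction of E to U0. *)
Definition iso_over (E F : AXsheaf X) (U0 : opens X)
    (G : forall U : opens X, set (sec F U)) : Prop :=
  exists f : forall U : opens X, {linear sec E U -> sec F U},
  forall U : opens X, U `<=` U0 ->
  [/\ injective (f U), range (f U) = G U,
      forall (S : pseries (OX U)) s, f U (oact S s) = oact S (f U s)
    & forall (V : opens X) (VU : V `<=` U) s, f V (res E VU s) = res F VU (f U s)].

Definition holomorphic_family k (E : AXsheaf X) : Prop :=
  forall x : X, exists2 U0 : opens X, oset U0 x &
    exists m (lam : 'I_m -> rat) N (V : vectType K) (phi : sec (XiX X lam N V) U0),
    [/\ injective lam, forall i, 0 < lam i <= 1, k_admissible k phi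
      & iso_over E U0 (generated phi)].

(* F is the sheaf E with unchanged O_X-structure and Ahat acting through Theta.  Its
   O_X[[b]]-structure is not carried over from E, as b now acts as Theta(b). *)
Definition theta_pushforward (Theta : {lrmorphism Ahat K -> Ahat K})
    (E F : AXsheaf X) : Prop :=
  exists f : forall U : opens X, {linear pushm Theta (sec E U) -> sec F U},
  forall U : opens X,
  [/\ bijective (f U),
      forall (g : OX U) (s : sec E U), f U (oact (psconst g) s) = oact (psconst g) (f U s)
    & forall (V : opens X) (VU : V `<=` U) (s : sec E U),
        f V (res E VU s) = res F VU (f U s)].
End Families.

Definition isomorphic (A : pzRingType) (M N : lmodType A) : Prop :=
  exists f : {linear M -> N}, bijective f.

Definition change_of_variable (K : fieldType) (theta : pseries K) : Prop :=
  theta 0%N = 0 /\ theta 1%N != 0.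

(* Continuity for the (a,b)-adic topology, i.e. the filtration by total degree. *)
Definition ab_continuous (K : fieldType) (Theta : Ahat K -> Ahat K) : Prop :=
  forall u n, exists n', forall v,
    (forall s t, (s + t < n')%N -> v s t = u s t) ->
    forall s t, (s + t < n)%N -> Theta v s t = Theta u s t.

Definition induced_automorphism (K : fieldType) (theta : pseries K)
    (Theta : {lrmorphism Ahat K -> Ahat K}) : Prop :=
  [/\ bijective Theta, ab_continuous Theta, Theta ahat_a = aser theta
    & Theta ahat_b = ahat_b * aser (psderiv theta)].

(* Main.v *)
(* Write a' = Theta(a) = theta(a) and b' = Theta(b) = b theta'(a).  Three facts give the theorem.

   Xi is stable under change of variable.  Thinking of e_(i,j) as s^(lam_i-1) (log s)^j / j!,
   with a acting as multiplication by s and b as integration, composition with the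
   inverse eta of theta is an injective map Psi from Xi to itself with
   Psi(Theta(u) x) = u Psi(x).  Hence Psi turns a section phi which is admissible for (a, b)
   into a section generating an (a, b)-stable sheaf isomorphic to theta_*.

   Bases are transported.  In a fresco of rank k, a is nilpotent modulo b (a is topologically
   nilpotent on Xi, and Artin-Rees applies), so 1, a, ..., a^(k-1) applied to a generator form
   a basis modulo b.  As theta(a) is a unit times a, and b' and b generate the same ideal, the
   powers of a' form a basis modulo b' as well, and by completeness a basis over O[[b']].
   In a family the coefficients of a^k phi modulo b are functions vanishing at each point,
   hence zero, and the same argument applies.

   Every lattice in Xi is geometric.  If E embeds in Xi, then so does E^sharp, and Artin-Rees
   shows that a product of factors (T + lam_i + l), l >= 0, annihilates E^sharp / b E^sharp. *)
Require Import Defs.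
From HB Require Import structures.
From mathcomp Require Import all_boot all_order all_algebra complex.
From mathcomp Require Import all_classical reals topology normedtype derive.
From mathcomp Require Import ring zify.
Set Implicit Arguments.
Unset Strict Implicit.
Unset Printing Implicit Defensive.
Import Order.TTheory GRing.Theory Num.Theory numFieldNormedType.Exports.
Local Open Scope ring_scope.
Local Open Scope classical_set_scope.

(** * Power series and the algebra Ahat *)

(** The obstacle is the action of [O_X[[b]]] on the pushed sheaf. As b now acts as b' = Theta(b), a
    series sum g_n b^n with holomorphic coefficients has to act as sum g_n b'^n, and this sum must
    be constructed. It exists where E has a finite basis over [O_X[[b]]], hence a priori only
    locally; it is formed on small open sets and glued, b-adic separation giving uniqueness. No
    limits are used for such sums: a b-adic sum is a sequence of tails tau_n = x_n + b tau_(n+1),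
    and two sums are compared by showing that their difference satisfies D_n = b D_(n+1), so that it
    lies in every b^n M. A second point concerns the values. E(x) is a quotient of germs and not
    given inside Xi, whereas geometricity is proved by embedding in Xi. Evaluation at x maps E(x)
    onto a submodule of Xi that is also free of rank k over K[[b]]; a surjection between free
    modules of equal rank is injective. *)

Definition psshift (O : comPzRingType) (f : pseries O) : pseries O := fun n => f n.+1.

Section PowerSeriesLemmas.
Variable K : fieldType.
Implicit Types f g h : pseries K.

Lemma psmulXE f n : (psvar K * f : pseries K) n = if n is n'.+1 then f n' else 0.
Proof.
rewrite [LHS]/(psmul (psvar K) f n) /psmul /psvar big_ord_recl mul0r add0r.
case: n => [|n]; first by rewrite big_ord0.
by rewrite big_ord_recl /= mul1r subSS subn0 big1 ?addr0// => i _; rewrite mul0r.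
Qed.
End PowerSeriesLemmas.

Section AhatLemmas.
Variable K : fieldType.
Implicit Types (u v w : Ahat K) (S T : pseries K).

Lemma ahatP u v : (forall s t, u s t = v s t) -> u = v.
Proof. by move=> H; apply/funext => s; apply/funext => t. Qed.

Lemma ahatBE u v s t : (u - v) s t = u s t - v s t. Proof. by []. Qed.
Lemma ahatNE u s t : (- u) s t = - u s t. Proof. by []. Qed.

Lemma ahat_sumE I (r : seq I) (P : pred I) (F : I -> Ahat K) s t :
  (\sum_(i <- r | P i) F i) s t = \sum_(i <- r | P i) F i s t.
Proof. by elim/big_rec2: _ => // i x y _ <-. Qed.

Lemma ahat_mulbE u s t : (u * ahat_b) s t = if t is t'.+1 then u s t' else 0.
Proof. by rewrite rmulbE. Qed.

Lemma iter_rmula_a p : iter p (@rmula K) ahat_a = iter p.+1 (@rmula K) 1.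
Proof. by rewrite iterSr -rmulaE mul1r. Qed.

Lemma ahat_amulE u s t : (ahat_a * u) s t = if s is s'.+1 then u s' t else 0.
Proof.
rewrite [LHS]/(ahat_mul ahat_a u s t) /ahat_mul.
have E p q : iter q (@rmulb K) (iter p (@rmula K) ahat_a) s t = ((s == p.+1) && (t == q))%:R.
  by rewrite iter_rmula_a -[LHS]/(rmon 1 p.+1 q (s, t)) rmon1.
under eq_bigr do under eq_bigr do rewrite E.
case: s {E} => [|s].
  by rewrite big1// => p _; rewrite big1// => q _; rewrite mulr0.
have sM : (s < (s.+1 + t).+1)%N by lia.
have tM : (t < (s.+1 + t).+1)%N by lia.
rewrite (bigD1 (Ordinal sM))//= [X in _ + X]big1 ?addr0; last first.
  move=> i; rewrite -val_eqE /= => /negbTE iN; apply: big1 => j _.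
  by rewrite eqSS eq_sym iN mulr0.
rewrite (bigD1 (Ordinal tM))//= [X in _ + X]big1 ?addr0 ?eqxx ?mulr1//.
by move=> i; rewrite -val_eqE /= => /negbTE iN; rewrite [t == _]eq_sym iN ?andbF mulr0.
Qed.

Lemma vanishes0 u : vanishes_below 0 u. Proof. by []. Qed.

Lemma vanishes_le N M u : (M <= N)%N -> vanishes_below N u -> vanishes_below M u.
Proof. by move=> MN H s t L; apply: H; apply: leq_trans MN. Qed.

Lemma vanishesD N u v : vanishes_below N u -> vanishes_below N v -> vanishes_below N (u + v).
Proof. by move=> H H' s t L; rewrite ahatDE H ?H' ?addr0. Qed.

Lemma vanishesN N u : vanishes_below N u -> vanishes_below N (- u).
Proof. by move=> H s t L; rewrite ahatNE H ?oppr0. Qed.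

Lemma vanishesB N u v : vanishes_below N u -> vanishes_below N v -> vanishes_below N (u - v).
Proof. by move=> H H'; apply: vanishesD => //; apply: vanishesN. Qed.

Lemma vanishesM M N u v : vanishes_below M u -> vanishes_below N v ->
  vanishes_below (M + N) (u * v).
Proof.
move=> uM vN s t L; rewrite [LHS]/(ahat_mul u v s t) /ahat_mul.
apply: big1 => p _; apply: big1 => q _.
have [pq|pq] := ltnP (p + q) N; first by rewrite vN// mul0r.
by rewrite (vanishes_iter (N := M))// ?mulr0//; lia.
Qed.

Lemma vanishesX N u n : vanishes_below N u -> vanishes_below (n * N) (u ^+ n).
Proof.
move=> H; elim: n => [|n IH]; first exact: vanishes0.
by rewrite exprS mulSn; apply: vanishesM.
Qed.

Lemma vanishes_eq u v : (forall N, vanishes_below N (u - v)) -> u = v.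
Proof.
move=> H; apply: ahatP => s t; apply/eqP; rewrite -subr_eq0; apply/eqP.
exact: (H (s + t).+1).
Qed.

Lemma vanishes_a : vanishes_below 1 (ahat_a : Ahat K).
Proof. by case=> [|s] [|t]. Qed.
Lemma vanishes_b : vanishes_below 1 (ahat_b : Ahat K).
Proof. by case=> [|s] [|t]. Qed.

(** Left multiplication by a and right multiplication by b are both shifts of coefficients, so the
    two quotients can be written down; this permits induction on the order. *)
Lemma vanishes_split N u : vanishes_below N.+1 u ->
  exists u1 u2, [/\ u = ahat_a * u1 + u2 * ahat_b, vanishes_below N u1 & vanishes_below N u2].
Proof.
move=> H; exists (fun s t => u s.+1 t), (fun s t => if s == 0%N then u s t.+1 else 0); split.
- apply: ahatP => s t; rewrite ahatDE ahat_amulE ahat_mulbE.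
  by case: s => [|s]; case: t => [|t]; rewrite ?addr0 ?add0r// H.
- by move=> s t L; apply: H; lia.
- by move=> s t L; case: eqP => // ->; apply: H; lia.
Qed.

Lemma ahat_split u : exists v, u = aser (fun s => u s 0%N) + v * ahat_b.
Proof.
exists (fun s t => u s t.+1); apply: ahatP => s t.
by rewrite ahatDE ahat_mulbE /aser; case: t => [|t]; rewrite ?addr0 ?add0r.
Qed.

Lemma mulb_inj u v : u * ahat_b = v * ahat_b -> u = v.
Proof.
move=> H; apply: ahatP => s t; have := congr1 (fun w : Ahat K => w s t.+1) H.
by rewrite !ahat_mulbE.
Qed.

Lemma aserD S T : aser (S + T) = aser S + aser T.
Proof. by apply: ahatP => s [|t]; rewrite ahatDE /aser ?addr0. Qed.

Lemma aser_const (c : K) : aser (psconst c) = c%:A.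
Proof.
by apply: ahatP => -[|s] [|t]; rewrite ahatZE /aser/psconst /= ?mulr1 ?mulr0.
Qed.
Lemma aser1 : aser 1 = 1 :> Ahat K.
Proof. exact: etrans (aser_const 1) (scale1r _). Qed.

Lemma iter_rmula_aser p S s t :
  iter p (@rmula K) (aser S) s t = if (p <= s)%N then aser S (s - p)%N t else 0.
Proof.
elim: p s t => [|p IH] s t; first by rewrite subn0.
rewrite iterS /rmula; case: s => [|s]; case: t => [|t]; rewrite ?IH ?ltnS ?subSS ?subr0 ?sub0r//=.
  by case: t => [|t]; rewrite ?mulr0n ?oppr0//= /aser /=; case: ifP; rewrite ?mul0rn ?oppr0.
case: t => [|t]; rewrite /aser/= ?mulr0n ?subr0//.
by case: ifP => _; case: ifP => _; rewrite ?mul0rn ?subr0.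
Qed.

Lemma mul_aserE u T s t : (u * aser T) s t =
  \sum_(p < (s + t).+1) T p * iter p (@rmula K) u s t.
Proof.
rewrite [LHS]/(ahat_mul u (aser T) s t) /ahat_mul; apply: eq_bigr => p _.
rewrite big_ord_recl big1 ?addr0// => q _.
by rewrite /aser /= mul0r.
Qed.

Lemma aserM S T : aser (S * T) = aser S * aser T.
Proof.
apply: ahatP => s t; rewrite mul_aserE.
under eq_bigr do rewrite iter_rmula_aser.
case: t => [|t]; last first.
  by rewrite /aser/= big1// => i _; case: ifP; rewrite mulr0.
rewrite addn0 mulrC [LHS]/(psmul T S s); apply: eq_bigr => i _.
by rewrite -ltnS ltn_ord.
Qed.

Lemma aserX S n : aser (S ^+ n) = aser S ^+ n.
Proof. by elim: n => [|n IH]; rewrite ?expr0 ?aser1// !exprS aserM IH. Qed.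

Lemma aser_sum I (r : seq I) (P : pred I) (F : I -> pseries K) :
  aser (\sum_(i <- r | P i) F i) = \sum_(i <- r | P i) aser (F i).
Proof.
apply: (big_morph _ aserD).
by apply: ahatP => s t; rewrite /aser; case: eqP.
Qed.

Lemma aser_trunc S N :
  vanishes_below N (aser S - \sum_(i < N) S i *: ahat_a ^+ i).
Proof.
have E i s t : (ahat_a ^+ i : Ahat K) s t = ((s == i) && (t == 0%N))%:R.
  elim: i s t => [|i IH] s t; first by [].
  by rewrite exprS ahat_amulE; case: s => [|s]; rewrite ?eqSS.
move=> s t L; rewrite ahatBE ahat_sumE.
have sN : (s < N)%N by lia.
under eq_bigr do rewrite ahatZE E.
rewrite (bigD1 (Ordinal sN))//= eqxx /aser /=; case: eqP => /= _.
  rewrite mulr1 big1 ?addr0 ?subrr// => i; rewrite -val_eqE /= eq_sym => /negbTE->.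
  by rewrite mulr0.
rewrite mulr0 big1 => [|i _]; last by rewrite andbF mulr0.
by rewrite addr0 subr0.
Qed.

Lemma aser_split S : aser S = (S 0%N)%:A + ahat_a * aser (psshift S).
Proof.
apply: ahatP => -[|s] [|t]; rewrite ahatDE ahat_amulE ahatZE /aser /psshift /=.
all: by rewrite ?mulr1 ?mulr0 ?addr0 ?add0r.
Qed.
Lemma bser_split S : bser S = (S 0%N)%:A + ahat_b * bser (psshift S).
Proof.
have -> : S = psconst (S 0%N) + psvar K * psshift S.
  apply/funext => n.
  transitivity (psconst (S 0%N) n + (psvar K * psshift S : pseries K) n); last by [].
  by rewrite psmulXE /psconst; case: n => [|n]; rewrite ?addr0 ?add0r.
rewrite bserD bserM bser_const; congr (_ *: _ + _ * bser _).
  transitivity (psconst (S 0%N) 0%N + (psvar K * psshift S : pseries K) 0%N); last by [].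
  by rewrite psmulXE addr0.
apply/funext => n; rewrite /psshift.
transitivity (psconst (S 0%N) n.+1 + (psvar K * psshift S : pseries K) n.+1); last by [].
by rewrite psmulXE add0r.
Qed.

(** Partial derivative in a, with the powers of b kept on the right; it measures how [u] fails to
    commute with b, see [mulb_comm]. *)
Definition adiff u : Ahat K := fun s t => u s.+1 t *+ s.+1.

Lemma adiff_rmula u : adiff (rmula u) = u + rmula (adiff u).
Proof.
apply: ahatP => s t; rewrite ahatDE /adiff /rmula.
case: s => [|s]; case: t => [|t]; rewrite ?subr0 ?mulr1n ?mulr0n ?addr0//=; 
  rewrite ?[in LHS]mulrnBl ?mulrSr; try ring.
Qed.
Lemma adiff_rmulb u : adiff (rmulb u) = rmulb (adiff u).
Proof. by apply: ahatP => s [|t]; rewrite /adiff /rmulb /= ?mul0rn. Qed.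
Lemma adiffD u v : adiff (u + v) = adiff u + adiff v.
Proof. by apply: ahatP => s t; rewrite /adiff !ahatDE mulrnDl. Qed.
Lemma adiffZ c u : adiff (c *: u) = c *: adiff u.
Proof. by apply: ahatP => s t; rewrite /adiff !ahatZE mulrnAr. Qed.

(** The first four conditions give all finite combinations of the monomials a^p b^q, which are dense
    for the total order; the last one is closedness. It extends identities known for a and b to all
    of [Ahat]. *)
Lemma ahat_density (P : Ahat K -> Prop) :
  P 1 -> (forall u, P u -> P (u * ahat_a)) -> (forall u, P u -> P (u * ahat_b)) ->
  (forall c u v, P u -> P v -> P (c *: u + v)) ->
  (forall u, (forall N, exists2 v, P v & vanishes_below N (u - v)) -> P u) ->
  forall u, P u.
Proof.
move=> P1 Pa Pb PL Pc u.
have P0 : P 0 by have := PL (- 1) 1 1 P1 P1; rewrite scaleN1r addNr.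
have Pm p q : P (iter q (@rmulb K) (iter p (@rmula K) 1)).
  elim: q => [|q IH]; last by rewrite iterS -rmulbE; apply: Pb.
  by elim: p => [|p IH] //=; rewrite -rmulaE; apply: Pa.
apply: Pc => N; exists (\sum_(p < N) \sum_(q < N) u p q *: iter q (@rmulb K) (iter p (@rmula K) 1)).
  elim/big_ind: _ => // [x y Px Py|p _]; first by rewrite -[x]scale1r; apply: PL.
  elim/big_ind: _ => // [x y Px Py|q _]; first by rewrite -[x]scale1r; apply: PL.
  by rewrite -[X in P X]addr0; apply: PL.
move=> s t L; rewrite ahatBE ahat_sumE.
have E p q : iter q (@rmulb K) (iter p (@rmula K) 1) s t = ((s == p) && (t == q))%:R.
  by rewrite -[LHS]/(rmon 1 p q (s, t)) rmon1.
under eq_bigr do rewrite ahat_sumE.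
under eq_bigr do under eq_bigr do rewrite ahatZE E.
have sN : (s < N)%N by lia.
have tN : (t < N)%N by lia.
rewrite (bigD1 (Ordinal sN))//= [X in _ - (_ + X)]big1 ?addr0; last first.
  move=> i; rewrite -val_eqE /= => /negbTE iN; apply: big1 => j _.
  by rewrite eq_sym iN mulr0.
rewrite (bigD1 (Ordinal tN))//= [X in _ - (_ + X)]big1 ?addr0 ?eqxx ?mulr1 ?subrr//.
by move=> i; rewrite -val_eqE /= => /negbTE iN; rewrite [t == _]eq_sym iN ?andbF mulr0.
Qed.

(* Extends ab = b(a + b). *)
Lemma mulb_comm u : u * ahat_b = ahat_b * (u + adiff u * ahat_b).
Proof.
have adiff_van N v : vanishes_below N.+1 v -> vanishes_below N (adiff v).
  by move=> H s t L; rewrite /adiff H ?mul0rn//; lia.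
move: u; apply: ahat_density.
- rewrite mul1r (_ : adiff 1 = 0) ?mul0r ?addr0 ?mulr1//.
  by apply: ahatP => s t; rewrite /adiff /GRing.one /= /ahat_one /= mul0rn.
- move=> u IH; have C x : x * ahat_a * ahat_b = x * ahat_b * ahat_a + x * ahat_b * ahat_b.
    by rewrite -!mulrA -mulrDr -expr2 -ahat_comm addrC subrK.
  have -> : adiff (u * ahat_a) = u + adiff u * ahat_a by rewrite !rmulaE adiff_rmula.
  rewrite C !IH; move: (adiff u) => v.
  by rewrite [in RHS]mulrDl [v * _ * _]C !(mulrDl, mulrDr) !mulrA -!addrA; congr (_ + _); rewrite addrCA.
- move=> u IH; rewrite {1}IH [in RHS]rmulbE adiff_rmulb -!rmulbE.
  by rewrite -mulrDl mulrA.
- move=> c u v Hu Hv; rewrite mulrDl -scalerAl Hu Hv adiffD adiffZ.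
  by rewrite !mulrDl !mulrDr scalerDr -!scalerAl -!scalerAr addrACA.
- move=> u H; apply: vanishes_eq => N.
  have [v Hv V] := H N.+1.
  have -> : u * ahat_b - ahat_b * (u + adiff u * ahat_b) =
     (u - v) * ahat_b - ahat_b * ((u - v) + adiff (u - v) * ahat_b).
    have -> : adiff (u - v) = adiff u - adiff v by rewrite adiffD -scaleN1r adiffZ scaleN1r.
    have -> : u - v + (adiff u - adiff v) * ahat_b =
      (u + adiff u * ahat_b) - (v + adiff v * ahat_b) by rewrite mulrBl opprD addrACA.
    by rewrite mulrBr mulrBl Hv opprB addrA subrK.
  have V' := vanishes_le (leqnSn N) V.
  apply: vanishesB.
    by apply: (@vanishes_le (N + 1)); [lia|apply: vanishesM; [|exact: vanishes_b]].
  apply: (@vanishes_le (1 + N)); [lia|apply: vanishesM; first exact: vanishes_b].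
  apply: vanishesD => //; apply: (@vanishes_le (N + 1)); first lia.
  by apply: vanishesM; [exact: adiff_van|exact: vanishes_b].
Qed.

Lemma aser_b_comm S : aser S * ahat_b = ahat_b * (aser S + aser (psderiv S) * ahat_b).
Proof.
rewrite mulb_comm; congr (_ * (_ + _ * _)).
by apply: ahatP => s t; rewrite /adiff /aser /psderiv; case: eqP; rewrite ?mul0rn.
Qed.

End AhatLemmas.

(** * Substitutions *)

(** [h n] carries the values of index below n; as [G n] reads no others, these values no longer
    change afterwards. *)
Lemma strong_recursion (T : Type) (x0 : T) (G : nat -> (nat -> T) -> T) :
  (forall n f g, (forall i, (i < n)%N -> f i = g i) -> G n f = G n g) ->
  exists f, forall n, f n = G n f.
Proof.
move=> Gext.
pose h := fix h n : nat -> T := if n is n'.+1 then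
  (fun i => if (i < n')%N then h n' i else G n' (h n')) else fun=> x0.
exists (fun n => h n.+1 n) => n /=; rewrite ltnn; apply: Gext => i.
elim: n => // n IH; rewrite ltnS leq_eqVlt => /orP[/eqP->|iln] /=.
  by rewrite !ltnn.
by rewrite iln IH.
Qed.

Lemma pseries_inv (K : fieldType) (S : pseries K) : S 0%N != 0 -> exists T : pseries K, T * S = 1.
Proof.
move=> S0.
have [|T TE] := @strong_recursion K 0 (fun n T =>
  ((n == 0%N)%:R - \sum_(i < n) T i * S (n - i)%N) / S 0%N).
  by move=> n f g fg; congr (_ / _); congr (_ - _); apply: eq_bigr => i _; rewrite fg.
exists T; apply/funext => n; rewrite [LHS]/(psmul T S n) /psmul big_ord_recr /= subnn.
rewrite [X in _ + X * _]TE divfK// addrC subrK.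
by rewrite [RHS]/(psconst 1 n) /psconst; case: eqP.
Qed.

Lemma pseries_ode (K : numFieldType) (c : K) (g f : pseries K) :
  exists W : pseries K, W 0%N = c /\ psderiv W = g * W + f.
Proof.
have [|W WE] := @strong_recursion K 0 (fun n W =>
  if n is n'.+1 then (psmul g W n' + f n') / n%:R else c).
  case=> // n u v uv; congr (_ / _); congr (_ + _); rewrite /psmul.
  by apply: eq_bigr => i _; rewrite uv// ltnS leq_subr.
exists W; split; first by rewrite WE.
apply/funext => n; rewrite /psderiv WE -[LHS]mulr_natr divfK ?pnatr_eq0//.
Qed.

Section ChangeOfVariable.
Variable K : fieldType.
Implicit Types (u v w : Ahat K) (S T theta : pseries K).

Definition substitution theta (Theta : {lrmorphism Ahat K -> Ahat K}) : Prop :=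
  [/\ theta 0%N = 0, theta 1%N != 0, Theta ahat_a = aser theta
    & Theta ahat_b = ahat_b * aser (psderiv theta)].

Lemma substitution_deriv_inv theta Theta : substitution theta Theta ->
  exists T, [/\ aser T * aser (psderiv theta) = 1 :> Ahat K,
    aser (psderiv theta) * aser T = 1 :> Ahat K & Theta ahat_b * aser T = ahat_b].
Proof.
move=> [_ t1 _ ->]; have [|T HT] := @pseries_inv K (psderiv theta); first by rewrite /psderiv mulr1n.
exists T; have HT' : psderiv theta * T = 1 by rewrite mulrC.
by rewrite -mulrA -!aserM HT HT' aser1 mulr1.
Qed.

Section WithTheta.
Variables (theta : pseries K) (Theta : {lrmorphism Ahat K -> Ahat K}).
Hypothesis sT : substitution theta Theta.

(** Theta(a) has no constant term and Theta(b) is a multiple of b, so each degree peeled off by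
    [vanishes_split] is regained. This is the form in which continuity of Theta is used. *)
Lemma substitution_van N u : vanishes_below N u -> vanishes_below N (Theta u).
Proof.
have [t0 t1 Ta Tb] := sT.
elim: N u => [|N IH] u; first by move=> _; exact: vanishes0.
move=> /vanishes_split[u1 [u2 [-> V1 V2]]]; rewrite rmorphD !rmorphM /=; apply: vanishesD.
  rewrite -add1n; apply: vanishesM; last exact: IH.
  by rewrite Ta => s t; case: s => [|s]; case: t => [|t]//; rewrite /aser /= t0.
rewrite -addn1; apply: vanishesM; first exact: IH.
by rewrite Tb -[1%N]addn0; apply: vanishesM; [exact: vanishes_b|exact: vanishes0].
Qed.

(** Polynomial truncations of S go to polynomials in theta, which are free of b; by
    [substitution_van] the image of S agrees with them to any order. *)
Lemma substitution_aser S : exists2 Q, Theta (aser S) = aser Q & Q 0%N = S 0%N.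
Proof.
have [t0 t1 Ta Tb] := sT.
have H N : vanishes_below N (Theta (aser S) - aser (\sum_(i < N) psconst (S i) * theta ^+ i)).
  have -> : aser (\sum_(i < N) psconst (S i) * theta ^+ i) = Theta (\sum_(i < N) S i *: ahat_a ^+ i).
    rewrite aser_sum raddf_sum; apply: eq_bigr => i _; rewrite /= linearZ rmorphXn /= Ta.
    by rewrite -aserX aserM aser_const mulr_algl.
  by rewrite -raddfB; apply: substitution_van; exact: aser_trunc.
exists (fun s => Theta (aser S) s 0%N).
  apply: ahatP => s t; rewrite {2}/aser; case: eqP => [->//|/eqP t_neq0].
  have := H (s + t).+1 s t (ltnSn _); rewrite ahatBE {2}/aser (negbTE t_neq0) subr0 => ->//.
have := H 1%N 0%N 0%N isT; rewrite ahatBE {2}/aser /= big_ord1 expr0.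
by rewrite mulr1 => /eqP; rewrite subr_eq0 => /eqP->.
Qed.

(** Powers of b move to the left past any factor by [mulb_comm]. With the converse
    [substitution_bX'], the filtrations by powers of b and of Theta(b) coincide. *)
Lemma substitution_bX n : exists v, Theta ahat_b ^+ n = ahat_b ^+ n * v.
Proof.
have [_ _ _ Tb] := sT.
elim: n => [|n [v IH]]; first by exists 1; rewrite !expr0 mulr1.
exists ((v + adiff v * ahat_b) * aser (psderiv theta)).
by rewrite !exprSr IH Tb !mulrA -[_ * v * _]mulrA mulb_comm !mulrA.
Qed.

Lemma substitution_bX' n : exists v, ahat_b ^+ n = Theta ahat_b ^+ n * v.
Proof.
have [_ _ _ Tb] := sT; have [T [T1 T2 T3]] := substitution_deriv_inv sT.
elim: n => [|n [v IH]]; first by exists 1; rewrite !expr0 mulr1.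
exists (aser T * (v + adiff v * ahat_b)).
by rewrite !exprSr {1}IH -[LHS]mulrA mulb_comm -[RHS]mulrA; congr (_ * _); rewrite mulrA T3.
Qed.

(** The point is that the inverse sends a into K[[a]]. Modulo b the image of a is a series eta;
    Theta sends eta to a series in a and the remainder to terms all containing b, so comparison of
    the terms free of b gives Theta(eta) = a. *)
Lemma substitution_inv : bijective Theta ->
  exists (Phi : {lrmorphism Ahat K -> Ahat K}) eta,
    [/\ cancel Theta Phi, cancel Phi Theta & substitution eta Phi].
Proof.
move=> [g Tg gT]; have [t0 t1 Ta Tb] := sT.
have [T [T1 T2 T3]] := substitution_deriv_inv sT.
pose gA := GRing.isLinear.Build K (Ahat K) (Ahat K) *:%R g (can2_linear Tg gT).
pose gM := GRing.isMonoidMorphism.Build (Ahat K) (Ahat K) g (can2_monoid_morphism Tg gT).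
pose Phi : {lrmorphism Ahat K -> Ahat K} := HB.pack g gA gM.
have [u2 u2E] := ahat_split (g ahat_a).
pose eta : pseries K := fun s => g ahat_a s 0%N.
have [Q TQ Q0] := substitution_aser eta.
have w0 S w : forall s, (w * ahat_b * aser S) s 0%N = 0.
  move=> s; rewrite mul_aserE big1// => p _; apply/eqP; rewrite mulf_eq0; apply/orP; right.
  apply/eqP; move: (nat_of_ord p) => q {p}; elim: q s => [|q IH] s; first by rewrite /= ahat_mulbE.
  have Z w' s' : rmula w' s' 0%N = if s' is s''.+1 then w' s'' 0%N else 0 :> K.
    by rewrite /rmula subr0.
  by rewrite iterS Z; case: s.
have TE : Theta (aser eta) = ahat_a.
  have /(congr1 Theta) := u2E; rewrite gT rmorphD rmorphM /= Tb TQ mulrA => aE.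
  congr aser; apply/funext => s; have := congr1 (fun u : Ahat K => u s 0%N) aE.
  by rewrite /= ahatDE w0 addr0.
have PE : g ahat_a = aser eta by rewrite -TE Tg.
have eta0 : eta 0%N = 0.
  by rewrite -Q0; have := congr1 (fun u : Ahat K => u 0%N 0%N) TE; rewrite TQ.
exists Phi, eta; split=> //; split=> //.
  (* If eta'(0) were 0, eta would have order 2, and so would its image a. *)
  apply/eqP => eta1.
  have V : vanishes_below 2 (aser eta).
    by case=> [|[|s]] [|[|t]]; rewrite /aser//=.
  have := substitution_van V; rewrite TE => /(_ 1%N 0%N isT) /eqP.
  by rewrite /ahat_a /aser /psvar /= oner_eq0.
(* With b' = Theta(b), applying Theta to eta b = b (eta + eta' b) gives b' Theta(eta') b' = b b'.
   Cancelling b' on the right yields Theta(b eta') = b. *)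
have := aser_b_comm eta => /(congr1 Theta); rewrite mulrDr !mulrA rmorphD !rmorphM /= TE.
move=> /eqP; rewrite addrC -subr_eq {1 2}Tb mulrA.
have -> : ahat_a * ahat_b = ahat_b * ahat_a + ahat_b * ahat_b :> Ahat K.
  by rewrite -expr2 -ahat_comm addrC subrK.
have Ca : ahat_a * aser (psderiv theta) = aser (psderiv theta) * ahat_a :> Ahat K.
  by rewrite -!aserM mulrC.
rewrite mulrDl -!mulrA Ca addrAC subrr add0r -Tb => /eqP H.
have {H} : Theta (ahat_b * aser (psderiv eta)) * Theta ahat_b = ahat_b * Theta ahat_b.
  by rewrite rmorphM -mulrA -H.
move=> /(congr1 (fun u => u * aser T)); rewrite -!mulrA T3 => /mulb_inj H.
exact: etrans (congr1 g (esym H)) (Tg _).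
Qed.
End WithTheta.
End ChangeOfVariable.

(** * Transport of Xi along a substitution *)

Lemma psderivM (K : fieldType) (S T : pseries K) :
  psderiv (S * T) = psderiv S * T + S * psderiv T.
Proof.
apply/funext => n.
transitivity (psmul (psderiv S) T n + psmul S (psderiv T) n); last by [].
transitivity ((\sum_(i < n.+2) S i * T (n.+1 - i)%N) *+ n.+1); first by [].
transitivity (\sum_(i < n.+2) ((S i *+ i) * T (n.+1 - i)%N
    + S i * (T (n.+1 - i)%N *+ (n.+1 - i)))).
  rewrite -sumrMnl; apply: eq_bigr => i _; rewrite mulrnAl mulrnAr -mulrnDr.
  by congr (_ *+ _); have := ltn_ord i; lia.
rewrite big_split /=; congr (_ + _).
  rewrite big_ord_recl mulr0n mul0r add0r; apply: eq_bigr => i _ /=.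
  by rewrite /psderiv subSS.
rewrite big_ord_recr /= subnn mulr0n mulr0 addr0; apply: eq_bigr => i _ /=.
by rewrite /psderiv subSn// -ltnS.
Qed.

Section XiLemmas.
Variables (K : numClosedFieldType) (m : nat) (lam : 'I_m -> rat) (N : nat) (V : vectType K).
Local Notation XiV := (Xi lam N V).
Implicit Types (x : XiV) (u : Ahat K) (S : pseries K).

Lemma xiP x x' : (forall n i j, x (n, i, j) = x' (n, i, j)) -> x = x'.
Proof. by move=> H; apply/funext => -[[n i] j]. Qed.

Lemma xiDE x x' idx : (x + x') idx = x idx + x' idx. Proof. by []. Qed.
Lemma xiNE x idx : (- x) idx = - x idx. Proof. by []. Qed.
Lemma xi_sumE I (r : seq I) (P : pred I) (F : I -> XiV) idx :
  (\sum_(i <- r | P i) F i) idx = \sum_(i <- r | P i) F i idx.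
Proof. by elim/big_rec2: _ => // i x y _ <-. Qed.

Lemma xi_scalarE c x idx : (c%:A *: x) idx = c *: x idx.
Proof.
rewrite [LHS]/(Xi_scale lam _ x idx) /Xi_scale big_ord_recl big_ord_recl /=.
have o p q : (c%:A : Ahat K) p q = if (p == 0%N) && (q == 0%N) then c else 0.
  by rewrite ahatZE /GRing.one /= /ahat_one; case: ifP; rewrite ?mulr1 ?mulr0.
rewrite o /= !big1 ?addr0// => k _; last by rewrite o scale0r.
by apply: big1 => l _; rewrite o scale0r.
Qed.

Lemma xi_bE x n i j :
  (ahat_b *: x) (n, i, j) = if n is n'.+1 then x (n', i, j) else 0.
Proof. by rewrite ahat_b_Xi. Qed.

Lemma xi_b_inj : injective (fun x => ahat_b *: x).
Proof.
move=> x x' H; apply: xiP => n i j.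
by have := congr1 (fun z : XiV => z (n.+1, i, j)) H; rewrite /= !xi_bE.
Qed.

Definition xvan M x := forall n i j, (n < M)%N -> x (n, i, j) = 0.

Lemma xvan_eq x : (forall M, xvan M x) -> x = 0.
Proof. by move=> H; apply: xiP => n i j; apply: (H n.+1). Qed.
Lemma xvan_le M M' x : (M <= M')%N -> xvan M' x -> xvan M x.
Proof. by move=> MM H n i j L; apply: H; apply: leq_trans MM. Qed.
Lemma xvanD M x x' : xvan M x -> xvan M x' -> xvan M (x + x').
Proof. by move=> H H' n i j L; rewrite xiDE H// H'// addr0. Qed.
Lemma xvanN M x : xvan M x -> xvan M (- x).
Proof. by move=> H n i j L; rewrite xiNE H// oppr0. Qed.
Lemma xvanB M x x' : xvan M x -> xvan M x' -> xvan M (x - x').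
Proof. by move=> H H'; apply: xvanD => //; apply: xvanN. Qed.

Lemma xvan_scale M M' u x : vanishes_below M u -> xvan M' x -> xvan (M + M') (u *: x).
Proof.
move=> uM xM n i j L; rewrite [LHS]/(Xi_scale lam u x (n, i, j)) /Xi_scale.
apply: big1 => p _; apply: big1 => q _.
have [pq|pq] := ltnP (p + q) M; first by rewrite uM// scale0r.
have xM' idx : (idx.1.1 < M')%N -> x idx = 0 by case: idx => [[n' i'] j'] /= L'; apply: xM.
have -> := @Xi_vanish_mon _ _ lam _ _ _ _ p q xM'; first by rewrite scaler0.
by apply: leq_trans L _; rewrite leq_add2r.
Qed.

Lemma xvan_bX M n x : xvan M x -> xvan (n + M) (ahat_b ^+ n *: x).
Proof.
apply: xvan_scale; rewrite -[n in vanishes_below n]muln1.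
by apply: vanishesX; exact: vanishes_b.
Qed.

Lemma xi_aser_lead n x S i j : xvan n x -> (aser S *: x) (n, i, j) = S 0%N *: x (n, i, j).
Proof.
move=> H; rewrite aser_split scalerDl xiDE xi_scalarE -[RHS]addr0; congr (_ + _).
apply: (@xvan_scale 1 n) => //; rewrite -[1%N]addn0; apply: vanishesM => //.
exact: vanishes_a.
Qed.

Section Psi.
Local Notation fiber := ('I_m -> 'I_N.+1 -> V).
Implicit Types y : fiber.

(* xi0 y = \sum_(i,j) e_(i,j) (x) y i j is the b-degree 0 part of Xi; there, a acts as b fshift,
   and fpart i l is the projection to the block i followed by e_(i,j) |-> e_(i,j-l). *)
Definition fext y (i : 'I_m) (j : nat) : V := if insub j is Some j' then y i j' else 0.
Definition fshift y : fiber := fun i j => ratr (lam i) *: y i j + fext y i j.+1.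
Definition xi0 y : XiV := fun '(n, i, j) => if n == 0%N then y i j else 0.
Definition fpart (i : 'I_m) (l : nat) y : fiber := fun i' j =>
  if i' == i then fext y i (j + l) else 0.
Definition xcoef x n : fiber := fun i j => x (n, i, j).

Lemma fext_ge y i j : (N < j)%N -> fext y i j = 0.
Proof. by move=> L; rewrite /fext insubF//; apply/negbTE; rewrite -leqNgt. Qed.

Lemma fext_ord y i (j : 'I_N.+1) : fext y i j = y i j.
Proof. by rewrite /fext valK. Qed.

Lemma fext_lt y i j (jN : (j < N.+1)%N) : fext y i j = y i (Ordinal jN).
Proof. by rewrite /fext insubT. Qed.

Lemma fext_shift y i j : fext (fshift y) i j = ratr (lam i) *: fext y i j + fext y i j.+1.
Proof.
have [jN|jN] := ltnP j N.+1; last by rewrite !fext_ge ?scaler0 ?addr0//; lia.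
by rewrite !(fext_lt _ _ jN).
Qed.

Lemma fpart_shift i l y : fpart i l (fshift y) = (ratr (lam i) *: fpart i l y : fiber) + fpart i l.+1 y.
Proof.
apply/funext => i'; apply/funext => j; rewrite /fpart addrfctE scalrfctE addrfctE scalrfctE.
by case: eqP => // _; rewrite ?scaler0 ?addr0// fext_shift addnS.
Qed.

Lemma fshift_part i l y : fshift (fpart i l y) = fpart i l (fshift y).
Proof.
rewrite fpart_shift; apply/funext => i'; apply/funext => j.
rewrite /fshift addrfctE scalrfctE addrfctE scalrfctE.
rewrite /fpart; case: (i' =P i) => [->|ne].
  congr (_ + _); have [jN|jN] := ltnP j.+1 N.+1; last by rewrite !fext_ge//; lia.
  by apply: etrans (fext_lt _ _ jN) _; rewrite eqxx /= addSnnS.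
have [jN|jN] := ltnP j.+1 N.+1; last by rewrite !scaler0 add0r addr0 !fext_ge//; lia.
by rewrite !scaler0 addr0; apply: etrans (congr1 _ (fext_lt _ _ jN)) _; rewrite add0r; case: eqP.
Qed.

Lemma fpart_big i y l : (N < l)%N -> fpart i l y = 0.
Proof.
move=> L; apply/funext => i'; apply/funext => j; rewrite /fpart; case: eqP => // _.
by rewrite fext_ge//; lia.
Qed.

Lemma xi0D y y' : xi0 (y + y') = xi0 y + xi0 y'.
Proof. by apply: xiP => -[|n] i j; rewrite xiDE //= addr0. Qed.
Lemma xi0Z c y : xi0 (c *: y) = c%:A *: xi0 y.
Proof. by apply: xiP => -[|n] i j; rewrite xi_scalarE //= scaler0. Qed.
Lemma xi00 : xi0 0 = 0.
Proof. by apply: xiP => -[|n] i j. Qed.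
Lemma fpartD i l y y' : fpart i l (y + y') = fpart i l y + fpart i l y'.
Proof.
apply/funext => i'; apply/funext => j; rewrite !addrfctE /fpart; case: eqP; rewrite ?addr0// => _.
by rewrite /fext; case: insub => [j'|]; rewrite ?addr0.
Qed.
Lemma fpartZ i l c y : fpart i l (c *: y) = c *: fpart i l y.
Proof.
apply/funext => i'; apply/funext => j; rewrite !scalrfctE /fpart; case: eqP; rewrite ?scaler0// => _.
by rewrite /fext; case: insub => [j'|]; rewrite ?scaler0.
Qed.

Lemma xi0_a y : ahat_a *: xi0 y = ahat_b *: xi0 (fshift y).
Proof.
rewrite ahat_a_Xi ahat_b_Xi; apply/funext => -[[[|[|n]] i] j] //=.
  by rewrite addr0 /fext.
by rewrite scaler0 add0r; case: insub.
Qed.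

Lemma xcoef_a x n : xcoef (ahat_a *: x) n.+1 = fshift (xcoef x n) + n%:R *: xcoef x n.
Proof.
apply/funext => i; apply/funext => j.
rewrite /xcoef ahat_a_Xi !addrfctE !scalrfctE /fshift /= scalerDl -!addrA; congr (_ + _).
by rewrite addrC.
Qed.
Lemma xcoef_a0 x : xcoef (ahat_a *: x) 0 = 0.
Proof. by rewrite /xcoef ahat_a_Xi. Qed.
Lemma xcoef_b x n : xcoef (ahat_b *: x) n.+1 = xcoef x n.
Proof. by rewrite /xcoef ahat_b_Xi. Qed.
Lemma xcoef_b0 x : xcoef (ahat_b *: x) 0 = 0.
Proof. by rewrite /xcoef ahat_b_Xi. Qed.

Variables (Phi : {lrmorphism Ahat K -> Ahat K}) (eta : pseries K).
Hypothesis sP : substitution eta Phi.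

(* W l plays the role of u^(lam - 1) (log u)^l / l! with u = eta / (eta'(0) s), so that
   \sum_l W l (s) s^(lam-1) (log s)^(j-l) / (j-l)! is, up to constants,
   eta^(lam-1) (log eta)^j / j!. *)
Lemma log_powers (lambda : K) : exists W : nat -> pseries K,
  W 0%N 0%N = 1 /\ (forall l, W l.+1 0%N = 0) /\
  forall l, psshift eta * psderiv (W l) =
    psderiv (psshift eta) * (psconst (lambda - 1) * W l + (if l is l'.+1 then W l' else 0)).
Proof.
have [e0 e1 _ _] := sP.
have [h hE] := @pseries_inv K (psshift eta) e1.
have /(_ _ _ _)/cid ode c g f := @pseries_ode K c g f.
(* Logarithmic derivative of eta/a: the relation becomes W_l' = g ((lambda - 1) W_l + W_(l-1)),
   solved successively in l. *)
pose g := h * psderiv (psshift eta).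
pose W := fix W l := if l is l'.+1
  then projT1 (ode 0 (g * psconst (lambda - 1)) (g * W l'))
  else projT1 (ode 1 (g * psconst (lambda - 1)) 0).
exists W; split; first by rewrite /=; case: (ode _ _ _) => w [].
split; first by move=> l /=; case: (ode _ _ _) => w [].
have hg : psshift eta * g = psderiv (psshift eta) by rewrite /g mulrA [_ * h]mulrC hE mul1r.
case=> [|l] /=; case: (ode _ _ _) => w /= [_ ->]; first by rewrite !addr0 -hg; ring.
by rewrite -hg; ring.
Qed.

Definition log_power (i : 'I_m) : nat -> pseries K := projT1 (cid (log_powers (ratr (lam i)))).

(** The value of Psi on the element [xi0 y]: e_(i,j) goes to the sum over l of W_l(a) e_(i,j-l). The
    initial values of the W_l make [y] its leading term, see [xi_frame_lead]. *)
Definition xi_frame y : XiV :=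
  \sum_(i < m) \sum_(l < N.+1) aser (log_power i l) *: xi0 (fpart i l y).

Lemma xi_frameD y y' : xi_frame (y + y') = xi_frame y + xi_frame y'.
Proof.
rewrite /xi_frame -big_split; apply: eq_bigr => i _; rewrite -big_split; apply: eq_bigr => l _.
by rewrite fpartD xi0D scalerDr.
Qed.
Lemma xi_frameZ c y : xi_frame (c *: y) = c%:A *: xi_frame y.
Proof.
rewrite /xi_frame scaler_sumr; apply: eq_bigr => i _; rewrite scaler_sumr; apply: eq_bigr => l _.
by rewrite fpartZ xi0Z !scalerA mulr_algl mulr_algr.
Qed.
Lemma xi_frame0 : xi_frame 0 = 0.
Proof. by rewrite -[0 in LHS](scale0r 0) xi_frameZ !scale0r. Qed.

Lemma xi_frame_lead y i j : xi_frame y (0%N, i, j) = y i j.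
Proof.
rewrite /xi_frame xi_sumE (bigD1 i)//= [X in _ + X]big1 ?addr0; last first.
  move=> i' /negbTE ne; rewrite xi_sumE big1// => l _.
  by rewrite xi_aser_lead//= /fpart eq_sym ne scaler0.
rewrite xi_sumE big_ord_recl big1 ?addr0; last first.
  move=> l _; rewrite xi_aser_lead//=; rewrite /log_power.
  by case: (cid _) => W /= [_ [-> _]]; rewrite scale0r.
rewrite xi_aser_lead//= /fpart eqxx addn0 fext_ord /log_power.
by case: (cid _) => W /= [-> _]; rewrite scale1r.
Qed.

Lemma xi_aserX S y : aser (psvar K * S) *: xi0 y =
  ahat_b *: (aser S *: xi0 (fshift y) + aser (psvar K * psderiv S) *: xi0 y).
Proof.
have X T : aser (psvar K * T) *: xi0 y = aser T *: (ahat_b *: xi0 (fshift y)).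
  by rewrite mulrC aserM -scalerA -/ahat_a xi0_a.
by rewrite X scalerA aser_b_comm -scalerA scalerDl -scalerA -X.
Qed.

(** The image under Psi of the relation [xi0_a]. Once the series in a are moved past b, the two
    sides agree on each [fpart i l y] by the differential equations of [log_powers]. *)
Lemma xi_frame_a y : Phi ahat_a *: xi_frame y = Phi ahat_b *: xi_frame (fshift y).
Proof.
have [e0 e1 -> ->] := sP.
rewrite -scalerA /xi_frame !scaler_sumr; apply: eq_bigr => i _; rewrite !scaler_sumr.
rewrite /log_power; case: (cid _) => W /= [W0 [_ WE]].
have etaE : eta = psvar K * psshift eta.
  by apply/funext => n; rewrite psmulXE; case: n.
have etaD : psderiv eta = psshift eta + psvar K * psderiv (psshift eta).
  apply/funext => n.
  transitivity (psshift eta n + (psvar K * psderiv (psshift eta) : pseries K) n); last by [].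
  by rewrite psmulXE /psderiv /psshift; case: n => [|n]; rewrite ?addr0 ?mulr1n// mulrS.
pose f l : pseries K := psshift eta * W l.
set lambda : K := ratr (lam i) in WE *.
(* Shift of l by one: the term with [fpart i N.+1 y] is zero by [fpart_big], and nothing arrives at
   l = 0. *)
have reindex (h : nat -> pseries K) : \sum_(l < N.+1) aser (h l) *: xi0 (fpart i l.+1 y) =
    \sum_(l < N.+1) aser (if nat_of_ord l is l'.+1 then h l' else 0) *: xi0 (fpart i l y).
  rewrite big_ord_recr /= fpart_big// xi00 scaler0 addr0.
  rewrite big_ord_recl /= (_ : aser 0 = 0) ?scale0r ?add0r//.
  by apply: ahatP => s t; rewrite /aser; case: eqP.
have psconstB : psconst (lambda - 1) = psconst lambda - 1 :> pseries K.
  apply/funext => n; transitivity (psconst lambda n - psconst 1 n); last by [].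
  by rewrite /psconst; case: eqP; rewrite ?subr0.
transitivity (\sum_(l < N.+1) ahat_b *: (
   (aser (psconst lambda * f l + psvar K * psderiv (f l)) *: xi0 (fpart i l y))
   + aser (f l) *: xi0 (fpart i l.+1 y))).
  apply: eq_bigr => l _; rewrite scalerA -aserM {1}etaE -mulrA xi_aserX; congr (_ *: _).
  rewrite fshift_part fpart_shift xi0D xi0Z scalerDr scalerA aserD scalerDl.
  rewrite -/(f l) [psconst _ * _]mulrC [aser (f l * _)]aserM aser_const -!addrA; congr (_ + _).
  exact: addrC.
rewrite -!scaler_sumr; congr (_ *: _).
pose g l := psconst lambda * W l + (if l is l'.+1 then W l' else 0).
transitivity (\sum_(l < N.+1) aser (psderiv eta * g l) *: xi0 (fpart i l y)).
  rewrite big_split /= reindex -big_split; apply: eq_bigr => l _ /=.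
  rewrite -scalerDl -aserD; congr (aser _ *: _).
  rewrite psderivM etaD /g mulrDr WE psconstB /f.
  by case: (nat_of_ord l) => [|l']; ring.
rewrite scaler_sumr.
under [RHS]eq_bigr do rewrite fpart_shift xi0D xi0Z !scalerDr !scalerA -!aserM.
rewrite big_split /= (reindex (fun l => psderiv eta * W l)) -big_split; apply: eq_bigr => l _ /=.
rewrite -scalerDl; congr (_ *: _).
rewrite -aser_const -aserM -aserD /g; congr aser.
by case: (nat_of_ord l) => [|l']; ring.
Qed.
End Psi.
End XiLemmas.

(** Replaces both sides of an identity by their remainders after a common partial sum. *)
Lemma subr_congr (M : zmodType) (x y x' y' : M) : x' = y' -> x - y = (x - x') - (y - y').
Proof. by move=> ->; rewrite opprB addrA subrK. Qed.

Section Transport.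
Variables (K : numClosedFieldType) (m : nat) (lam : 'I_m -> rat) (N : nat) (V : vectType K).
Local Notation XiV := (Xi lam N V).
Variables (Phi : {lrmorphism Ahat K -> Ahat K}) (eta : pseries K).
Hypothesis sP : substitution eta Phi.
Implicit Types (x : XiV) (u : Ahat K).
Local Notation frame := (@xi_frame K m lam N V Phi eta sP).

(** x is the b-adic sum of the b^n xi0(x_n); here b is replaced by Phi(b) and [xi0] by the frame.
    Terms of index above n have order above n, so n+1 terms determine the coefficient of b^n. *)
Definition xi_partial M x : XiV := \sum_(n < M) Phi ahat_b ^+ n *: frame (xcoef x n).
(* Composition with eta on the functions s^(lam-1) (log s)^j. *)
Definition xi_transport x : XiV := fun '(n, i, j) => xi_partial n.+1 x (n, i, j).
Local Notation Psi := xi_transport.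

Lemma xvan_PhibX n x : xvan n (Phi ahat_b ^+ n *: x).
Proof.
rewrite -[n in xvan n _]addn0; apply: xvan_scale => //.
rewrite -rmorphXn; apply: (substitution_van sP).
by rewrite -[n in vanishes_below n]muln1; apply: vanishesX; exact: vanishes_b.
Qed.

Lemma xi_transport_partial M x : xvan M (Psi x - xi_partial M x).
Proof.
move=> n i j nM; rewrite xiDE xiNE /xi_partial -(subnKC nM) big_split_ord /= xiDE.
rewrite [X in _ - (_ + X)](_ : _ = 0) ?addr0 ?subrr// xi_sumE big1// => l _.
by apply: xvan_PhibX; rewrite ltnS leq_addr.
Qed.

Lemma xi_partialD M x x' : xi_partial M (x + x') = xi_partial M x + xi_partial M x'.
Proof.
rewrite -big_split; apply: eq_bigr => n _.
by rewrite /= -scalerDr -xi_frameD.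
Qed.

Lemma xi_transportD x x' : Psi (x + x') = Psi x + Psi x'.
Proof. by apply: xiP => n i j; rewrite xiDE /= xi_partialD xiDE. Qed.

Lemma xi_transportZ c x : Psi (c%:A *: x) = c%:A *: Psi x.
Proof.
apply: xiP => n i j; rewrite xi_scalarE /= -xi_scalarE; congr ((_ : XiV) _).
rewrite /xi_partial scaler_sumr; apply: eq_bigr => l _.
have -> : xcoef (c%:A *: x) l = c *: xcoef x l.
  by apply/funext => i'; apply/funext => j'; rewrite /xcoef xi_scalarE.
by rewrite xi_frameZ !scalerA mulr_algl mulr_algr.
Qed.

Lemma xi_transport0 : Psi 0 = 0.
Proof. by apply: (addrI (Psi 0)); rewrite -xi_transportD !addr0. Qed.

Lemma xi_transportN x : Psi (- x) = - Psi x.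
Proof. by apply: (addrI (Psi x)); rewrite -xi_transportD !subrr xi_transport0. Qed.

Lemma xi_transport_van M x : xvan M x -> xvan M (Psi x).
Proof.
move=> H n i j nM; rewrite /= /xi_partial xi_sumE big1// => l _.
have -> : xcoef x l = 0.
  by apply/funext => i'; apply/funext => j'; apply: H; have := ltn_ord l; lia.
by rewrite xi_frame0 scaler0.
Qed.

Lemma Phi_ab n : Phi ahat_a * Phi ahat_b ^+ n =
  Phi ahat_b ^+ n * (Phi ahat_a + n%:R *: Phi ahat_b).
Proof.
have C : ahat_a * ahat_b = ahat_b * (ahat_a + ahat_b) :> Ahat K.
  by rewrite mulrDr -expr2 -ahat_comm addrC subrK.
elim: n => [|n IH]; first by rewrite !expr0 mul1r mulr1 scale0r addr0.
rewrite exprSr mulrA IH -!mulrA; congr (_ * _).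
rewrite mulrDl -rmorphM C rmorphM rmorphD /= -scalerAl scalerAr -mulrDr; congr (_ * _).
by rewrite -addrA -natr1 scalerDl scale1r [n%:R *: _ + _]addrC.
Qed.

(** Modulo order M both sides are partial sums, and the rule [xcoef_a] for the coefficients of a x
    is matched by [Phi_ab] and [xi_frame_a]. The left side takes one term more because a raises the
    degree, its term of index 0 being zero. *)
Lemma xi_transport_a x : Psi (ahat_a *: x) = Phi ahat_a *: Psi x.
Proof.
apply/eqP; rewrite -subr_eq0; apply/eqP; apply: xvan_eq => M.
have -> : Psi (ahat_a *: x) - Phi ahat_a *: Psi x =
    (Psi (ahat_a *: x) - xi_partial M.+1 (ahat_a *: x))
    - Phi ahat_a *: (Psi x - xi_partial M x).
  rewrite scalerBr; apply: subr_congr.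
  rewrite /xi_partial big_ord_recl /= xcoef_a0 xi_frame0 scaler0 add0r scaler_sumr.
  apply: eq_bigr => n _.
  rewrite xcoef_a xi_frameD xi_frameZ scalerA Phi_ab -scalerA /bump add1n exprSr -scalerA.
  by rewrite scalerDr scalerDl xi_frame_a scalerA mulr_algr.
apply: xvanB; first by apply: (xvan_le (leqnSn M)); exact: xi_transport_partial.
apply: (@xvan_scale _ _ _ _ _ 0 M) => //; exact: xi_transport_partial.
Qed.

Lemma xi_transport_b x : Psi (ahat_b *: x) = Phi ahat_b *: Psi x.
Proof.
apply/eqP; rewrite -subr_eq0; apply/eqP; apply: xvan_eq => M.
have -> : Psi (ahat_b *: x) - Phi ahat_b *: Psi x =
    (Psi (ahat_b *: x) - xi_partial M.+1 (ahat_b *: x))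
    - Phi ahat_b *: (Psi x - xi_partial M x).
  rewrite scalerBr; apply: subr_congr.
  rewrite /xi_partial big_ord_recl /= xcoef_b0 xi_frame0 scaler0 add0r scaler_sumr.
  apply: eq_bigr => n _.
  by rewrite xcoef_b scalerA /bump add1n exprS.
apply: xvanB; first by apply: (xvan_le (leqnSn M)); exact: xi_transport_partial.
apply: (@xvan_scale _ _ _ _ _ 0 M) => //; exact: xi_transport_partial.
Qed.

Lemma xi_transportP u x : Psi (u *: x) = Phi u *: Psi x.
Proof.
move: u x; apply: ahat_density.
- by move=> x; rewrite rmorph1 !scale1r.
- by move=> u IH x; rewrite rmorphM -!scalerA IH xi_transport_a.
- by move=> u IH x; rewrite rmorphM -!scalerA IH xi_transport_b.
- move=> c u v Hu Hv x; rewrite scalerDl xi_transportD Hv.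
  rewrite -mulr_algl -scalerA xi_transportZ Hu scalerA mulr_algl.
  by rewrite -scalerDl raddfD /= mulr_algl linearZ.
- move=> u H x; apply/eqP; rewrite -subr_eq0; apply/eqP; apply: xvan_eq => M.
  have [v Hv vu] := H M.
  have -> : Psi (u *: x) - Phi u *: Psi x = Psi ((u - v) *: x) - Phi (u - v) *: Psi x.
    by rewrite raddfB !scalerBl xi_transportD xi_transportN Hv opprB addrA subrK.
  apply: xvanB.
    by apply: xi_transport_van; rewrite -[M]addn0; apply: xvan_scale.
  by rewrite -[M]addn0; apply: xvan_scale => //; exact: (substitution_van sP).
Qed.

Lemma PhibX_lead M (z : XiV) i j :
  (Phi ahat_b ^+ M *: z) (M, i, j) = eta 1%N ^+ M *: z (0%N, i, j).
Proof.
have [_ _ _ Pb] := sP.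
elim: M => [|M IH]; first by rewrite !expr0 !scale1r.
rewrite exprS -scalerA {1}Pb -scalerA xi_bE xi_aser_lead; last exact: xvan_PhibX.
by rewrite IH /psderiv mulr1n exprS -scalerA.
Qed.

(** Only the term of index M contributes, and Phi(b)^M = (b eta'(a))^M has leading term eta'(0)^M
    b^M. This factor is nonzero, whence the injectivity of Psi. *)
Lemma xi_transport_lead M x i j : xvan M x -> Psi x (M, i, j) = eta 1%N ^+ M *: x (M, i, j).
Proof.
move=> H; rewrite /= /xi_partial xi_sumE big_ord_recr /= big1 ?add0r; last first.
  move=> n _; rewrite (_ : xcoef x n = 0) ?xi_frame0 ?scaler0//.
  by apply/funext => i'; apply/funext => j'; apply: H.
by rewrite -[x (M, i, j)]/(xcoef x M i j) -(xi_frame_lead lam sP) PhibX_lead.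
Qed.

Lemma xi_transport_inj : injective Psi.
Proof.
have [_ e1 _ _] := sP.
suff H x : Psi x = 0 -> x = 0.
  by move=> x x' E; apply/eqP; rewrite -subr_eq0; apply/eqP/H; rewrite xi_transportD xi_transportN E subrr.
move=> Px0; apply: xvan_eq; elim=> [//|M IH] n i j.
rewrite ltnS leq_eqVlt => /orP[/eqP->|]; last exact: IH.
have := xi_transport_lead i j IH; rewrite Px0 => /esym/eqP.
by rewrite scaler_eq0 expf_eq0 (negbTE e1) andbF => /eqP.
Qed.
End Transport.

(** * Submodules of free K[[b]]-modules *)

Section PseriesLattices.
Variable K : fieldType.
Implicit Types S T : pseries K.

Lemma psmulXnE d S n : (psvar K ^+ d * S) n = if (d <= n)%N then S (n - d)%N else 0.
Proof.
elim: d n => [|d IH] n; first by rewrite expr0 mul1r subn0.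
by rewrite exprS -mulrA psmulXE; case: n => [|n] //; rewrite IH ltnS subSS.
Qed.

Lemma psmul_van d S T : (forall n, (n < d)%N -> S n = 0) -> forall n, (n < d)%N -> (S * T) n = 0.
Proof.
move=> H n nd; rewrite [LHS]/(psmul S T n) /psmul big1// => i _.
by rewrite H ?mul0r//; apply: leq_ltn_trans nd; rewrite -ltnS.
Qed.

Lemma ps_factorXn d S : (forall n, (n < d)%N -> S n = 0) ->
  S = psvar K ^+ d * ((fun n => S (n + d)%N) : pseries K).
Proof.
move=> H; apply/funext => n; rewrite psmulXnE; case: ifPn => [dn|]; first by rewrite subnK.
by rewrite -ltnNge => /H.
Qed.

Lemma psXn_reg d S : psvar K ^+ d * S = 0 -> S = 0.
Proof.
move=> H; apply/funext => n; have := congr1 (fun T : pseries K => T (n + d)%N) H.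
by rewrite /= psmulXnE leq_addl addnK.
Qed.

Variable J : finType.
Definition psc (S : pseries K) (g : J -> pseries K) : J -> pseries K := fun j => S * g j.

Lemma pscDr S g h : psc S (g + h) = psc S g + psc S h.
Proof. by apply/funext => j; rewrite /psc mulrDr. Qed.
Lemma pscA S T g : psc S (psc T g) = psc (S * T) g.
Proof. by apply/funext => j; rewrite /psc mulrA. Qed.
Lemma psc1 g : psc 1 g = g.
Proof. by apply/funext => j; rewrite /psc mul1r. Qed.
Lemma pscNl S g : psc (- S) g = - psc S g.
Proof. by apply/funext => j; rewrite /psc mulNr. Qed.
Lemma psc_sumE k (S : 'I_k -> pseries K) (e : 'I_k -> J -> pseries K) j :
  (\sum_(i < k) psc (S i) (e i)) j = \sum_(i < k) S i * e i j.
Proof. by rewrite fct_sumE. Qed.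

(* Echelon reduction, one coordinate at a time; the last clause is an Artin-Rees bound. *)
Lemma pseries_submodule (D : {set J}) (G : set (J -> pseries K)) :
  G 0 -> (forall S x y, G x -> G y -> G (psc S x + y)) ->
  (forall g, G g -> forall j, j \notin D -> g j = 0) ->
  exists k (e : 'I_k -> J -> pseries K) n,
  [/\ forall S : 'I_k -> pseries K, \sum_(i < k) psc (S i) (e i) = 0 -> forall i, S i = 0,
      forall i, G (e i),
      forall g, G g -> exists S : 'I_k -> pseries K, g = \sum_(i < k) psc (S i) (e i)
    & forall g, G g -> (forall j i, (i < n)%N -> g j i = 0) ->
        exists2 h, G h & g = psc (psvar K) h].
Proof.
move: {2}#|D| (leqnn #|D|) => r; elim: r D G => [|r IH] D G Dr G0 GP GD.
  have g0 g : G g -> g = 0.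
    move=> Gg; apply/funext => j; apply: GD => //.
    by move: Dr; rewrite leqn0 cards_eq0 => /eqP->; rewrite finset.in_set0.
  exists 0%N, (fun=> 0), 0%N; split=> [S _ []//|[]//|g /g0->|g /g0-> _].
    by exists (fun=> 0); rewrite big_ord0.
  by exists 0 => //; apply/funext => j; rewrite /psc mulr0.
have [D0|[j0 j0D]] := set_0Vmem D; first by apply: (IH D) => //; rewrite D0 cards0.
have Dr' : (#|D :\ j0| <= r)%N by move: Dr; rewrite (cardsD1 j0) j0D.
have [z|nz] := pselect (forall g, G g -> g j0 = 0).
  have := IH (D :\ j0) G Dr' G0 GP; apply=> g Gg j.
  by rewrite !finset.inE negb_and negbK => /orP[/eqP->|]; [exact: z|exact: GD].
(* The least order d of the coordinate j0 over G; an element attaining it serves as pivot. *)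
have ex : exists d, `[< exists2 g, G g & g j0 d != 0 >].
  move/existsNP: nz => [g /not_implyP[Gg /eqP gj]].
  have /existsNP[d /eqP gd] : ~ forall d, g j0 d = 0.
    by move=> H; move/eqP: gj; apply; apply/funext.
  by exists d; apply/asboolP; exists g.
pose d := ex_minn ex.
have [g1 Gg1 [g1d dmin]] : exists2 g1, G g1 & g1 j0 d != 0 /\
    forall g n, G g -> (n < d)%N -> g j0 n = 0.
  rewrite /d; case: ex_minnP => d' /asboolP[g Gg gd] dm; exists g => //; split=> // h n Gh nd.
  apply/eqP; apply/negP => /negP hn; have : (d' <= n)%N by apply: dm; apply/asboolP; exists h.
  by rewrite leqNgt nd.
have [T TE] := pseries_inv (S := fun n => g1 j0 (n + d)%N) g1d.
have GZ S g : G g -> G (psc S g) by move=> Gg; rewrite -[psc S g]addr0; apply: GP.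
have GB g h : G g -> G h -> G (g - h).
  by move=> Gg Gh; rewrite addrC -[h]psc1 -pscNl; apply: GP.
(* The pivot rescaled by a unit, so that its coordinate j0 is exactly b^d. *)
pose g0 := psc T g1.
have Gg0 : G g0 by exact: GZ.
have g0E : g0 j0 = psvar K ^+ d.
  rewrite /g0 /psc (ps_factorXn (d := d) (S := g1 j0)); last by move=> n; apply: dmin.
  by rewrite mulrCA TE mulr1.
pose c (g : J -> pseries K) : pseries K := fun n => g j0 (n + d)%N.
have cE g : G g -> (g - psc (c g) g0) j0 = 0.
  move=> Gg; rewrite addrfctE opprfctE /psc g0E mulrC -ps_factorXn ?subrr// => n.
  exact: dmin.
pose G1 : set (J -> pseries K) := fun g => G g /\ g j0 = 0.
have G1c g : G g -> G1 (g - psc (c g) g0) by move=> Gg; split; [exact: GB (GZ _ _ _)|exact: cE].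
have [k [e [n [free eG span AR]]]] : exists k (e : 'I_k -> J -> pseries K) n,
  [/\ forall S : 'I_k -> pseries K, \sum_(i < k) psc (S i) (e i) = 0 -> forall i, S i = 0,
      forall i, G1 (e i),
      forall g, G1 g -> exists S : 'I_k -> pseries K, g = \sum_(i < k) psc (S i) (e i)
    & forall g, G1 g -> (forall j i, (i < n)%N -> g j i = 0) ->
        exists2 h, G1 h & g = psc (psvar K) h].
  apply: (IH (D :\ j0)) => //.
  - move=> S x y [Gx x0] [Gy y0]; split; first exact: GP.
    by rewrite addrfctE /psc x0 y0 mulr0 addr0.
  - move=> g [Gg gj0] j; rewrite !finset.inE negb_and negbK => /orP[/eqP->//|].
    exact: GD.
(* If g has order at least n+d+1, then its quotient [c g] by the pivot has order at least n+1. So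
   [c g] is divisible by b, and g - c(g) g0 still has order at least n, as the inductive bound
   requires. *)
exists k.+1, (fun i => if unlift ord0 i is Some i' then e i' else g0), (n + d).+1; split.
- move=> S; rewrite big_ord_recl unlift_none.
  under eq_bigr do rewrite liftK.
  move=> H; have S0 : S ord0 = 0.
    have := congr1 (fun g : J -> pseries K => g j0) H.
    rewrite addrfctE psc_sumE big1 ?addr0; last by move=> i _; rewrite (eG i).2 mulr0.
    by rewrite /psc g0E mulrC => /psXn_reg.
  move: H; rewrite S0 (_ : psc 0 g0 = 0) ?add0r => [/free H i|].
    by case: (unliftP ord0 i) => [i' ->|->].
  by apply/funext => j; rewrite /psc mul0r.
- by move=> i; case: unlift => [i'|] //; case: (eG i').
- move=> g Gg; have [S SE] := span _ (G1c g Gg).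
  exists (fun i => if unlift ord0 i is Some i' then S i' else c g).
  rewrite big_ord_recl unlift_none.
  under eq_bigr do rewrite liftK.
  by rewrite -SE addrC subrK.
- move=> g Gg gn; have cn i : (i < n.+1)%N -> c g i = 0 by move=> L; apply: gn; lia.
  have cX : c g = psvar K * psshift (c g).
    by apply/funext => i; rewrite psmulXE; case: i => [|i] //; apply: cn.
  have [|h1 [Gh1 _] h1E] := AR _ (G1c g Gg).
    move=> j i L; transitivity (g j i - (c g * g0 j : pseries K) i); first by [].
    rewrite gn; last lia.
    by rewrite (psmul_van (d := n.+1))// ?subrr//; lia.
  exists (psc (psshift (c g)) g0 + h1); first exact: GP.
  by rewrite pscDr pscA -cX -h1E addrC subrK.
Qed.

Lemma lattice_submodule (M : zmodType) (act : pseries K -> M -> M)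
    (phi : M -> J -> pseries K) (G : set M) :
  injective phi -> {morph phi : x y / x + y} ->
  (forall S x, phi (act S x) = psc S (phi x)) ->
  G 0 -> (forall S x y, G x -> G y -> G (act S x + y)) ->
  exists k (e : 'I_k -> M) n,
  [/\ forall S : 'I_k -> pseries K, \sum_(i < k) act (S i) (e i) = 0 -> forall i, S i = 0,
      forall i, G (e i),
      forall g, G g -> exists S : 'I_k -> pseries K, g = \sum_(i < k) act (S i) (e i)
    & forall g, G g -> (forall j i, (i < n)%N -> phi g j i = 0) ->
        exists2 h, G h & g = act (psvar K) h].
Proof.
move=> phiI phiD phiZ G0 GP.
have phi0 : phi 0 = 0 by apply: (addrI (phi 0)); rewrite -phiD !addr0.
have phiS k (S : 'I_k -> pseries K) (e : 'I_k -> M) :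
    phi (\sum_(i < k) act (S i) (e i)) = \sum_(i < k) psc (S i) (phi (e i)).
  rewrite (big_morph phi phiD phi0); apply: eq_bigr => i _; exact: phiZ.
have [k [e [n [free eG span AR]]]] : exists k (e : 'I_k -> J -> pseries K) n,
  [/\ forall S : 'I_k -> pseries K, \sum_(i < k) psc (S i) (e i) = 0 -> forall i, S i = 0,
      forall i, (phi @` G) (e i),
      forall g, (phi @` G) g -> exists S : 'I_k -> pseries K, g = \sum_(i < k) psc (S i) (e i)
    & forall g, (phi @` G) g -> (forall j i, (i < n)%N -> g j i = 0) ->
        exists2 h, (phi @` G) h & g = psc (psvar K) h].
  apply: (@pseries_submodule [set: J]%SET).
  - by exists 0.
  - move=> S x y [x' Gx <-] [y' Gy <-]; exists (act S x' + y'); first exact: GP.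
    by rewrite phiD phiZ.
  - by move=> g _ j; rewrite finset.in_setT.
have /(_ _)/cid2 pre i := eG i.
exists k, (fun i => projT1 (pre i)), n.
pose e' i := projT1 (pre i).
have phie i : phi (e' i) = e i by rewrite /e'; case: (pre i).
split.
- move=> S /(congr1 phi); rewrite phiS phi0 => H; apply: free; rewrite -[RHS]H.
  by apply: eq_bigr => i _; rewrite phie.
- by move=> i; case: (pre i).
- move=> g Gg; have [|S SE] := span (phi g); first by exists g.
  exists S; apply: phiI; rewrite phiS SE; apply: eq_bigr => i _; by rewrite phie.
- move=> g Gg gn; have [||h' [h Gh <-] hE] := AR (phi g); [by exists g|exact: gn|].
  by exists h => //; apply: phiI; rewrite phiZ.
Qed.
End PseriesLattices.

(** * Bernstein polynomials of submodules of Xi *)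

Section XiLattice.
Variables (K : numClosedFieldType) (m : nat) (lam : 'I_m -> rat) (N : nat) (V : vectType K).
Local Notation XiV := (Xi lam N V).
Implicit Types (x z : XiV) (u : Ahat K).

Definition xi_coord x : 'I_m * 'I_N.+1 * 'I_(\dim {:V}) -> pseries K :=
  fun '(i, j, l) n => coord (vbasis {:V}) l (x (n, i, j)).

Lemma xi_coord_inj : injective xi_coord.
Proof.
move=> x x' H; apply: xiP => n i j.
rewrite [LHS](coord_vbasis (memvf _)) [RHS](coord_vbasis (memvf _)).
apply: eq_bigr => l _; congr (_ *: _).
exact: (congr1 (fun g : _ -> pseries K => g (i, j, l) n) H).
Qed.

Lemma xi_coordD : {morph xi_coord : x y / x + y}.
Proof.
move=> x y; apply/funext => -[[i j] l]; apply/funext => n.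
exact: raddfD.
Qed.

Lemma xi_coordZ (S : pseries K) x : xi_coord (bser S *: x) = psc S (xi_coord x).
Proof.
apply/funext => -[[i j] l]; apply/funext => n.
pose c : {linear V -> K^o} := coord (vbasis {:V}) l.
transitivity (c ((bser S *: x) (n, i, j))); first by [].
rewrite bser_scaleE raddf_sum /=.
by apply: eq_bigr => q _; rewrite linearZ.
Qed.

Lemma xi_coord_van n x : xvan n x -> forall t i, (i < n)%N -> xi_coord x t i = 0.
Proof. by move=> H [[i j] l] k kn; rewrite /xi_coord H// raddf0. Qed.

(** Xi is free of finite rank over K[[b]], on the e_(i,j) tensored with a basis of V. The last
    clause is the Artin-Rees inclusion of the intersection of G and b^n Xi in b G. *)
Lemma Xi_submodule (G : set XiV) :
  G 0 -> (forall (S : pseries K) x y, G x -> G y -> G (bser S *: x + y)) ->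
  exists k (e : 'I_k -> XiV) n,
  [/\ forall S : 'I_k -> pseries K, \sum_(i < k) bser (S i) *: e i = 0 -> forall i, S i = 0,
      forall i, G (e i),
      forall g, G g -> exists S : 'I_k -> pseries K, g = \sum_(i < k) bser (S i) *: e i
    & forall g, G g -> xvan n g -> exists2 h, G h & g = ahat_b *: h].
Proof.
move=> G0 GP; have [k [e [n [H1 H2 H3 H4]]]] := @lattice_submodule K _ XiV
  (fun S x => bser S *: x) xi_coord G xi_coord_inj xi_coordD xi_coordZ G0 GP.
exists k, e, n; split=> // g Gg /xi_coord_van gn; exact: H4.
Qed.

(** The operator b^-1 a, which exists on Xi because a maps Xi into b Xi and b is injective. *)
Definition xi_D z : XiV := fun '(n, i, j) => Xi_a lam z (n.+1, i, j).

Lemma xi_DE z n i j : xi_D z (n, i, j) =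
  (ratr (lam i) + n%:R) *: z (n, i, j) + fext (xcoef z n) i j.+1.
Proof. by rewrite /= /fext /xcoef; case: insub. Qed.

Lemma xi_bD z : ahat_b *: xi_D z = ahat_a *: z.
Proof. by rewrite ahat_b_Xi ahat_a_Xi; apply/funext => -[[[|n] i] j]. Qed.
End XiLattice.

(** * Commuting powers of b past Atilde *)

Section Localization.
Variable K : numClosedFieldType.

Lemma mulb_left (u : Ahat K) : exists v, ahat_b * u = v * ahat_b.
Proof.
exists (fun s t => (ahat_b * u) s t.+1).
suff H : forall s, (ahat_b * u) s 0%N = 0.
  by apply: ahatP => s [|t]; rewrite ahat_mulbE ?H.
move: u; apply: ahat_density.
- by move=> s; rewrite mulr1; case: s.
- move=> u H s; rewrite mulrA rmulaE; case: s => [|s]; first by rewrite /rmula subr0.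
  by rewrite -(H s) /rmula subr0.
- by move=> u H s; rewrite mulrA ahat_mulbE.
- by move=> c u v Hu Hv s; rewrite mulrDr -scalerAr ahatDE ahatZE Hu Hv mulr0 addr0.
- move=> u H s; have [v Hv vu] := H s.+1.
  have -> : u = (u - v) + v by rewrite subrK.
  rewrite mulrDr ahatDE Hv addr0.
  by apply: (vanishesM (@vanishes_b K) vu); lia.
Qed.

(** An Ore condition for the powers of b; the new factor stays polynomial in a because its
    coefficients are those of b u, shifted. *)
Lemma at_bX_left (u : Atilde K) n : exists v : Atilde K, at_b ^+ n * u = v * at_b ^+ n.
Proof.
have H (w : Atilde K) : exists v : Atilde K, at_b * w = v * at_b.
  have [v vE] := mulb_left w.
  have vT : v \in @tilde K.
    have /tildeP bwT : (ahat_b * atval w) \in @tilde K.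
      have := valP (at_b * w); by rewrite rmorphM.
    apply/tildeP => t; have [d dP] := bwT t.+1; exists d => s ds.
    by have := dP s ds; rewrite vE ahat_mulbE.
  by exists (MkAtilde vT); apply: val_inj; rewrite !rmorphM.
elim: n u => [|n IH] u; first by exists u; rewrite !expr0 mulr1 mul1r.
have [v1 E1] := IH u; have [v2 E2] := H v1.
by exists v2; rewrite exprS -mulrA E1 mulrA E2 -mulrA.
Qed.

Lemma at_bXE n : atval (at_b ^+ n) = ahat_b ^+ n :> Ahat K.
Proof. exact: (rmorphXn val). Qed.

End Localization.

Section OperatorPolynomials.
Variables (K : fieldType) (A : algType K) (M : lmodType A) (U : M -> M).
Hypothesis UD : {morph U : x y / x + y}.
Hypothesis UZ : forall (c : K) x, U (c%:A *: x) = c%:A *: U x.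

Definition opoly (p : {poly K}) (x : M) : M := \sum_(i < size p) (p`_i)%:A *: iter i U x.

Lemma opolyE n (p : {poly K}) x : (size p <= n)%N -> opoly p x = \sum_(i < n) (p`_i)%:A *: iter i U x.
Proof.
move=> H; rewrite -(subnKC H) big_split_ord /= [X in _ + X]big1 ?addr0// => i _.
by rewrite nth_default ?scale0r ?scale0r// leq_addr.
Qed.

Lemma opoly_factor c (q : {poly K}) x : opoly (('X - c%:P) * q) x = U (opoly q x) - c%:A *: opoly q x.
Proof.
have U0 : U 0 = 0 by apply: (addrI (U 0)); rewrite -UD !addr0.
rewrite (opolyE (n := (size q).+1)); last first.
  by apply: leq_trans (size_polyMleq _ _) _; rewrite size_XsubC.
rewrite [X in _ - _ *: X](opolyE x (leqnSn (size q))) /opoly (big_morph U UD U0) scaler_sumr.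
have cE i : (('X - c%:P) * q)`_i = (if i == 0%N then 0 else q`_i.-1) - c * q`_i.
  by rewrite mulrBl mul_polyC coefB coefXM coefZ.
under [LHS]eq_bigr do rewrite cE scalerBl scalerBl.
rewrite sumrB; congr (_ - _).
  rewrite big_ord_recl /= !scale0r add0r; apply: eq_bigr => i _.
  by rewrite UZ.
by apply: eq_bigr => i _; rewrite [RHS]scalerA mulr_algl scalerA.
Qed.
End OperatorPolynomials.

(** * Modules embedded in Xi are geometric *)

Section Geometric.
Variables (K : numClosedFieldType) (m : nat) (lam : 'I_m -> rat) (N : nat) (V : vectType K).
Local Notation XiV := (Xi lam N V).
Implicit Types (z : XiV).

Definition xi_ND z : XiV := - xi_D z.

Lemma xi_NDD : {morph xi_ND : x y / x + y}.
Proof.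
move=> x y; rewrite /xi_ND -opprD; congr (- _); apply: xi_b_inj.
by rewrite scalerDr !xi_bD scalerDr.
Qed.

Lemma xi_NDZ (c : K) z : xi_ND (c%:A *: z) = c%:A *: xi_ND z.
Proof.
rewrite /xi_ND scalerN; congr (- _); apply: xi_b_inj.
have comm u y : u *: (c%:A *: y) = c%:A *: (u *: y) :> XiV.
  by rewrite !scalerA mulr_algl mulr_algr.
by rewrite xi_bD comm -xi_bD [RHS]comm.
Qed.

(* Each factor X + lam_i + n of the polynomial kills one more row of the block (n, i). *)
Lemma xi_ND_nilpotent (s : seq K) z n i :
  (N < count_mem (- (ratr (lam i) + n%:R)) s)%N ->
  forall j, opoly xi_ND (\prod_(c <- s) ('X - c%:P)) z (n, i, j) = 0.
Proof.
move=> H.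
(* Rows are cleared from j = N downwards: b^-1 a acts on row j as the scalar lam_i + n plus row j+1,
   so a factor with root -(lam_i + n) leaves only row j+1. *)
suff {H} E : forall (j : 'I_N.+1), (N < j + count_mem (- (ratr (lam i) + n%:R)) s)%N ->
    opoly xi_ND (\prod_(c <- s) ('X - c%:P)) z (n, i, j) = 0.
  by move=> j; apply: E; rewrite ltn_addl.
elim: s => [|c s IH] j; first by rewrite addn0 ltnNge -ltnS ltn_ord.
rewrite big_cons opoly_factor; [|exact: xi_NDD|exact: xi_NDZ].
set w := opoly _ _ _ in IH *; rewrite /xi_ND xiDE !xiNE xi_DE xi_scalarE /= => L.
have -> : fext (xcoef w n) i j.+1 = 0.
  rewrite /fext; case: insubP => // j' _ j'E; apply: IH.
  move: L; rewrite j'E; move: (count_mem _ _) => q; case: (_ == _); rewrite /= ?add1n ?add0n ?addnS ?addSn //; exact: ltnW.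
rewrite addr0 -opprD -scalerDl; apply/eqP; rewrite oppr_eq0 scaler_eq0.
have [/eqP cE|ne] := boolP (c == - (ratr (lam i) + n%:R)); first by rewrite cE subrr eqxx.
by rewrite IH ?eqxx ?orbT//; move: L; rewrite (negbTE ne).
Qed.

Section WithEmbedding.
Variables (M : lmodType (Ahat K)) (f : M -> XiV).
Hypotheses (fL : linear f) (fI : injective f) (lam0 : forall i, 0 < lam i).

Lemma linear_addE x y : f (x + y) = f x + f y.
Proof. by have := fL 1 x y; rewrite !scale1r. Qed.
Lemma linear_zeroE : f 0 = 0.
Proof. by apply: (addrI (f 0)); rewrite -linear_addE !addr0. Qed.
Lemma linear_scaleE u x : f (u *: x) = u *: f x.
Proof. by have := fL u x 0; rewrite !addr0 linear_zeroE addr0. Qed.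

Lemma ab_module_tilde_Xi : exists k, ab_module k [set: tildem XiV].
Proof.
have [k [e [n [free _ span _]]]] := @Xi_submodule K m lam N V setT I (fun _ _ _ _ _ => I).
exists k; split; first by [].
have bcE S : b_comb (e : 'I_k -> tildem XiV) S = \sum_(i < k) bser (S i) *: e i by [].
exists e; split.
  move=> S S' E; apply/ffunP => i; apply/eqP; rewrite -subr_eq0; apply/eqP.
  apply: (free (fun i => S i - S' i)).
  transitivity (b_comb (e : 'I_k -> tildem XiV) S - b_comb (e : 'I_k -> tildem XiV) S'); last by rewrite E subrr.
  rewrite !bcE -sumrB; apply: eq_bigr => j _.
  have -> : bser (S j - S' j) = bser (S j) - bser (S' j).
    by apply: ahatP => s t; rewrite ahatBE /bser; case: eqP; rewrite ?subr0.
  by rewrite scalerBl.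
rewrite eqEsubset; split=> // x _; have [S ->] := span x I.
by exists (finfun S) => //; rewrite bcE; apply: eq_bigr => i _; rewrite ffunE.
Qed.

(** Xi itself serves as the simple pole module, [xi_D] providing the division of a by b. *)
Lemma regular_embedding : regular (tildem M).
Proof.
have fL' : linear (f : tildem M -> tildem XiV) by move=> u x y; exact: fL.
pose mx := GRing.isLinear.Build (Atilde K) (tildem M) (tildem XiV) *:%R f fL'.
pose F : {linear tildem M -> tildem XiV} := HB.pack f mx.
exists (tildem XiV), F; split; [exact: ab_module_tilde_Xi| |exact: fI].
move=> x _; exists (xi_D x) => //.
exact: (esym (xi_bD _)).
Qed.

Section Loc.
Variables (L : lmodType (Atilde K)) (j : {linear tildem M -> L}).
Hypothesis Lj : b_localization j.

(* y in L = M[b^-1] corresponds to z in Xi under the extension of f to M[b^-1]. *)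
Definition xi_rel (y : L) z : Prop :=
  exists n (x : M), at_b ^+ n *: y = j x /\ f x = ahat_b ^+ n *: z.

Lemma at_bX_inj n : injective (fun y : L => at_b ^+ n *: y).
Proof.
have [_ bb _] := Lj; elim: n => [|n IH] y y'; first by rewrite !expr0 !scale1r.
by rewrite !exprSr -!scalerA => /IH; exact: (bij_inj bb).
Qed.

Lemma xi_bX_inj n : injective (fun z : XiV => ahat_b ^+ n *: z).
Proof.
elim: n => [|n IH] y y'; first by rewrite !expr0 !scale1r.
by rewrite !exprSr -!scalerA => /IH; exact: xi_b_inj.
Qed.

Lemma xi_relX n' n y (x : M) z : at_b ^+ n *: y = j x -> f x = ahat_b ^+ n *: z ->
  at_b ^+ (n' + n) *: y = j (ahat_b ^+ n' *: x : M) /\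
  f (ahat_b ^+ n' *: x) = ahat_b ^+ (n' + n) *: z.
Proof.
move=> E1 E2; rewrite !exprD -!scalerA E1 linear_scaleE E2; split=> //.
have -> : ahat_b ^+ n' *: x = at_b ^+ n' *: (x : tildem M).
  by rewrite -at_bXE.
by rewrite linearZ.
Qed.

Lemma xi_rel_common y y' z z' : xi_rel y z -> xi_rel y' z' -> exists n (x x' : M),
  [/\ at_b ^+ n *: y = j x, at_b ^+ n *: y' = j x', f x = ahat_b ^+ n *: z & f x' = ahat_b ^+ n *: z'].
Proof.
move=> [n [x [E1 E2]]] [n' [x' [E1' E2']]].
have [F1 F2] := xi_relX n' E1 E2; have [F1' F2'] := xi_relX n E1' E2'.
by exists (n' + n)%N, (ahat_b ^+ n' *: x), (ahat_b ^+ n *: x'); rewrite addnC in F1' F2'.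
Qed.

Lemma xi_rel_inj y y' z : xi_rel y z -> xi_rel y' z -> y = y'.
Proof.
move=> H /(xi_rel_common H)[n [x [x' [E1 E2 E3 E4]]]].
by apply: (at_bX_inj (n := n)); rewrite E1 E2; congr (j _); apply: fI; rewrite E3.
Qed.

Lemma xi_rel_fun y z z' : xi_rel y z -> xi_rel y z' -> z = z'.
Proof.
move=> H /(xi_rel_common H)[n [x [x' [E1 E2 E3 E4]]]].
have [ij _ _] := Lj.
by apply: (xi_bX_inj (n := n)); rewrite -E3 -E4; congr (f _); apply: ij; rewrite -E1.
Qed.

Lemma xi_relD y y' z z' : xi_rel y z -> xi_rel y' z' -> xi_rel (y + y') (z + z').
Proof.
move=> H /(xi_rel_common H)[n [x [x' [E1 E2 E3 E4]]]].
by exists n, (x + x'); rewrite !scalerDr E1 E2 linear_addE E3 E4 -raddfD.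
Qed.

(** As u does not commute with b^n, the numerator x is multiplied by the v for which b^n u = v
    b^n. *)
Lemma xi_relZ u y z : xi_rel y z -> xi_rel (u *: y) (atval u *: z).
Proof.
move=> [n [x [E1 E2]]]; have [v vE] := at_bX_left u n.
exists n, (atval v *: x); split; first by rewrite scalerA vE -scalerA E1 -linearZ.
by rewrite linear_scaleE E2 !scalerA -!at_bXE -!(rmorphM val) vE.
Qed.

Lemma xi_relN y z : xi_rel y z -> xi_rel (- y) (- z).
Proof.
move=> [n [x [E1 E2]]]; exists n, (- x); rewrite !scalerN E1 -E2; split.
  exact: (esym (raddfN j x)).
by rewrite -scaleN1r linear_scaleE scaleN1r.
Qed.

Lemma xi_rel_b y z : xi_rel (at_b *: y) (ahat_b *: z) -> xi_rel y z.
Proof. by move=> [n [x [E1 E2]]]; exists n.+1, x; rewrite !exprSr -!scalerA. Qed.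

Lemma xi_rel_j (x : M) : xi_rel (j x) (f x).
Proof. by exists 0%N, x; rewrite !expr0 !scale1r. Qed.

Lemma xi_rel0 : xi_rel 0 0.
Proof. by have := xi_rel_j 0; rewrite linear_zeroE raddf0. Qed.

Lemma xi_rel_sum k (y : 'I_k -> L) (z : 'I_k -> XiV) : (forall i, xi_rel (y i) (z i)) ->
  xi_rel (\sum_(i < k) y i) (\sum_(i < k) z i).
Proof. by move=> H; elim/big_rec2: _ => [|i a b _]; [exact: xi_rel0|exact: xi_relD]. Qed.

(** The intersection of M[b^-1] with Xi inside Xi[b^-1]. It is a simple pole lattice containing M,
    hence contains [sharp j]; this is how [sharp j] gets into Xi. *)
Definition xi_lattice : set L := [set y | exists z, xi_rel y z].

Lemma xi_lattice_ab : exists k, ab_module k xi_lattice.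
Proof.
have [||k [e [n [free eG span _]]]] := @Xi_submodule K m lam N V [set z | exists y, xi_rel y z].
- by exists 0; exact: xi_rel0.
- move=> S x x' [y yx] [y' yx']; exists (at_bser S *: y + y').
  by apply: xi_relD => //; exact: xi_relZ.
have /(_ _)/cid pre i := eG i; pose e' i := projT1 (pre i).
have eR i : xi_rel (e' i) (e i) by rewrite /e'; case: (pre i).
have bR (S : 'I_k -> pseries K) :
    xi_rel (\sum_(i < k) at_bser (S i) *: e' i) (\sum_(i < k) bser (S i) *: e i).
  by apply: xi_rel_sum => i; exact: xi_relZ.
exists k; split.
  split; first by exists 0; exact: xi_rel0.
  move=> u y y' [z zy] [z' zy']; exists (atval u *: z + z').
  by apply: xi_relD => //; exact: xi_relZ.
exists e'; split.
  move=> S S' E; apply/ffunP => i; apply/eqP; rewrite -subr_eq0; apply/eqP.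
  apply: (free (fun i => S i - S' i)).
  have -> : \sum_(i < k) bser (S i - S' i) *: e i =
      \sum_(i < k) bser (S i) *: e i - \sum_(i < k) bser (S' i) *: e i.
    rewrite -sumrB; apply: eq_bigr => l _.
    have -> : bser (S l - S' l) = bser (S l) - bser (S' l).
      by apply: ahatP => s t; rewrite ahatBE /bser; case: eqP; rewrite ?subr0.
    by rewrite scalerBl.
  apply/eqP; rewrite subr_eq0; apply/eqP; apply: xi_rel_fun (bR _) _.
  by have := bR S'; rewrite -/(b_comb e' S') -E.
rewrite eqEsubset; split=> [y [S _ <-]|y [z yz]]; first by exists (\sum_(i < k) bser (S i) *: e i); exact: bR.
have [S SE] := span z (ex_intro _ y yz).
exists (finfun S) => //; apply: (@xi_rel_inj _ _ z) => //; rewrite SE /b_comb.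
under eq_bigr do rewrite ffunE.
exact: bR.
Qed.

Lemma xi_lattice_simple : simple_pole xi_lattice.
Proof.
move=> y [z yz]; have [_ [b' bK b'K] _] := Lj.
exists (b' (at_a *: y)); last by rewrite b'K.
exists (xi_D z); apply: xi_rel_b; rewrite b'K xi_bD; exact: (xi_relZ at_a yz).
Qed.

Lemma sharp_sub_lattice : sharp j `<=` xi_lattice.
Proof.
have [k ab] := xi_lattice_ab.
move=> y /(_ _ _ ab xi_lattice_simple); apply=> _ [x _ <-]; exists (f x); exact: xi_rel_j.
Qed.

Lemma sharp_opoly_root (T : L -> L) (P : {poly K}) r :
  (forall y, at_b *: T y = - (at_a *: y)) ->
  (forall Q, annihilates (sharp j) T Q -> P %| Q) -> root P r ->
  exists2 q : rat, q < 0 & r = ratr q.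
Proof.
move=> TE PQ Pr.
have shS : forall (u : Atilde K) y y', sharp j y -> sharp j y' -> sharp j (u *: y + y').
  move=> u y y' Sy Sy' G k abG sG jG; have [[_ GP] _] := abG.
  by apply: GP; [exact: Sy abG _ _|exact: Sy' abG _ _].
have sh0 : sharp j 0 by move=> G k [[G0 _] _] _ _.
(* T preserves every competing lattice G, because a G is contained in b G and b is injective on
   L. *)
have shT y : sharp j y -> sharp j (T y).
  move=> Sy G k abG sG jG; have [[G0 GP] _] := abG.
  have [y' Gy' E] := sG _ (Sy _ _ abG sG jG).
  have [_ bb _] := Lj.
  have -> : T y = - 1 *: y' + 0 by apply: (bij_inj bb); rewrite /= TE E addr0 scaleN1r scalerN.
  exact: GP.
have shZ u y : sharp j y -> sharp j (u *: y) by move=> Sy; rewrite -[_ *: _]addr0; exact: shS.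
have [||k [e [n [_ _ _ AR]]]] :=
    @Xi_submodule K m lam N V [set z | exists2 y, sharp j y & xi_rel y z].
- by exists 0 => //; exact: xi_rel0.
- move=> S x x' [y Sy yx] [y' Sy' yx']; exists (at_bser S *: y + y'); first exact: shS.
  by apply: xi_relD => //; exact: xi_relZ.
(* The bound l < n is the Artin-Rees constant of the image of [sharp j] in Xi: an element there
   whose first n coefficients vanish is b times another. The multiplicity N+1 is what
   [xi_ND_nilpotent] needs to clear all rows. *)
pose qs : seq rat := flatten (nseq N.+1
  (flatten [seq [seq lam i + l%:R | i <- enum 'I_m] | l <- iota 0 n])).
pose cs : seq K := [seq - ratr q | q <- qs].
have TR y z : xi_rel y z -> xi_rel (T y) (xi_ND z).
  move=> yz; apply: xi_rel_b; rewrite TE scalerN xi_bD.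
  exact: xi_relN (xi_relZ at_a yz).
have opR y z p : xi_rel y z -> xi_rel (opoly T p y) (opoly xi_ND p z).
  move=> yz; apply: xi_rel_sum => i.
  have itR l : xi_rel (iter l T y) (iter l xi_ND z) by elim: l => //= l; exact: TR.
  have -> : (p`_i)%:A = atval ((p`_i)%:A) :> Ahat K by [].
  exact: xi_relZ.
have sh_op y p : sharp j y -> sharp j (opoly T p y).
  move=> Sy; apply: big_ind => // [a b Sa Sb|i _]; first by rewrite -[a]scale1r; exact: shS.
  by apply: shZ; elim: (nat_of_ord i) => //= l; exact: shT.
have ann : annihilates (sharp j) T (\prod_(c <- cs) ('X - c%:P)).
  move=> y Sy; have [z yz] := sharp_sub_lattice Sy.
  have [||z' [y' Sy' yz'] zE] := AR (opoly xi_ND (\prod_(c <- cs) ('X - c%:P)) z).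
  - by exists (opoly T (\prod_(c <- cs) ('X - c%:P)) y); [exact: sh_op|exact: opR].
  - move=> l i i' ln; apply: xi_ND_nilpotent.
    pose q0 := lam i + l%:R.
    have -> : ratr (lam i) + l%:R = ratr q0 :> K by rewrite rmorphD /= ratr_nat.
    rewrite count_map; apply: (@leq_trans (count_mem q0 qs)).
      rewrite count_flatten map_nseq sumn_nseq -[X in (X <= _)%N]mul1n.
      apply: leq_mul => //; rewrite -has_count has_pred1; apply/flattenP.
      exists [seq lam i + l%:R | i <- enum 'I_m]; last by apply: map_f; rewrite mem_enum.
      by apply: map_f; rewrite mem_iota.
    by apply: sub_count => q /= /eqP->.
  exists y' => //; apply: (@xi_rel_inj _ _ (ahat_b *: z')); last exact: (xi_relZ at_b yz').
  by rewrite -zE; exact: opR.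
have : root (\prod_(c <- cs) ('X - c%:P)) r.
  by have /dvdpP[Q ->] := PQ _ ann; rewrite rootM Pr orbT.
rewrite root_prod_XsubC => /mapP[q qin ->]; exists (- q); last by rewrite rmorphN.
rewrite oppr_lt0; move: qin => /flattenP[s]; rewrite mem_nseq => /eqP-> /flattenP[s' /mapP[l _ ->]].
by move=> /mapP[i _ ->]; rewrite ltr_wpDr.
Qed.
End Loc.

Lemma geometric_embedding : geometric (tildem M).
Proof.
split; first exact: regular_embedding.
move=> P r [L [j [T [Lj TE _ PQ]]]]; apply: (sharp_opoly_root Lj TE) => Q /PQ; exact.
Qed.
End WithEmbedding.
End Geometric.

(** * b-adically complete modules and their bases *)

Section BAdic.
Variables (K : fieldType) (M : lmodType (Ahat K)).
Implicit Types (x w : M).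

Definition b_injective := injective (fun x : M => ahat_b *: x).
Definition b_separated := forall x, (forall n, exists w, x = ahat_b ^+ n *: w) -> x = 0.
(** [tau n] is the tail t_n + b t_(n+1) + b^2 t_(n+2) + ...; the recursion states the convergence of
    all tails without a topology. *)
Definition b_complete := forall t : nat -> M, exists tau : nat -> M,
  forall n, tau n = t n + ahat_b *: tau n.+1.

(** Iterating the relation puts [D i] in b^n M for all n. This replaces comparison of b-adic series:
    an identity is proved once the difference of its sides reproduces itself, times b, for shifted
    data. *)
Lemma b_coinduction (I : Type) (D : I -> M) (s : I -> I) : b_separated ->
  (forall i, D i = ahat_b *: D (s i)) -> forall i, D i = 0.
Proof.
move=> sep H i; apply: sep => n; exists (D (iter n s i)).
elim: n => [|n IH]; first by rewrite expr0 scale1r.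
by rewrite iterS exprSr -scalerA -H.
Qed.

Lemma scale_b u w : u *: (ahat_b *: w) = ahat_b *: ((u + adiff u * ahat_b) *: w).
Proof. by rewrite scalerA mulb_comm -scalerA. Qed.

Section Action.
Variables (O : comPzRingType) (act : O -> M -> M) (iota : {rmorphism K -> O}).
Hypotheses (actP : is_action act) (actC : forall c u x, act c (u *: x) = u *: act c x).
Hypothesis actI : forall c x, act (iota c) x = c%:A *: x.

Lemma act1 x : act 1 x = x. Proof. by case: actP. Qed.
Lemma actA c d x : act (c * d) x = act c (act d x). Proof. by case: actP. Qed.
Lemma actDr c x y : act c (x + y) = act c x + act c y. Proof. by case: actP => _ _ H _; apply: H. Qed.
Lemma actDl c d x : act (c + d) x = act c x + act d x. Proof. by case: actP => _ _ _ H; apply: H. Qed.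
Lemma act0l x : act 0 x = 0.
Proof. by apply: (addrI (act 0 x)); rewrite -actDl !addr0. Qed.
Lemma act0r c : act c 0 = 0.
Proof. by apply: (addrI (act c 0)); rewrite -actDr !addr0. Qed.
Lemma act_sumr c I (r : seq I) (F : I -> M) : act c (\sum_(i <- r) F i) = \sum_(i <- r) act c (F i).
Proof. exact: (big_morph _ (actDr c) (act0r c)). Qed.
Lemma act_suml x I (r : seq I) (F : I -> O) : act (\sum_(i <- r) F i) x = \sum_(i <- r) act (F i) x.
Proof. exact: (big_morph (act^~ x) (fun c d => actDl c d x) (act0l x)). Qed.

Definition basis_mod_b k (e : 'I_k -> M) : Prop :=
  (forall x, exists (c : 'I_k -> O) w, x = \sum_(i < k) act (c i) (e i) + ahat_b *: w) /\
  (forall (c : 'I_k -> O) w, \sum_(i < k) act (c i) (e i) = ahat_b *: w -> forall i, c i = 0).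

Lemma sum_mod_b k (c : 'I_k -> O) (e : 'I_k -> M) (F : 'I_k -> M) :
  (forall i, exists w, e i = F i + ahat_b *: w) ->
  exists w, \sum_(i < k) act (c i) (e i) = \sum_(i < k) act (c i) (F i) + ahat_b *: w.
Proof.
move=> /(_ _)/cid H; exists (\sum_(i < k) act (c i) (projT1 (H i))).
rewrite scaler_sumr -big_split; apply: eq_bigr => i _ /=.
by case: (H i) => w /= ->; rewrite actDr actC.
Qed.

Lemma basis_mod_b_change k (e e' : 'I_k -> M) (C : 'M[K]_k) :
  basis_mod_b e -> C \in unitmx ->
  (forall i, exists w, e' i = \sum_(j < k) act (iota (C i j)) (e j) + ahat_b *: w) ->
  basis_mod_b e'.
Proof.
move=> [span free] Cu e'E.
have comb (c : 'I_k -> O) : exists w, \sum_(i < k) act (c i) (e' i) =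
    \sum_(j < k) act (\sum_(i < k) c i * iota (C i j)) (e j) + ahat_b *: w.
  have [w ->] := sum_mod_b c e'E; exists w; congr (_ + _).
  under eq_bigr do rewrite act_sumr.
  rewrite exchange_big; apply: eq_bigr => j _; rewrite act_suml.
  by apply: eq_bigr => i _; rewrite actA.
pose D := invmx C.
have DC i j : \sum_(l < k) iota (D i l) * iota (C l j) = (i == j)%:R.
  have := congr1 (fun A : 'M[K]_k => iota (A i j)) (mulVmx Cu); rewrite /= !mxE rmorph_nat => <-.
  by rewrite rmorph_sum; apply: eq_bigr => l _; rewrite rmorphM.
have CD i j : \sum_(l < k) iota (C i l) * iota (D l j) = (i == j)%:R.
  have := congr1 (fun A : 'M[K]_k => iota (A i j)) (mulmxV Cu); rewrite /= !mxE rmorph_nat => <-.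
  by rewrite rmorph_sum; apply: eq_bigr => l _; rewrite rmorphM.
split=> [x|c w H i].
  have [c [w ->]] := span x; exists (fun i => \sum_(j < k) c j * iota (D j i)).
  have [w' ->] := comb (fun i => \sum_(j < k) c j * iota (D j i)).
  exists (w - w'); rewrite scalerBr -addrA [ahat_b *: w' + _]addrC subrK; congr (_ + _).
  apply: eq_bigr => l _; congr (act _ _).
  under eq_bigr do rewrite mulr_suml.
  rewrite exchange_big (bigD1 l)//= [X in _ + X]big1 ?addr0; last first.
    move=> j /negbTE jl; under eq_bigr do rewrite -mulrA.
    by rewrite -mulr_sumr DC jl mulr0.
  by under eq_bigr do rewrite -mulrA; rewrite -mulr_sumr DC eqxx mulr1.
have [w' E] := comb c; have {H} /free Z : \sum_(j < k) act (\sum_(i < k) c i * iota (C i j)) (e j) = ahat_b *: (w - w').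
  by rewrite scalerBr -H E addrK.
transitivity (\sum_(l < k) \sum_(j < k) c l * iota (C l j) * iota (D j i)).
  rewrite (bigD1 i)//= [X in _ + X]big1 ?addr0; last first.
    move=> l /negbTE li; under eq_bigr do rewrite -mulrA.
    by rewrite -mulr_sumr CD li mulr0.
  by under eq_bigr do rewrite -mulrA; rewrite -mulr_sumr CD eqxx mulr1.
by rewrite exchange_big big1// => j _; rewrite -mulr_suml Z mul0r.
Qed.

(** Beyond the first k terms S is a multiple of a^k, which sends phi into bM, and bM is stable under
    [Ahat] by [scale_b]. *)
Lemma aser_mod_b k (S : pseries K) (phi : M) : (exists w, ahat_a ^+ k *: phi = ahat_b *: w) ->
  exists w, aser S *: phi = \sum_(j < k) act (iota (S j)) (ahat_a ^+ j *: phi) + ahat_b *: w.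
Proof.
move=> [w0 w0E].
have E : aser S = \sum_(j < k) S j *: ahat_a ^+ j + aser (fun n => S (n + k)%N) * ahat_a ^+ k.
  elim: {w0E} k => [|k IH].
    rewrite big_ord0 add0r expr0 mulr1; congr aser; apply/funext => n; by rewrite addn0.
  rewrite big_ord_recr /= [LHS]IH -addrA; congr (_ + _).
  rewrite [in LHS]aser_split mulrDl add0n mulr_algl; congr (_ + _).
  have -> : psshift (fun n => S (n + k)%N) = fun n => S (n + k.+1)%N.
    by apply/funext => n; rewrite /psshift addSnnS.
  by rewrite exprS mulrA /ahat_a -!aserM [psvar K * _]mulrC.
exists ((aser (fun n => S (n + k)%N) + adiff (aser (fun n => S (n + k)%N)) * ahat_b) *: w0).
rewrite E scalerDl -scalerA w0E scale_b scaler_suml; congr (_ + _).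
by apply: eq_bigr => j _; rewrite actI scalerA mulr_algl.
Qed.

(** theta^i is theta'(0)^i a^i plus higher powers, and powers from a^k on vanish modulo b; so the
    transition matrix is triangular with nonzero diagonal entries. *)
Lemma basis_mod_b_theta k (phi : M) (theta : pseries K) : theta 0%N = 0 -> theta 1%N != 0 ->
  basis_mod_b (fun i : 'I_k => ahat_a ^+ i *: phi) ->
  (exists w, ahat_a ^+ k *: phi = ahat_b *: w) ->
  basis_mod_b (fun i : 'I_k => aser theta ^+ i *: phi).
Proof.
move=> t0 t1 bas nil.
have van i j : (j <= i)%N -> (theta ^+ i : pseries K) j = if j == i then theta 1%N ^+ i else 0.
  have tE : theta = psvar K * psshift theta.
    by apply/funext => n; rewrite psmulXE; case: n.
  have S0 l : (psshift theta ^+ l : pseries K) 0%N = theta 1%N ^+ l.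
    elim: l => [|l IH]; first by rewrite !expr0.
    rewrite !exprS -IH [LHS]/(psmul (psshift theta) (psshift theta ^+ l) 0) /psmul.
    by rewrite big_ord_recl big_ord0 addr0.
  move=> ji; rewrite {1}tE exprMn psmulXnE; case: ifPn => [ij|].
    have -> : j = i by apply/eqP; rewrite eqn_leq ji.
    by rewrite eqxx subnn S0.
  by rewrite -ltnNge => /ltn_eqF->.
pose C := \matrix_(i < k, j < k) (theta ^+ i : pseries K) j.
apply: (basis_mod_b_change (C := C) bas).
  rewrite -unitmx_tr unitmxE det_trig.
    rewrite unitfE; apply/prodf_neq0 => i _; rewrite !mxE van// eqxx.
    by rewrite expf_neq0.
  by apply/is_trig_mxP => i j ij; rewrite !mxE van 1?ltnW// ltn_eqF.
move=> i; rewrite -aserX; have [w ->] := aser_mod_b (theta ^+ i) nil.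
by exists w; congr (_ + _); apply: eq_bigr => j _; rewrite mxE.
Qed.

(** * Actions of O[[b]] determined by their recursion *)

Variable A : pseries O -> M -> M.
Hypothesis rec : forall S x, A S x = act (S 0%N) x + ahat_b *: A (psshift S) x.

Definition b_comb_of k (e : 'I_k -> M) (S : 'I_k -> pseries O) : M := \sum_(i < k) A (S i) (e i).

Lemma b_comb_rec k (e : 'I_k -> M) S : b_comb_of e S =
  \sum_(i < k) act (S i 0%N) (e i) + ahat_b *: b_comb_of e (fun i => psshift (S i)).
Proof.
by rewrite scaler_sumr -big_split; apply: eq_bigr => i _; rewrite rec.
Qed.

Section Sep.
Hypothesis sep : b_separated.

Lemma ext_act_addr S x y : A S (x + y) = A S x + A S y.
Proof.
apply/eqP; rewrite -subr_eq0; apply/eqP; move: S.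
apply: (b_coinduction (s := @psshift O) sep) => S.
by rewrite ![A S _]rec actDr [X in _ - X]addrACA opprD addrACA subrr add0r scalerBr scalerDr.
Qed.

Lemma ext_act_addl S T x : A (S + T) x = A S x + A T x.
Proof.
apply/eqP; rewrite -subr_eq0; apply/eqP.
apply: (b_coinduction (D := fun ST => A (ST.1 + ST.2) x - (A ST.1 x + A ST.2 x))
  (s := fun ST => (psshift ST.1, psshift ST.2)) sep _ (S, T)).
move=> [S' T'] /=; rewrite [A (S' + T') _]rec [A S' _]rec [A T' _]rec.
have -> : (S' + T') 0%N = S' 0%N + T' 0%N by [].
have -> : psshift (S' + T') = psshift S' + psshift T' by [].
by rewrite actDl [X in _ - X]addrACA opprD addrACA subrr add0r scalerBr scalerDr.
Qed.

Lemma ext_act0 x : A 0 x = 0.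
Proof. by apply: (addrI (A 0 x)); rewrite -ext_act_addl !addr0. Qed.

Lemma ext_act_const c x : A (psconst c) x = act c x.
Proof.
by rewrite rec (_ : psshift (psconst c) = 0) ?ext_act0 ?scaler0 ?addr0.
Qed.

Definition psmX (S : pseries O) : pseries O := fun n => if n is n'.+1 then S n' else 0.

Lemma ext_act_psmX S x : A (psmX S) x = ahat_b *: A S x.
Proof. by rewrite rec act0l add0r. Qed.

Lemma ext_act_constM c S x : A (psconst c * S) x = act c (A S x).
Proof.
have cE T n : (psconst c * T : pseries O) n = c * T n.
  rewrite [LHS]/(psmul (psconst c) T n) /psmul big_ord_recl subn0 big1 ?addr0// => i _.
  by rewrite /psconst mul0r.
apply/eqP; rewrite -subr_eq0; apply/eqP; move: S.
apply: (b_coinduction (s := @psshift O) sep) => S.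
rewrite [A (_ * S) _]rec [A S _]rec cE actA actDr actC scalerBr.
have -> : psshift (psconst c * S) = psconst c * psshift S.
  by apply/funext => n; rewrite [RHS]cE [LHS]cE.
by rewrite opprD addrACA subrr add0r.
Qed.

Lemma ext_act_mul S T x : A (S * T) x = A S (A T x).
Proof.
apply/eqP; rewrite -subr_eq0; apply/eqP; move: S.
apply: (b_coinduction (s := @psshift O) sep) => S.
have -> : S * T = psconst (S 0%N) * T + psmX (psshift S * T).
  have {1}-> : S = psconst (S 0%N) + psmX (psshift S).
    apply/funext => n; transitivity (psconst (S 0%N) n + psmX (psshift S) n); last by [].
    by case: n => [|n]; rewrite /psconst /psshift ?addr0 ?add0r.
  rewrite mulrDl; congr (_ + _); apply/funext => n.
  rewrite [LHS]/(psmul (psmX (psshift S)) T n) /psmul big_ord_recl mul0r add0r.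
  by case: n => [|n]; rewrite ?big_ord0.
rewrite ext_act_addl ext_act_constM ext_act_psmX [in RHS]scalerBr [A S _]rec.
by rewrite opprD addrACA subrr add0r.
Qed.

Lemma ext_act_action : is_action A.
Proof.
split; [|exact: ext_act_mul|exact: ext_act_addr|by move=> x S T; exact: ext_act_addl].
by move=> x; rewrite -[1]/(psconst 1) ext_act_const act1.
Qed.

Lemma ext_act_bser (S : pseries K) x : A (fun n => iota (S n)) x = bser S *: x.
Proof.
apply/eqP; rewrite -subr_eq0; apply/eqP; move: S.
apply: (b_coinduction (s := @psshift K) sep) => S.
rewrite rec bser_split scalerDl actI -scalerA scalerBr opprD addrACA subrr add0r.
by [].
Qed.

(** Freeness modulo b kills the constant terms of a vanishing combination; dividing by b leaves the
    shifted combination, and the argument repeats. *)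
Lemma b_comb_inj k (e : 'I_k -> M) : b_injective -> basis_mod_b e -> injective (b_comb_of e).
Proof.
move=> bI [span free].
suff H S : b_comb_of e S = 0 -> forall i n, S i n = 0.
  move=> S S' E; apply/funext => i; apply/funext => n; apply/eqP; rewrite -subr_eq0; apply/eqP.
  apply: (H (fun i => S i - S' i)).
  have -> : b_comb_of e (fun i => S i - S' i) = b_comb_of e S - b_comb_of e S'.
    rewrite -sumrB; apply: eq_bigr => j _.
    by apply: (addIr (A (S' j) (e j))); rewrite subrK -ext_act_addl subrK.
  by rewrite E subrr.
have key S' : b_comb_of e S' = 0 ->
    (forall i, S' i 0%N = 0) /\ b_comb_of e (fun i => psshift (S' i)) = 0.
  rewrite b_comb_rec => H.
  have Z : forall i, S' i 0%N = 0.
    apply: (free (fun i => S' i 0%N) (- b_comb_of e (fun i => psshift (S' i)))).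
    by apply/eqP; rewrite scalerN -addr_eq0 H.
  split=> //; apply: bI; rewrite /= scaler0 -[RHS]H [X in _ = X + _]big1 ?add0r// => i _.
  by rewrite Z act0l.
move=> S0 i n; elim: n S S0 i => [|n IH] S /key[Z0 Z1] i; first exact: Z0.
exact: (IH (fun i => psshift (S i)) Z1 i).
Qed.

(** Reduction modulo b is iterated on the successive quotients [w]. Convergence of the resulting
    series is contained in the existence of [A], and separation identifies its sum with x. *)
Lemma b_comb_surj k (e : 'I_k -> M) : basis_mod_b e -> forall x, exists S, x = b_comb_of e S.
Proof.
move=> [span free] x.
have /(_ _)/cid c := span; pose w y := projT1 (cid (projT2 (c y))).
have E y : y = \sum_(i < k) act (projT1 (c y) i) (e i) + ahat_b *: w y.
  by rewrite /w; case: (cid _).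
exists (fun i n => projT1 (c (iter n w x)) i).
apply/eqP; rewrite -subr_eq0; apply/eqP.
apply: (b_coinduction (D := fun y => y - b_comb_of e (fun i n => projT1 (c (iter n w y)) i))
  (s := w) sep _ x) => y.
rewrite {1}[y]E b_comb_rec scalerBr opprD addrACA subrr add0r; congr (_ *: _ - _ *: _).
congr b_comb_of; apply/funext => i; apply/funext => n; rewrite /psshift.
by rewrite iterSr.
Qed.
End Sep.

Section FromBasis.
Variables (k : nat) (e : 'I_k -> M).
Hypothesis AD : forall S T x, A (S + T) x = A S x + A T x.
Hypotheses (inj : injective (b_comb_of e)) (surj : forall x, exists S, x = b_comb_of e S).

Lemma comb_iter_psmX n S : ahat_b ^+ n *: b_comb_of e S = b_comb_of e (fun i => iter n psmX (S i)).
Proof.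
rewrite scaler_sumr; apply: eq_bigr => i _; elim: n => [|n IH]; first by rewrite expr0 scale1r.
by rewrite iterS exprS -scalerA IH [RHS]rec [act _ _]act0l add0r.
Qed.

Lemma comb0 : b_comb_of e (fun=> 0) = 0.
Proof. by rewrite /b_comb_of big1// => i _; apply: (addrI (A 0 (e i))); rewrite -AD !addr0. Qed.

Lemma basis_b_separated : b_separated.
Proof.
move=> x H; have [S SE] := surj x; rewrite SE -comb0; congr b_comb_of.
apply/funext => i; apply/funext => n; have [w] := H n.+1.
have [T ->] := surj w; rewrite SE comb_iter_psmX => /inj /(congr1 (fun S => S i n)) /= ->.
suff Z l m (T' : pseries O) : (m < l)%N -> iter l psmX T' m = 0 by exact: (Z n.+1 n (T i) (ltnSn n)).
by elim: l m => // l IH [|m] //=; rewrite ltnS => /IH.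
Qed.

Lemma basis_b_injective : b_injective.
Proof.
move=> x y; have [S ->] := surj x; have [T ->] := surj y => /=.
rewrite -[ahat_b]expr1 !comb_iter_psmX => /inj E; congr b_comb_of.
apply/funext => i; apply/funext => n.
exact: (congr1 (fun S : 'I_k -> pseries O => S i n.+1) E).
Qed.

Lemma basis_b_complete : b_complete.
Proof.
move=> t; have /(_ _)/cid H := surj (t _); pose S n := projT1 (H n).
have tE n : t n = b_comb_of e (S n) by rewrite /S; case: (H n).
(* Coordinates of the tail sum over l of b^l t_(n+l): the coefficient of b^m receives the
   coefficient m-l of t_(n+l). *)
pose R n : 'I_k -> pseries O := fun i m => \sum_(l < m.+1) S (n + l)%N i (m - l)%N.
exists (fun n => b_comb_of e (R n)) => n.
rewrite tE -[ahat_b]expr1 comb_iter_psmX -big_split; apply: eq_bigr => i _ /=.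
rewrite -AD; congr A; apply/funext => m.
rewrite [RHS]/(S n i m + psmX (R n.+1 i) m) /R big_ord_recl addn0 subn0; congr (_ + _).
case: m => [|m]; first by rewrite big_ord0.
by apply: eq_bigr => l _; rewrite addSnnS.
Qed.

Lemma basis_mod_b_of_basis : basis_mod_b e.
Proof.
split=> [x|c w].
  have [S ->] := surj x; exists (fun i => S i 0%N), (b_comb_of e (fun i => psshift (S i))).
  exact: b_comb_rec.
have [S ->] := surj w => E i.
have Ec x d : A (psconst d) x = act d x.
  rewrite rec (_ : psshift (psconst d) = 0) // (_ : A 0 x = 0) ?scaler0 ?addr0//.
  by apply: (addrI (A 0 x)); rewrite -AD !addr0.
have /inj /(congr1 (fun S : 'I_k -> pseries O => S i 0%N)) : b_comb_of e (fun i => psconst (c i)) = b_comb_of e (fun i => psmX (S i)).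
  by have := comb_iter_psmX 1 S; rewrite expr1 => <-; rewrite -E; apply: eq_bigr => j _; rewrite Ec.
by [].
Qed.
End FromBasis.

(* t is the b-adic sum of the b^n S_n x; tau lists the tails, divided by b^n. *)
Definition b_limit (S : pseries O) x t : Prop :=
  exists tau : nat -> M, tau 0%N = t /\ forall n, tau n = act (S n) x + ahat_b *: tau n.+1.

Lemma b_limit_uniq S x t t' : b_separated -> b_limit S x t -> b_limit S x t' -> t = t'.
Proof.
move=> sep [u [<- uE]] [v [<- vE]]; apply/eqP; rewrite -subr_eq0; apply/eqP.
apply: (b_coinduction (D := fun n => u n - v n) (s := succn) sep _ 0%N) => n.
by rewrite uE vE opprD addrACA subrr add0r scalerBr.
Qed.

Lemma b_limit_shift S x t : b_limit S x t -> exists t', b_limit (psshift S) x t' /\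
  t = act (S 0%N) x + ahat_b *: t'.
Proof.
move=> [u [<- uE]]; exists (u 1%N); split; last exact: uE.
by exists (fun n => u n.+1); split=> // n; rewrite uE.
Qed.

End Action.
End BAdic.

(** * Ranks and cyclic generators modulo b *)

Section Cyclic.
Variables (K : fieldType) (M : lmodType (Ahat K)).

Definition scalar_act (c : K) (x : M) : M := c%:A *: x.

Lemma scalar_actP : is_action scalar_act.
Proof.
split; rewrite /scalar_act.
- by move=> x; rewrite !scale1r.
- by move=> c d x; rewrite scalerA mulr_algl scalerA.
- by move=> c x y; rewrite scalerDr.
- by move=> x c d; rewrite !scalerDl.
Qed.

Lemma scalar_actC c u (x : M) : scalar_act c (u *: x) = u *: scalar_act c x.
Proof. by rewrite /scalar_act !scalerA mulr_algl mulr_algr. Qed.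

Lemma scalar_actI c (x : M) : scalar_act ((idfun : {rmorphism K -> K}) c) x = c%:A *: x.
Proof. by []. Qed.

(** Going from e to e' and back is the identity modulo b, where e is free. This yields both the
    comparison of ranks and the invertibility of transition matrices. *)
Lemma basis_mod_b_mul1 k k' (e : 'I_k -> M) (e' : 'I_k' -> M) (B : 'M_(k, k')) (A : 'M_(k', k)) :
  basis_mod_b scalar_act e ->
  (forall i, exists w, e i = \sum_(l < k') scalar_act (B i l) (e' l) + ahat_b *: w) ->
  (forall l, exists w, e' l = \sum_(j < k) scalar_act (A l j) (e j) + ahat_b *: w) ->
  B *m A = 1%:M.
Proof.
move=> [_ free] BE AE; apply/matrixP => i j.
have [w wE] := BE i.
have [w' w'E] := sum_mod_b scalar_actP scalar_actC (B i) AE.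
have := free (fun j => (B *m A) i j - (1%:M : 'M[K]_k) i j) (- (w + w')).
move=> /(_ _ j) H; apply/eqP; rewrite -subr_eq0; apply/eqP/H.
have -> : \sum_(j < k) scalar_act ((B *m A) i j - (1%:M : 'M[K]_k) i j) (e j) =
    \sum_(l < k') scalar_act (B i l) (\sum_(j < k) scalar_act (A l j) (e j)) - e i.
  transitivity (\sum_(j < k) scalar_act ((B *m A) i j) (e j)
      - \sum_(j < k) scalar_act ((1%:M : 'M[K]_k) i j) (e j)).
    by rewrite -sumrB; apply: eq_bigr => h _; rewrite /scalar_act !scalerBl.
  congr (_ - _).
    under [RHS]eq_bigr do rewrite (act_sumr scalar_actP).
    rewrite exchange_big; apply: eq_bigr => h _; rewrite mxE (act_suml scalar_actP).
    by apply: eq_bigr => l _; rewrite (actA scalar_actP).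
  rewrite (bigD1 i)//= mxE eqxx (act1 scalar_actP) big1 ?addr0// => h /negbTE hi.
  by rewrite mxE eq_sym hi (act0l scalar_actP).
rewrite wE w'E scalerN scalerDr -[X in _ - X]addrA opprD addrA subrr add0r.
by rewrite [ahat_b *: w' + _]addrC.
Qed.

Lemma span_mod_b_matrix k k' (e : 'I_k -> M) (e' : 'I_k' -> M) :
  (forall x, exists (c : 'I_k' -> K) w, x = \sum_(i < k') scalar_act (c i) (e' i) + ahat_b *: w) ->
  exists B : 'M_(k, k'),
    forall i, exists w, e i = \sum_(l < k') scalar_act (B i l) (e' l) + ahat_b *: w.
Proof.
move=> span; have /(_ _)/cid B i := span (e i).
exists (\matrix_(i < k, j < k') projT1 (B i) j) => i; have [w E] := projT2 (B i).
by exists w; rewrite {1}E; congr (_ + _); apply: eq_bigr => l _; rewrite mxE.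
Qed.

Lemma basis_mod_b_rank k k' (e : 'I_k -> M) (e' : 'I_k' -> M) :
  basis_mod_b scalar_act e -> basis_mod_b scalar_act e' -> (k <= k')%N.
Proof.
move=> bas bas'; have [B BE] := span_mod_b_matrix e bas'.1.
have [A AE] := span_mod_b_matrix e' bas.1.
exact: mulmx1_min (basis_mod_b_mul1 bas BE AE).
Qed.

(** M / bM is generated by g over K[a] with a nilpotent, hence is K[a]/(a^r) for the least r with
    a^r g in bM; comparison of ranks gives r = k. *)
Lemma cyclic_basis k (e : 'I_k -> M) (g : M) : b_injective M -> basis_mod_b scalar_act e ->
  (exists n, forall x : M, exists w, ahat_a ^+ n *: x = ahat_b *: w) ->
  (forall x, exists u, x = u *: g) ->
  basis_mod_b scalar_act (fun i : 'I_k => ahat_a ^+ i *: g) /\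
  exists w, ahat_a ^+ k *: g = ahat_b *: w.
Proof.
move=> bI bas [n nil] gen.
have ex : exists n, `[< exists w, ahat_a ^+ n *: g = ahat_b *: w >].
  by exists n; apply/asboolP/nil.
pose r := ex_minn ex.
have [rE rmin] : (exists w, ahat_a ^+ r *: g = ahat_b *: w) /\
    forall l, (exists w, ahat_a ^+ l *: g = ahat_b *: w) -> (r <= l)%N.
  rewrite /r; case: ex_minnP => r' /asboolP H1 H2; split=> // l Hl.
  by apply: H2; apply/asboolP.
have basr : basis_mod_b scalar_act (fun i : 'I_r => ahat_a ^+ i *: g).
  split=> [x|c w E i].
    have [u ->] := gen x; have [v vE] := ahat_split u.
    have [w wE] := aser_mod_b scalar_actI (fun s => u s 0%N) rE.
    exists (fun i : 'I_r => u i 0%N), (w + (v + adiff v * ahat_b) *: g).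
    by rewrite {1}vE scalerDl -scalerA wE scale_b scalerDr addrA.
  pose inb (x : M) := exists w, x = ahat_b *: w.
  have inbZ u x : inb x -> inb (u *: x) by move=> [w' ->]; rewrite scale_b; eexists.
  have inbD x y : inb x -> inb y -> inb (x + y).
    by move=> [x' ->] [y' ->]; exists (x' + y'); rewrite scalerDr.
  (* Once the coefficients below i vanish, multiplication by a^(r-1-i) pushes the terms above i into
     bM and leaves c_i a^(r-1) g; minimality of r then forces c_i = 0. *)
  have [l] := ubnP (i : nat); elim: l i => // l IH i il.
  apply/eqP/negP => /negP ci; have r0 : (0 < r)%N by apply: leq_trans (ltn_ord i).
  suff : inb (ahat_a ^+ r.-1 *: g) by move/rmin; rewrite -ltnS prednK// ltnn.
  suff : inb ((c i)%:A *: (ahat_a ^+ r.-1 *: g)).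
    have cc : (c i)^-1%:A * (c i)%:A = 1 :> Ahat K.
      by rewrite mulr_algl scalerA mulVf// scale1r.
    by move/(inbZ (c i)^-1%:A); rewrite scalerA cc scale1r.
  have : inb (ahat_a ^+ (r.-1 - i) *: (\sum_(i < r) scalar_act (c i) (ahat_a ^+ i *: g))).
    by apply: (inbZ); exists w.
  have ir : (r.-1 - i + i = r.-1)%N by rewrite subnK// -ltnS prednK.
  rewrite scaler_sumr (bigD1 i)//= -scalar_actC scalerA -exprD ir => /inbD H.
  rewrite -[X in inb X](addrK (\sum_(j < r | j != i) ahat_a ^+ (r.-1 - i) *: scalar_act (c j) (ahat_a ^+ j *: g))).
  apply: H; rewrite -scaleN1r; apply: (inbZ).
  apply: big_ind => [||j ji]; [by exists 0; rewrite scaler0|exact: inbD|].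
  have [jli|] := ltnP j i.
    by rewrite (IH j)// /scalar_act ?scale0r ?scale0r ?scaler0; [exists 0; rewrite scaler0|lia].
  move=> ij'; have {ij'} ij : (i < j)%N by rewrite ltn_neqAle ij' andbT eq_sym.
  rewrite -scalar_actC /scalar_act; apply: (inbZ); rewrite scalerA -exprD.
  have -> : (r.-1 - i + j = (r.-1 - i + j - r) + r)%N by lia.
  by rewrite exprD -scalerA; apply: (inbZ).
have kr : k = r.
  apply/eqP; rewrite eqn_leq; apply/andP; split.
    exact: basis_mod_b_rank bas basr.
  exact: basis_mod_b_rank basr bas.
by rewrite kr.
Qed.
End Cyclic.

(** * Change of variable for frescos *)

Section Push.
Variables (K : fieldType) (theta : pseries K) (Theta : {lrmorphism Ahat K -> Ahat K}).
Hypothesis sT : substitution theta Theta.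
Variable M : lmodType (Ahat K).
Local Notation M' := (pushm Theta M).

Lemma pushE u (x : M) : u *: (x : M') = Theta u *: x :> M. Proof. by []. Qed.

Lemma push_bX n (w : M) : exists w' : M, ahat_b ^+ n *: (w : M') = ahat_b ^+ n *: w' :> M.
Proof.
have [v vE] := substitution_bX sT n.
by exists (v *: w); rewrite pushE rmorphXn /= vE scalerA.
Qed.

Lemma push_bX' n (w : M) : exists w' : M, ahat_b ^+ n *: w = ahat_b ^+ n *: (w' : M') :> M.
Proof.
have [v vE] := substitution_bX' sT n.
by exists (v *: w); rewrite pushE rmorphXn /= scalerA -vE.
Qed.

Lemma push_b_injective : b_injective M -> b_injective M'.
Proof.
have [_ _ _ Tb] := sT; have [T [T1 _ _]] := substitution_deriv_inv sT => bI.
suff H (x : M) : Theta ahat_b *: x = 0 -> x = 0.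
  move=> x y; rewrite /= => E; apply/eqP; rewrite -subr_eq0; apply/eqP; apply: H.
  by rewrite scalerBr; apply/eqP; rewrite subr_eq0; apply/eqP.
rewrite Tb -scalerA -[0 in X in X -> _](scaler0 M ahat_b) => /bI E.
by rewrite -[x]scale1r -T1 -scalerA E scaler0.
Qed.

Lemma push_b_separated : b_separated M -> b_separated M'.
Proof.
move=> sep x H; apply: sep => n; have [w ->] := H n; exact: push_bX.
Qed.

(** With b' = Theta(b) and b'^n = b^n v_n, the sum of the b'^n t_n is that of the b^n v_n t_n, with
    tails b^n s_n. Writing b^n = b'^n v'_n gives the tails v'_n s_n for b', checked after
    multiplication by the injective b'^n. *)
Lemma push_b_complete : b_injective M -> b_complete M -> b_complete M'.
Proof.
move=> bI cpl t.
have /(_ _)/cid v n := substitution_bX sT n; have /(_ _)/cid v' n := substitution_bX' sT n.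
have [s sE] := cpl (fun n => projT1 (v n) *: (t n : M)).
exists (fun n => projT1 (v' n) *: s n) => n.
have cancel_b : injective (fun x : M' => ahat_b ^+ n *: x).
  elim: n => [|n IH] x y; first by rewrite !expr0 !scale1r.
  by rewrite !exprSr -!scalerA => /IH; exact: push_b_injective.
apply: cancel_b => /=; rewrite scalerDr scalerA -exprSr !pushE !rmorphXn /= !scalerA.
have vE k : Theta ahat_b ^+ k * projT1 (v' k) = ahat_b ^+ k by case: (v' k).
rewrite !vE sE scalerDr !scalerA -exprSr.
by have -> : ahat_b ^+ n * projT1 (v n) = Theta ahat_b ^+ n by case: (v n).
Qed.

Lemma push_basis_mod_b (O : comPzRingType) (act : O -> M -> M) k (e : 'I_k -> M) :
  basis_mod_b act e -> @basis_mod_b K M' O act k e.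
Proof.
move=> [span free]; split=> [x|c w E].
  have [c [w ->]] := span x; have [w' w'E] := push_bX' 1 w.
  by exists c, w'; rewrite -[ahat_b]expr1 w'E.
by have [w' w'E] := push_bX 1 w; apply: (free c w'); rewrite -[ahat_b]expr1 -w'E.
Qed.

Lemma push_scalar c (x : M) : scalar_act (M := M') c x = scalar_act c x.
Proof. by rewrite /scalar_act pushE linearZ rmorph1. Qed.

End Push.

Section FrescoPush.
Variables (K : numClosedFieldType) (m : nat) (lam : 'I_m -> rat) (N : nat) (V : vectType K).
Local Notation XiV := (Xi lam N V).
Hypothesis lam0 : forall i, 0 < lam i.

Definition bser_act (M : lmodType (Ahat K)) (S : pseries K) (x : M) : M := bser S *: x.

Lemma bser_act_rec (M : lmodType (Ahat K)) S (x : M) :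
  bser_act S x = scalar_act (S 0%N) x + ahat_b *: bser_act (psshift S) x.
Proof. by rewrite /bser_act bser_split scalerDl -scalerA. Qed.

Lemma bser_actD (M : lmodType (Ahat K)) S T (x : M) : bser_act (S + T) x = bser_act S x + bser_act T x.
Proof. by rewrite /bser_act bserD scalerDl. Qed.

Lemma ab_module_basis k (M : lmodType (Ahat K)) : ab_module k [set: tildem M] ->
  exists e : 'I_k -> M, injective (b_comb_of (@bser_act M) e) /\
    forall x, exists S, x = b_comb_of (@bser_act M) e S.
Proof.
move=> [_ [e [inj rg]]].
have bE S : b_comb e (finfun S) = b_comb_of (@bser_act M) e S.
  by apply: eq_bigr => i _; rewrite ffunE.
exists e; split=> [S S' E|x].
  have /ffunP H : finfun S = finfun S' by apply: inj; rewrite !bE.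
  by apply/funext => i; have := H i; rewrite !ffunE.
have : range (b_comb e) x by rewrite rg.
move=> [S _ <-]; exists S; rewrite -bE; have -> : finfun S = S; last by [].
by apply/ffunP => i; rewrite ffunE.
Qed.

Lemma basis_ab_module k (M : lmodType (Ahat K)) (e : 'I_k -> M) :
  injective (b_comb_of (@bser_act M) e) ->
  (forall x, exists S, x = b_comb_of (@bser_act M) e S) -> ab_module k [set: tildem M].
Proof.
move=> inj surj; split; first by [].
exists e; split.
  move=> S S' E; apply/ffunP => i; exact: (congr1 (fun S => S i) (inj (S : 'I_k -> pseries K) S' E)).
rewrite eqEsubset; split=> // x _; have [S ->] := surj x; exists (finfun S) => //.
by apply: eq_bigr => i _; rewrite ffunE.
Qed.

Section WithModule.
Variables (k : nat) (M : lmodType (Ahat K)) (f : M -> XiV).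
Hypotheses (fL : linear f) (fI : injective f).
Hypothesis ab : ab_module k [set: tildem M].

Lemma ab_module_bI : b_injective M.
Proof.
have [e [inj surj]] := ab_module_basis ab.
exact: (basis_b_injective (@scalar_actP K M) (@bser_act_rec M) inj surj).
Qed.
Lemma ab_module_sep : b_separated M.
Proof.
have [e [inj surj]] := ab_module_basis ab.
exact: (basis_b_separated (@scalar_actP K M) (@bser_act_rec M) (@bser_actD M) inj surj).
Qed.
Lemma ab_module_mod_b : exists e : 'I_k -> M, basis_mod_b (@scalar_act K M) e.
Proof.
have [e [inj surj]] := ab_module_basis ab; exists e.
exact: (basis_mod_b_of_basis (@scalar_actP K M) (@bser_act_rec M) (@bser_actD M) inj surj).
Qed.

(* Artin-Rees for the image of M in Xi, where a is topologically nilpotent. *)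
Lemma a_nilpotent_mod_b : exists n, forall x : M, exists w, ahat_a ^+ n *: x = ahat_b *: w.
Proof.
have f0 := linear_zeroE fL.
have [||d [e [n [_ _ _ AR]]]] := @Xi_submodule K m lam N V (range f).
- by exists 0.
- by move=> S _ _ [x _ <-] [y _ <-]; exists (bser S *: x + y); rewrite ?fL.
exists n => x; have [||_ [w _ <-] E] := AR (f (ahat_a ^+ n *: x)).
- by exists (ahat_a ^+ n *: x).
- rewrite (linear_scaleE fL) -[n in xvan n _]addn0; apply: xvan_scale => //.
  by rewrite -[n in vanishes_below n]muln1; apply: vanishesX; exact: vanishes_a.
by exists w; apply: fI; rewrite E (linear_scaleE fL).
Qed.

Lemma fresco_cyclic (g : M) : (forall x, exists u, x = u *: g) ->
  basis_mod_b (@scalar_act K M) (fun i : 'I_k => ahat_a ^+ i *: g) /\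
  exists w, ahat_a ^+ k *: g = ahat_b *: w.
Proof.
have [e bas] := ab_module_mod_b.
exact: cyclic_basis ab_module_bI bas a_nilpotent_mod_b.
Qed.
End WithModule.

Lemma fresco_push k (M : lmodType (Ahat K)) (f : M -> XiV) (theta : pseries K)
    (Theta : {lrmorphism Ahat K -> Ahat K}) :
  linear f -> injective f -> substitution theta Theta -> bijective Theta ->
  fresco k (tildem M) -> fresco k (tildem (pushm Theta M)).
Proof.
move=> fL fI sT bT [ab _ [g gen]].
have [bas nil] : basis_mod_b (@scalar_act K M) (fun i : 'I_k => ahat_a ^+ i *: (g : M)) /\
    exists w, ahat_a ^+ k *: (g : M) = ahat_b *: w.
  by apply: (fresco_cyclic fL fI ab) => x; have [u uE] := gen x; exists (atval u).
have [t0 t1 Ta Tb] := sT.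
have bas' := basis_mod_b_theta (@scalar_actP K M) (@scalar_actC K M) (@scalar_actI K M) t0 t1 bas nil.
have {}bas' : basis_mod_b (@scalar_act K (pushm Theta M))
    (fun i : 'I_k => ahat_a ^+ i *: (g : pushm Theta M)).
  have -> : @scalar_act K (pushm Theta M) = @scalar_act K M.
    by apply/funext => c; apply/funext => x; rewrite push_scalar.
  have -> : (fun i : 'I_k => ahat_a ^+ i *: (g : pushm Theta M)) = (fun i : 'I_k => aser theta ^+ i *: (g : M)).
    by apply/funext => i; rewrite pushE rmorphXn /= Ta.
  exact: (push_basis_mod_b sT).
have bI' := push_b_injective sT (ab_module_bI ab).
have sep' := push_b_separated sT (ab_module_sep ab).
have inj' := b_comb_inj (@scalar_actP K (pushm Theta M)) (@bser_act_rec (pushm Theta M)) sep' bI' bas'.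
have surj' := b_comb_surj (@bser_act_rec (pushm Theta M)) sep' bas'.
split.
- exact: basis_ab_module inj' surj'.
(* Psi is taken for the inverse Phi of Theta, so that Psi after f is linear for the action through
   Theta. *)
- have [Phi [eta [TP PT sP]]] := substitution_inv sT bT.
  apply: (@geometric_embedding K m lam N V (pushm Theta M) (fun x => xi_transport sP (f x))) => //.
    move=> u x y; rewrite pushE fL xi_transportD xi_transportP TP//.
  by move=> x y /xi_transport_inj /fI.
- exists g => x; have [S SE] := surj' x.
  (* Only finitely many powers of a occur next to series in b, so the multiplier lies in
     [Atilde]. *)
  exists (\sum_(i < k) at_bser (S i) * at_a ^+ i); rewrite [LHS]SE scaler_suml.
  apply: eq_bigr => i _; rewrite -scalerA; congr (bser _ *: _).
  have aE : atval (at_a ^+ i) = ahat_a ^+ i :> Ahat K by exact: (rmorphXn val).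
  by rewrite -aE.
Qed.
End FrescoPush.

(** * The sheaf theta_*(E) *)

Section PushLinear.
Variables (K : fieldType) (Theta : {lrmorphism Ahat K -> Ahat K}).
Variables (M L : lmodType (Ahat K)) (f : {linear M -> L}).
Definition push_fun (x : pushm Theta M) : pushm Theta L := f x.
Lemma push_fun_linear : linear push_fun.
Proof. by move=> u x y; rewrite /push_fun; exact: (linearP f (Theta u) x y). Qed.
HB.instance Definition _ := GRing.isLinear.Build (Ahat K) (pushm Theta M) (pushm Theta L) *:%R
  push_fun push_fun_linear.
Definition push_linear : {linear pushm Theta M -> pushm Theta L} := push_fun.
End PushLinear.

Section SheafLemmas.
Variables (K : numClosedFieldType) (X : complexSpace K).

Lemma ocst_additive (U : opens X) : nmod_morphism (@ocst K X U).
Proof. by split; [apply: val_inj|move=> c d; apply: val_inj]. Qed.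
Lemma ocst_multiplicative (U : opens X) : monoid_morphism (@ocst K X U).
Proof. by split; [apply: val_inj|move=> c d; apply: val_inj]. Qed.
HB.instance Definition _ (U : opens X) :=
  GRing.isNmodMorphism.Build K (OX U) (@ocst K X U) (@ocst_additive U).
HB.instance Definition _ (U : opens X) :=
  GRing.isMonoidMorphism.Build K (OX U) (@ocst K X U) (@ocst_multiplicative U).

Variable E : AXsheaf X.

Definition const_act (U : opens X) (g : OX U) (s : sec E U) : sec E U := oact (psconst g) s.

Lemma psconstD (O : comPzRingType) (c d : O) : psconst (c + d) = psconst c + psconst d.
Proof.
apply/funext => n; transitivity (psconst c n + psconst d n); last by [].
by rewrite /psconst; case: eqP; rewrite ?addr0.
Qed.
Lemma psconstM (O : comPzRingType) (c d : O) : psconst (c * d) = psconst c * psconst d.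
Proof.
apply/funext => n; rewrite [RHS]/(psmul (psconst c) (psconst d) n) /psmul.
rewrite big_ord_recl subn0 big1 ?addr0; last by move=> i _; rewrite /psconst mul0r.
by rewrite /psconst; case: eqP; rewrite ?mulr0.
Qed.

Lemma const_actP (U : opens X) : is_action (@const_act U).
Proof.
have [H1 H2 H3 H4] := oact_action E U; split; rewrite /const_act.
- by move=> s; rewrite -[psconst 1]/(1 : pseries (OX U)) H1.
- by move=> g h s; rewrite psconstM H2.
- by move=> g s t; rewrite H3.
- by move=> s g h; rewrite psconstD H4.
Qed.

Lemma const_actC (U : opens X) (g : OX U) u s : const_act g (u *: s) = u *: const_act g s.
Proof. exact: oact_comm. Qed.

Lemma const_actI (U : opens X) c (s : sec E U) : const_act (ocst U c) s = c%:A *: s.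
Proof.
rewrite /const_act -bser_const -oact_b; congr oact; apply/funext => n.
by rewrite /psconst; case: eqP => // _; apply: val_inj.
Qed.

Lemma const_act_res (U W : opens X) (WU : W `<=` U) g (s : sec E U) :
  res E WU (const_act g s) = const_act (ores WU g) (res E WU s).
Proof. by rewrite /const_act oact_res ores_const. Qed.

(** S is S_0 + b [psshift S] in [O_X[[b]]], and [oact_b] identifies the series b with the element b
    of [Ahat]. *)
Lemma oact_rec (U : opens X) (S : pseries (OX U)) (s : sec E U) :
  oact S s = const_act (S 0%N) s + ahat_b *: oact (psshift S) s.
Proof.
have [H1 H2 H3 H4] := oact_action E U.
pose v : pseries (OX U) := fun n => ocst U (psvar K n).
have v0 : v 0%N = 0 by exact: (rmorph0 (@ocst K X U)).
have v1 : v 1%N = 1 by exact: (rmorph1 (@ocst K X U)).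
have v2 n : v n.+2 = 0 by exact: (rmorph0 (@ocst K X U)).
have {1}-> : S = psconst (S 0%N) + v * psshift S.
  apply/funext => n.
  transitivity (psconst (S 0%N) n + psmul v (psshift S) n); last by [].
  rewrite /psmul; case: n => [|n]; first by rewrite big_ord1 v0 mul0r addr0.
  rewrite big_ord_recl big_ord_recl v0 mul0r add0r v1 mul1r big1 ?addr0 => [|i _].
    by rewrite add0r lift0 /psshift subSS subn0.
  by rewrite !lift0 v2 mul0r.
by rewrite H4 H2; congr (_ + _); exact: oact_b.
Qed.

Lemma oact_addl (U : opens X) (S T : pseries (OX U)) (s : sec E U) :
  oact (S + T) s = oact S s + oact T s.
Proof. by have [_ _ _ H] := oact_action E U; exact: H. Qed.
End SheafLemmas.

Section PushSheaf.
Variables (K : numClosedFieldType) (X : complexSpace K) (E : AXsheaf X).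
Variables (theta : pseries K) (Theta : {lrmorphism Ahat K -> Ahat K}).
Hypothesis sT : substitution theta Theta.
Hypothesis Eloc : forall x : X, exists2 U0 : opens X, oset U0 x & forall U : opens X, U `<=` U0 ->
  [/\ b_injective (sec E U), b_separated (sec E U) & b_complete (sec E U)].

Definition psec (U : opens X) : lmodType (Ahat K) := pushm Theta (sec E U).
Definition pres (U W : opens X) (WU : W `<=` U) : {linear psec U -> psec W} :=
  push_linear Theta (res E WU).
Definition pact (U : opens X) (g : OX U) (s : psec U) : psec U := const_act g s.

Lemma pactP (U : opens X) : is_action (@pact U). Proof. exact: const_actP. Qed.
Lemma pactC (U : opens X) (g : OX U) u s : pact g (u *: s) = u *: pact g s.
Proof. exact: (const_actC g (Theta u) s). Qed.
Lemma pactI (U : opens X) c (s : psec U) : pact (ocst U c) s = c%:A *: s.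
Proof. by rewrite -[RHS]/(scalar_act c s) push_scalar; exact: const_actI. Qed.
Lemma pact_res (U W : opens X) (WU : W `<=` U) g (s : psec U) :
  pres WU (pact g s) = pact (ores WU g) (pres WU s).
Proof. exact: (const_act_res WU g (s : sec E U)). Qed.

Lemma presZ (U W : opens X) (WU : W `<=` U) u (s : psec U) :
  pres WU (u *: s) = u *: pres WU s.
Proof. by rewrite -[LHS]/(res E WU (Theta u *: (s : sec E U))) linearZ. Qed.

Lemma presD (U W : opens X) (WU : W `<=` U) (s t : psec U) :
  pres WU (s + t) = pres WU s + pres WU t.
Proof. exact: (raddfD (res E WU)). Qed.

(** Separation is given on small open sets; restriction and [sec_sep] spread it to all. *)
Lemma psec_separated (U : opens X) : b_separated (psec U).
Proof.
move=> s H; apply: sec_sep => x Ux; have [U0 U0x /(_ (opensI U U0))] := Eloc x.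
move=> /(_ (@opensIr _ U U0)) [_ sep _].
exists (opensI U U0), (@opensIl _ U U0); split=> //.
rewrite raddf0; apply: (push_b_separated sT sep) => n; have [w ->] := H n.
exists (pres (@opensIl _ U U0) w).
exact: presZ.
Qed.

(** Tails exist locally by completeness. On overlaps two families of tails obey the same recursion,
    so they agree by separation; they are glued for each n, and the recursion is then checked
    locally. *)
Lemma plimit_exists (U : opens X) (S : pseries (OX U)) (s : psec U) :
  exists t, b_limit (@pact U) S s t.
Proof.
have /(_ _)/cid2 cov := Eloc.
pose W (x : {x : X | oset U x}) := opensI U (projT1 (cov (projT1 x))).
pose WU x : W x `<=` U := @opensIl _ U _.
have Wx x : oset (W x) (projT1 x) by split; [exact: projT2|rewrite /=; case: (cov _)].
have loc x : exists tau : nat -> psec (W x), forall n,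
    tau n = pact (ores (WU x) (S n)) (pres (WU x) s) + ahat_b *: tau n.+1.
  have [bI _ cpl] : [/\ b_injective (sec E (W x)), b_separated (sec E (W x)) & b_complete (sec E (W x))].
    by rewrite /W; case: (cov (projT1 x)) => U0 /= _; apply; exact: opensIr.
  exact: (push_b_complete sT bI cpl).
have /(_ _)/cid tau x := loc x.
have glue n : exists t : sec E U, forall x, res E (WU x) t = projT1 (tau x) n.
  apply: (@sec_glue _ _ E U _ W WU (fun x => projT1 (tau x) n)).
    by move=> x Ux; exists (exist _ x Ux); exact: (Wx (exist _ x Ux)).
  move=> x y Y Yx Yy.
  have YU : Y `<=` U by apply: subset_trans Yx (WU x).
  apply/eqP; rewrite -subr_eq0; apply/eqP; move: n.
  pose tx := projT1 (tau x); pose ty := projT1 (tau y).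
  have txE : forall n, tx n = _ := projT2 (tau x).
  have tyE : forall n, ty n = _ := projT2 (tau y).
  apply: (b_coinduction (M := psec Y) (s := succn)
    (D := fun n => pres Yx (tx n) - pres Yy (ty n))).
    exact: psec_separated.
  move=> n; rewrite [tx n]txE [ty n]tyE !presD !pact_res !presZ scalerBr opprD addrACA.
  have rr i (Yi : Y `<=` W i) : pres Yi (pres (WU i) s) = pres YU s by exact: res_comp.
  rewrite !rr.
  have orr i (Yi : Y `<=` W i) : ores Yi (ores (WU i) (S n)) = ores YU (S n).
    by apply: val_inj; apply/funext => z /=; congr (S n _); exact: pt_irr.
  by rewrite !orr subrr add0r.
have /(_ _)/cid t n := glue n.
exists (projT1 (t 0%N) : psec U), (fun n => projT1 (t n) : psec U); split=> // n.
apply: sec_sep => x Ux; exists (W (exist _ x Ux)), (WU _); split; first exact: (Wx (exist _ x Ux)).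
set i := exist _ x Ux.
rewrite -[RHS]/(pres (WU i) (pact (S n) s + ahat_b *: (projT1 (t n.+1) : psec U))).
rewrite presD pact_res presZ.
rewrite -[pres _ (projT1 (t n.+1))]/(res E (WU i) (projT1 (t n.+1))).
case: (t n) => tn /= ->; case: (t n.+1) => tn1 /= ->.
exact: (projT2 (tau i) n).
Qed.

Definition poact (U : opens X) (S : pseries (OX U)) (s : psec U) : psec U :=
  projT1 (cid (plimit_exists S s)).

Lemma poact_rec (U : opens X) (S : pseries (OX U)) (s : psec U) :
  poact S s = pact (S 0%N) s + ahat_b *: poact (psshift S) s.
Proof.
have [t [Ht E1]] : exists t', b_limit (@pact U) (psshift S) s t' /\
    poact S s = pact (S 0%N) s + ahat_b *: t'.
  by apply: b_limit_shift; rewrite /poact; case: (cid _).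
rewrite E1; congr (_ + _ *: _); apply: (b_limit_uniq (@psec_separated U) Ht).
by rewrite /poact; case: (cid _).
Qed.

Lemma poact_res (U W : opens X) (WU : W `<=` U) S (s : psec U) :
  pres WU (poact S s) = poact (fun n => ores WU (S n)) (pres WU s).
Proof.
apply/eqP; rewrite -subr_eq0; apply/eqP; move: S.
apply: (b_coinduction (s := @psshift _) (@psec_separated W)) => S.
rewrite [poact S _]poact_rec [poact (fun n => ores WU (S n)) _]poact_rec presD pact_res.
by rewrite presZ opprD addrACA subrr add0r scalerBr.
Qed.

Definition push_sheaf : AXsheaf X.
Proof.
refine (@AXSheaf K X psec pres _ _ _ _ poact _ poact_res _ _).
- exact: res_id.
- exact: res_comp.
- exact: sec_sep.
- exact: sec_glue.
- move=> U; exact: (ext_act_action (@pactP U) (@pactC U) (@poact_rec U) (@psec_separated U)).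
- move=> U S s; exact: (ext_act_bser (iota := @ocst K X U) (@pactI U) (@poact_rec U) (@psec_separated U)).
- move=> U g u s; rewrite !(ext_act_const (@pactP U) (@poact_rec U) (@psec_separated U)).
  exact: pactC.
Defined.

Lemma push_sheaf_const (U : opens X) (g : OX U) (s : psec U) :
  poact (psconst g) s = oact (psconst g) (s : sec E U).
Proof. exact: (ext_act_const (@pactP U) (@poact_rec U) (@psec_separated U)). Qed.
End PushSheaf.

(** * Psi on holomorphic sections *)

Section TransportSections.
Variables (K : numClosedFieldType) (X : complexSpace K).
Variables (m : nat) (lam : 'I_m -> rat) (N : nat) (V : vectType K).
Variables (Phi : {lrmorphism Ahat K -> Ahat K}) (eta : pseries K).
Hypothesis sP : substitution eta Phi.
Local Notation XiV := (Xi lam N V).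
Local Notation Psi := (@xi_transport K m lam N V Phi eta sP).
Variable U : opens X.
Local Notation xhol := (@xhol K X m lam N V U).

Lemma xholZD u (s t : U -> XiV) : s \in xhol -> t \in xhol -> (fun x => u *: s x + t x) \in xhol.
Proof. by have [_ H] := @xhol_submod K X m lam N V U; exact: H. Qed.

Lemma xhol0 : (fun=> 0 : XiV) \in xhol.
Proof. by have [H _] := @xhol_submod K X m lam N V U; exact: H. Qed.

Lemma xhol_sum k (F : 'I_k -> U -> XiV) : (forall i, F i \in xhol) ->
  (fun x => \sum_(i < k) F i x) \in xhol.
Proof.
move=> H; have -> : (fun x => \sum_(i < k) F i x) = \sum_(i < k) F i.
  by apply/funext => x; elim/big_rec2: _ => // i a b _ ->.
elim/big_ind: _ => [|s t Hs Ht|i _]; [exact: xhol0| |exact: H].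
have -> : s + t = fun x => 1 *: s x + t x by apply/funext => x; rewrite scale1r.
exact: xholZD.
Qed.

Lemma xholZ u (s : U -> XiV) : s \in xhol -> (fun x => u *: s x) \in xhol.
Proof.
move=> H; have -> : (fun x => u *: s x) = fun x => u *: s x + 0 by apply/funext => x; rewrite addr0.
exact: xholZD xhol0.
Qed.

(** Each coefficient of Psi(s x) is a combination of finitely many coefficients of s x, with scalars
    of K independent of x. *)
Lemma xhol_transport (s : U -> XiV) : s \in xhol -> (fun x => Psi (s x)) \in xhol.
Proof.
move=> H; apply/xholP => -[[n i] j] l.
have /xholP/(_ (n, i, j) l) // : (fun x => xi_partial sP n.+1 (s x)) \in xhol.
apply: xhol_sum => n'; apply: xholZ; apply: xhol_sum => i'; apply: xhol_sum => l'.
apply: xholZ; apply/xholP => -[[[|n''] i''] j''] h /=; last first.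
  by have /xholP/(_ (0%N, i, j) h) := xhol0.
rewrite /fpart; case: eqP => _; last by have /xholP/(_ (0%N, i, j) h) := xhol0.
rewrite /fext; case: insub => [j3|]; last by have /xholP/(_ (0%N, i, j) h) := xhol0.
by move/xholP: H; apply.
Qed.

Definition xi_tsec (s : XiSec lam N V U) : XiSec lam N V U := MkXiSec (xhol_transport (XiSecP s)).

Lemma xi_sec_separated : b_separated (XiSec lam N V U : lmodType (Ahat K)).
Proof.
move=> s H; apply: XiSec_inj; apply/funext => x; apply: xvan_eq => M.
have [w ->] := H M; rewrite [_ x]/(ahat_b ^+ M *: (w x)) -[M in xvan M _]addn0.
exact: xvan_bX.
Qed.
End TransportSections.

Section ValueEmbedding.
Variables (K : numClosedFieldType) (m : nat) (lam : 'I_m -> rat) (N : nat) (V : vectType K).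
Local Notation XiV := (Xi lam N V).

(* h factors through a surjection M -> L of free K[[b]]-modules of the same rank. *)
Lemma same_range_injective k (M L : lmodType (Ahat K)) (h : M -> XiV) (g : L -> XiV) :
  linear h -> linear g -> injective g -> range h = range g ->
  ab_module k [set: tildem M] -> ab_module k [set: tildem L] -> injective h.
Proof.
move=> hL gL gI rg abM abL.
have /(_ _)/cid pre x : exists y, g y = h x.
  have : range h (h x) by exists x.
  by rewrite rg => -[y _ yE]; exists y.
pose p x := projT1 (pre x).
have pE x : g (p x) = h x by rewrite /p; case: (pre x).
have pL : linear p by move=> u x y; apply: gI; rewrite pE hL gL !pE.
have pD x y : p (x + y) = p x + p y by have := pL 1 x y; rewrite !scale1r.
have p0 : p 0 = 0 by apply: (addrI (p 0)); rewrite -pD !addr0.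
have pZ u x : p (u *: x) = u *: p x by have := pL u x 0; rewrite !addr0 p0 addr0.
have pS y : exists x, p x = y.
  have : range g (g y) by exists y.
  by rewrite -rg => -[x _ xE]; exists x; apply: gI; rewrite pE.
suff H : forall x, p x = 0 -> x = 0.
  move=> x y; rewrite -!pE => /gI E; apply/eqP; rewrite -subr_eq0; apply/eqP; apply: H.
  by rewrite -scaleN1r pD pZ E scaleN1r subrr.
have [e [einj esurj]] := ab_module_basis abM.
have [d dbas] := ab_module_mod_b abL; have [dspan dfree] := dbas.
have [espan _] := basis_mod_b_of_basis (@scalar_actP K M) (@bser_act_rec K M) (@bser_actD K M) einj esurj.
have pspan y : exists (c : 'I_k -> K) w, y = \sum_(i < k) scalar_act (c i) (p (e i)) + ahat_b *: w.
  have [x <-] := pS y; have [c [w ->]] := espan x; exists c, (p w).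
  rewrite pD pZ; congr (_ + _); rewrite (big_morph p pD p0); apply: eq_bigr => i _.
  exact: pZ.
(* The k elements p(e_i) span L / bL, which has dimension k, so they form a basis there; they are
   then free over K[[b]], and p is injective. *)
have [Bm BE] := span_mod_b_matrix d pspan.
have [Am AE] := span_mod_b_matrix (fun i => p (e i)) dspan.
have BA := basis_mod_b_mul1 dbas BE AE.
have Au : Am \in unitmx by case: (mulmx1_unit BA).
have pbas : basis_mod_b (@scalar_act K L) (fun i => p (e i)).
  apply: (basis_mod_b_change (iota := idfun) (@scalar_actP K L) (@scalar_actC K L) dbas Au) => i.
  exact: AE.
move=> x px0; have [S SE] := esurj x.
have bI := ab_module_bI abL.
have sep := ab_module_sep abL.
have /(_ S (fun=> 0)) E := b_comb_inj (@scalar_actP K L) (@bser_act_rec K L) sep bI pbas.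
rewrite SE E; first by rewrite /b_comb_of big1// => i _; rewrite /bser_act (_ : bser 0 = 0) ?scale0r//;
  apply: ahatP => s t; rewrite /bser; case: eqP.
transitivity (p x); last first.
  rewrite px0 /b_comb_of big1// => i _; rewrite /bser_act (_ : bser 0 = 0) ?scale0r//.
  by apply: ahatP => s t; rewrite /bser; case: eqP.
by rewrite SE /b_comb_of (big_morph p pD p0); apply: eq_bigr => i _; rewrite /bser_act pZ.
Qed.
End ValueEmbedding.

Section PushValue.
Variables (K : numClosedFieldType) (X : complexSpace K) (E : AXsheaf X).
Variables (theta : pseries K) (Theta : {lrmorphism Ahat K -> Ahat K}).
Hypothesis sT : substitution theta Theta.
Hypothesis Eloc : forall x : X, exists2 U0 : opens X, oset U0 x & forall U : opens X, U `<=` U0 ->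
  [/\ b_injective (sec E U), b_separated (sec E U) & b_complete (sec E U)].
Local Notation F := (push_sheaf sT Eloc).
Variable x : X.

(** M_x E is formed with the action of functions alone, which the pushforward leaves unchanged. *)
Lemma push_in_maximal (U : opens X) (Ux : oset U x) (s : sec E U) :
  in_maximal (E := F) Ux s <-> in_maximal Ux s.
Proof.
split=> -[r [g [t [g0 sE]]]]; exists r, g, t; split=> //; rewrite sE;
  apply: eq_bigr => i _; first exact: push_sheaf_const.
exact: (esym (push_sheaf_const sT Eloc _ _)).
Qed.

Lemma push_cls_eq (U W : opens X) (Ux : oset U x) (Wx : oset W x) (s : sec E U) (t : sec E W) :
  cls (E := F) Ux s = cls (E := F) Wx t <-> cls Ux s = cls Wx t.
Proof.
rewrite !clsE; split=> -[Y [Yx [Yp [Yq H]]]]; exists Y, Yx, Yp, Yq.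
  by move/push_in_maximal: H.
by apply/push_in_maximal.
Qed.

Definition value_push (v : value F x) : pushm Theta (value E x) :=
  cls (gpt (repr v)) (gsec (repr v) : sec E _).

Lemma value_push_cls (U : opens X) (Ux : oset U x) (s : sec E U) :
  value_push (cls (E := F) Ux s) = cls Ux s.
Proof. by apply/push_cls_eq; exact: cls_repr. Qed.

Lemma value_push_linear : linear value_push.
Proof.
move=> u v w; have [U [Ux [s [t [-> ->]]]]] := cls_surj2 v w.
have -> : u *: cls (E := F) Ux s + cls (E := F) Ux t = cls (E := F) Ux (u *: s + t).
  apply: etrans (cls_add (E := F) Ux (u *: s) t); congr (value_add _ _).
  exact: (cls_scale (E := F) u Ux s).
rewrite !value_push_cls; apply: etrans (esym (cls_add (E := E) Ux (Theta u *: (s : sec E U)) t)) _.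
by congr (value_add _ _); exact: (esym (cls_scale (E := E) (Theta u) Ux s)).
Qed.

Lemma value_push_iso : isomorphic (value F x) (pushm Theta (value E x)).
Proof.
pose mx := GRing.isLinear.Build (Ahat K) (value F x) (pushm Theta (value E x)) *:%R
  value_push value_push_linear.
pose f : {linear value F x -> pushm Theta (value E x)} := HB.pack value_push mx.
exists f; exists (fun v : value E x => cls (E := F) (gpt (repr v)) (gsec (repr v))).
  move=> v; have [U [Ux [s ->]]] := cls_surj v.
  by apply/push_cls_eq; rewrite /= cls_repr value_push_cls.
by move=> v; rewrite /= value_push_cls cls_repr.
Qed.
End PushValue.

(** * Local models *)

Section LocalModel.
Variables (K : numClosedFieldType) (X : complexSpace K) (E : AXsheaf X).
Variables (k : nat) (U0 : opens X) (m : nat) (lam : 'I_m -> rat) (N : nat) (V : vectType K).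
Local Notation XiV := (Xi lam N V).
Local Notation XiS := (XiX X lam N V).
Variable phi : sec XiS U0.
Hypothesis lam0 : forall i, 0 < lam i.
Hypothesis adm : k_admissible k phi.
Variable f : forall U : opens X, {linear sec E U -> sec XiS U}.
Hypothesis fI : forall U : opens X, U `<=` U0 -> injective (f U).
Hypothesis fR : forall U : opens X, U `<=` U0 -> range (f U) = generated phi (U := U).
Hypothesis fO : forall U : opens X, U `<=` U0 -> forall (S : pseries (OX U)) s,
  f U (oact S s) = oact S (f U s).
Hypothesis fres : forall U : opens X, U `<=` U0 -> forall (W : opens X) (WU : W `<=` U) s,
  f W (res E WU s) = res XiS WU (f U s).

Lemma generator_exists : exists s, f U0 s = phi.
Proof.
have : generated phi phi by move=> G _.
by rewrite -fR// => -[s _ sE]; exists s.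
Qed.
Definition generator : sec E U0 := projT1 (cid generator_exists).
Lemma generatorE : f U0 generator = phi.
Proof. by rewrite /generator; case: (cid _). Qed.

Definition model_frame (U : opens X) (UU0 : U `<=` U0) (i : 'I_k) : sec E U :=
  ahat_a ^+ i *: res E UU0 generator.

Lemma f_frame (U : opens X) (UU0 : U `<=` U0) S :
  f U (b_comb_of (@oact K X E U) (model_frame UU0) S) = O_comb (res XiS UU0 phi) S.
Proof.
rewrite /b_comb_of raddf_sum; apply: eq_bigr => i _ /=.
by rewrite fO// linearZ /= fres// generatorE.
Qed.

Lemma model_frame_inj (U : opens X) (UU0 : U `<=` U0) :
  injective (b_comb_of (@oact K X E U) (model_frame UU0)).
Proof.
have [inj _] := adm.1 U UU0.
by move=> S T /(congr1 (f U)); rewrite !f_frame => /inj.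
Qed.

Lemma model_frame_surj (U : opens X) (UU0 : U `<=` U0) s :
  exists S, s = b_comb_of (@oact K X E U) (model_frame UU0) S.
Proof.
have [_ rg] := adm.1 U UU0.
have : range (f U) (f U s) by exists s.
rewrite fR// -rg => -[S _ SE]; exists S; apply: (fI UU0).
by rewrite f_frame.
Qed.

Lemma model_b_adic (U : opens X) : U `<=` U0 ->
  [/\ b_injective (sec E U), b_separated (sec E U) & b_complete (sec E U)].
Proof.
move=> UU0; have inj := @model_frame_inj U UU0; have surj := @model_frame_surj U UU0.
have aP := @const_actP K X E U; have rec := @oact_rec K X E U; have AD := @oact_addl K X E U.
split; [exact: (basis_b_injective aP rec inj surj)|exact: (basis_b_separated aP rec AD inj surj)|].
exact: (basis_b_complete aP rec AD surj).
Qed.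

Lemma xi_ev_sum (U : opens X) x (Ux : oset U x) n (s : 'I_n -> sec XiS U) :
  xi_ev Ux (\sum_(i < n) s i) = \sum_(i < n) xi_ev Ux (s i).
Proof. by elim/big_rec2: _ => // i a b _ <-. Qed.

Lemma xi_ev_comb (U : opens X) x (Ux : oset U x) (UU0 : U `<=` U0) S :
  xi_ev Ux (O_comb (k := k) (res XiS UU0 phi) S) =
  \sum_(i < k) bser (fun n => S i n (pt Ux)) *: (ahat_a ^+ i *: xi_ev (UU0 _ Ux) phi).
Proof.
rewrite xi_ev_sum; apply: eq_bigr => i _.
rewrite [LHS]/(bser _ *: (ahat_a ^+ i *: xfun phi (Defs.incl UU0 (pt Ux)))).
by congr (_ *: (_ *: xfun phi _)); exact: pt_irr.
Qed.

Lemma fiber_generator x (Ux : oset U0 x) : exists (M : lmodType (Ahat K)) (g : {linear M -> XiV}) (m0 : M),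
  [/\ injective g, range g = ev_image phi x, fresco k (tildem M), g m0 = xi_ev Ux phi
    & forall y, exists u, y = u *: m0].
Proof.
have [M [g [gI gR fr]]] := adm.2 x Ux; exists M, g.
have [m0 _ m0E] : range g (xi_ev Ux phi).
  rewrite gR; exists U0, Ux, phi; split=> //; by move=> G _.
exists m0; split=> // y.
have : range g (g y) by exists y.
rewrite gR => -[U [Ux' [s [UU0 sgen yE]]]].
move: sgen; have [_ <-] := adm.1 U UU0; move=> [S _ sE].
(* By admissibility s is a combination of the a^i phi; its coefficients are evaluated at x. *)
exists (\sum_(i < k) bser (fun n => S i n (pt Ux')) * ahat_a ^+ i); apply: gI.
rewrite yE -sE xi_ev_comb linearZ /= m0E scaler_suml; apply: eq_bigr => i _.
rewrite -scalerA; congr (_ *: (_ *: _)).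
by rewrite /xi_ev; congr (xfun phi _); exact: pt_irr.
Qed.

(* At each point a is nilpotent modulo b, since the fiber lies in Xi; functions on a
   reduced space which vanish at every point are zero. *)
Lemma generator_nilpotent : exists w, ahat_a ^+ k *: generator = ahat_b *: w.
Proof.
have U00 : U0 `<=` U0 by [].
have [S SE] := model_frame_surj U00 (ahat_a ^+ k *: generator).
suff S0 i : S i 0%N = 0.
  exists (b_comb_of (@oact K X E U0) (model_frame U00) (fun i => psshift (S i))).
  rewrite SE (b_comb_rec (@oact_rec K X E U0)) big1 ?add0r// => i _.
  by rewrite S0 (act0l (@const_actP K X E U0)).
apply: val_inj; apply/funext => x.
have Ux : oset U0 (\val x) := set_mem (valP x).
have -> : x = pt Ux by exact: pt_irr.
have [M [g [m0 [gI gR [ab _ _] m0E gen]]]] := fiber_generator Ux.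
have gL : linear g by exact: linearP.
have [[_ free] [w wE]] := fresco_cyclic gL gI ab gen.
(* a^k m0 is b w, and also the evaluated combination of the a^i m0. The witness gathers the
   multiples of b of both, so freeness modulo b kills the constant terms at x. *)
apply: (free (fun i => S i 0%N (pt Ux)) (w - \sum_(i < k) bser (psshift (fun n => S i n (pt Ux))) *: (ahat_a ^+ i *: m0))).
have E1 : ahat_a ^+ k *: m0 = \sum_(i < k) bser (fun n => S i n (pt Ux)) *: (ahat_a ^+ i *: m0).
  apply: gI; rewrite raddf_sum linearZ /= m0E.
  transitivity (xi_ev Ux (f U0 (ahat_a ^+ k *: generator))).
    by rewrite linearZ /= generatorE.
  rewrite SE f_frame xi_ev_comb; apply: eq_bigr => j _; rewrite !linearZ /= m0E.
  by congr (_ *: (_ *: xfun phi _)); exact: pt_irr.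
rewrite scalerBr -wE E1 scaler_sumr -sumrB; apply: eq_bigr => j _.
by rewrite bser_split scalerDl -scalerA addrK.
Qed.

Lemma ev_in_maximal (U : opens X) x (Ux : oset U x) s : U `<=` U0 ->
  in_maximal Ux s -> xi_ev Ux (f U s) = 0.
Proof.
move=> UU0 [r [g [t [g0 ->]]]]; rewrite raddf_sum xi_ev_sum big1// => i _ /=.
rewrite fO//; rewrite [LHS]/(bser (fun n => psconst (g i) n (pt Ux)) *: xi_ev Ux (f U (t i))).
have -> : (fun n => psconst (g i) n (pt Ux)) = psconst 0 :> pseries K.
  by apply/funext => n; rewrite /psconst; case: eqP.
rewrite bser_const scale0r; exact: scale0r.
Qed.

Section FiberValue.
Variables (x : X) (Ux : oset U0 x).

(** The properties of f are known inside U0, so the germ is restricted there before evaluation. *)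
Definition germ_ev (p : germ E x) : XiV :=
  xi_ev (conj (gpt p) Ux : oset (opensI (gset p) U0) x)
    (f _ (res E (@opensIl _ (gset p) U0) (gsec p))).

Lemma germ_evE (p : germ E x) (W : opens X) (Wx : oset W x) (Wp : W `<=` gset p) : W `<=` U0 ->
  germ_ev p = xi_ev Wx (f W (res E Wp (gsec p))).
Proof.
move=> WU0; have WI : W `<=` opensI (gset p) U0 by move=> y Wy; split; [exact: Wp|exact: WU0].
rewrite -(res_comp (@opensIl _ (gset p) U0) WI) fres; last exact: opensIr.
by rewrite /germ_ev /xi_ev /=; congr (xfun _ _); exact: pt_irr.
Qed.

Lemma germ_ev_eq p q : value_eq p q -> germ_ev p = germ_ev q.
Proof.
move=> [W [Wx [Wp [Wq H]]]]; pose W' := opensI W U0.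
have W'x : oset W' x by split.
have W'W : W' `<=` W := @opensIl _ W U0; have W'U0 : W' `<=` U0 := @opensIr _ W U0.
rewrite (germ_evE W'x (subset_trans W'W Wp) W'U0) (germ_evE W'x (subset_trans W'W Wq) W'U0).
have := ev_in_maximal W'U0 (in_maximal_res W'W W'x H).
rewrite !raddfB /= (res_comp Wp W'W (subset_trans W'W Wp)) (res_comp Wq W'W (subset_trans W'W Wq)).
by move/eqP; rewrite [X in X == _]/(xi_ev W'x (f W' _) - xi_ev W'x (f W' _)) subr_eq0 => /eqP.
Qed.

Definition value_ev (v : value E x) : XiV := germ_ev (repr v).

Lemma value_ev_cls (U : opens X) (Ux' : oset U x) s : value_ev (cls Ux' s) = germ_ev (Germ Ux' s).
Proof.
have := cls_repr (cls Ux' s); rewrite clsE => /germ_ev_eq.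
by [].
Qed.

Lemma value_ev_linear : linear value_ev.
Proof.
move=> u v w; have [U [Ux' [s [t [-> ->]]]]] := cls_surj2 v w.
have -> : u *: cls Ux' s + cls Ux' t = cls Ux' (u *: s + t).
  apply: etrans (cls_add Ux' (u *: s) t); congr (value_add _ _).
  exact: (cls_scale u Ux' s).
by rewrite !value_ev_cls /germ_ev /= linearP linearP.
Qed.

Lemma value_ev_range : range value_ev = ev_image phi x.
Proof.
rewrite eqEsubset; split=> [_ [v _ <-]|y [U [Ux' [s [UU0 sgen ->]]]]].
  have [U [Ux' [s ->]]] := cls_surj v; rewrite value_ev_cls.
  exists (opensI U U0), (conj Ux' Ux), (f _ (res E (@opensIl _ U U0) s)); split=> //.
    exact: opensIr.
  by rewrite -fR; [exists (res E (@opensIl _ U U0) s)|exact: opensIr].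
move: sgen; rewrite -fR// => -[t _ <-]; exists (cls Ux' t) => //.
rewrite value_ev_cls (germ_evE (p := Germ Ux' t) Ux' (@subset_refl _ U) UU0) /=.
by rewrite res_id.
Qed.

(** Not formal: a section vanishing at x has to be shown to lie in M_x E. The map is onto the fiber
    of the model in Xi, and both sides are free of rank k over K[[b]]. *)
Lemma value_ev_injective : fresco k (tildem (value E x)) -> injective value_ev.
Proof.
move=> [ab _ _]; have [M [g [m0 [gI gR [abM _ _] _ _]]]] := fiber_generator Ux.
apply: (same_range_injective value_ev_linear _ gI _ ab abM); first exact: linearP.
by rewrite value_ev_range.
Qed.
End FiberValue.

Section Push.
Variables (theta eta : pseries K) (Theta Phi : {lrmorphism Ahat K -> Ahat K}).
Hypotheses (sT : substitution theta Theta) (sP : substitution eta Phi).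
Hypotheses (TP : cancel Theta Phi) (PT : cancel Phi Theta).
Hypothesis Eloc : forall x : X, exists2 U0 : opens X, oset U0 x & forall U : opens X, U `<=` U0 ->
  [/\ b_injective (sec E U), b_separated (sec E U) & b_complete (sec E U)].
Local Notation F := (push_sheaf sT Eloc).
Local Notation Psi := (@xi_transport K m lam N V Phi eta sP).

Lemma value_push_fresco x : oset U0 x ->
  fresco k (tildem (value E x)) -> fresco k (tildem (pushm Theta (value E x))).
Proof.
move=> Ux fr; have bT : bijective Theta by exists Phi.
exact: (fresco_push lam0 (@value_ev_linear x Ux) (@value_ev_injective x Ux fr) sT bT fr).
Qed.

Definition push_map_fun (U : opens X) (s : sec F U) : sec XiS U := xi_tsec sP (f U s).

Lemma push_map_linear (U : opens X) : linear (@push_map_fun U).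
Proof.
move=> u s t; apply: XiSec_inj; apply/funext => x.
have E1 : f U (Theta u *: (s : sec E U) + t) x = Theta u *: f U s x + f U t x.
  by rewrite linearP.
apply: etrans (congr1 Psi E1) _.
by rewrite xi_transportD xi_transportP TP.
Qed.
HB.instance Definition _ (U : opens X) :=
  GRing.isLinear.Build (Ahat K) (sec F U) (sec XiS U) *:%R (@push_map_fun U) (@push_map_linear U).
Definition push_map (U : opens X) : {linear sec F U -> sec XiS U} := @push_map_fun U.

Lemma push_mapD (U : opens X) (s t : sec F U) : push_map U (s + t) = push_map U s + push_map U t.
Proof. exact: raddfD. Qed.
Lemma push_mapZ (U : opens X) u (s : sec F U) : push_map U (u *: s) = u *: push_map U s.
Proof. by rewrite linearZ. Qed.

Lemma push_map_inj (U : opens X) : U `<=` U0 -> injective (push_map U).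
Proof.
move=> UU0 s t E1; apply: (fI UU0); apply: XiSec_inj; apply/funext => x.
apply: (@xi_transport_inj K m lam N V Phi eta sP).
exact: (congr1 (fun s : sec XiS U => s x) E1).
Qed.

Lemma push_map_res (U : opens X) : U `<=` U0 -> forall (W : opens X) (WU : W `<=` U) s,
  push_map W (res F WU s) = res XiS WU (push_map U s).
Proof.
move=> UU0 W WU s; apply: XiSec_inj; apply/funext => x.
exact: (congr1 (fun s : sec XiS W => Psi (s x)) (fres UU0 WU (s : sec E U))).
Qed.

Lemma push_map_act (U : opens X) (g : OX U) (s : sec F U) : U `<=` U0 ->
  push_map U (pact g s) = const_act g (push_map U s).
Proof.
move=> UU0; apply: XiSec_inj; apply/funext => x.
have cE y : bser (fun n => psconst g n x) *: y = (g x)%:A *: y :> XiV.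
  rewrite -bser_const; congr (bser _ *: _).
  by apply/funext => n; rewrite /psconst; case: eqP.
have E1 : f U (oact (psconst g) (s : sec E U)) x = (g x)%:A *: f U s x.
  by rewrite fO//; exact: cE.
apply: etrans (congr1 Psi E1) _; rewrite xi_transportZ.
exact: (esym (cE (Psi (f U s x)))).
Qed.

(** Both actions obey the same recursion in S, and they agree on functions; separation of the
    sections of Xi concludes. *)
Lemma push_map_oact (U : opens X) : U `<=` U0 -> forall (S : pseries (OX U)) (s : sec F U),
  push_map U (oact S s) = oact S (push_map U s).
Proof.
move=> UU0 S s; apply/eqP; rewrite -subr_eq0; apply/eqP; move: S.
apply: (b_coinduction (M := sec XiS U) (s := @psshift _)).
  exact: xi_sec_separated.
move=> S.
have E1 : oact S s = pact (S 0%N) s + ahat_b *: oact (psshift S) s :> sec F U.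
  exact: (poact_rec sT Eloc S s).
have E2 : oact S (push_map U s) = const_act (S 0%N) (push_map U s)
    + ahat_b *: oact (psshift S) (push_map U s) by exact: oact_rec.
rewrite E1 E2 push_mapD push_mapZ push_map_act//.
by rewrite opprD addrACA subrr add0r scalerBr.
Qed.

Definition push_generator : sec XiS U0 := push_map U0 (generator : sec F U0).

Definition push_frame (U : opens X) (UU0 : U `<=` U0) (i : 'I_k) : sec F U :=
  ahat_a ^+ i *: res F UU0 (generator : sec F U0).

Lemma push_frame_mod_b (U : opens X) (UU0 : U `<=` U0) :
  basis_mod_b (@pact K X E Theta U) (push_frame UU0).
Proof.
have aP := @const_actP K X E U; have aC := @const_actC K X E U.
have rec := @oact_rec K X E U; have AD := @oact_addl K X E U.
have bas := basis_mod_b_of_basis aP rec AD (@model_frame_inj U UU0) (@model_frame_surj U UU0).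
have nil : exists w, ahat_a ^+ k *: res E UU0 generator = ahat_b *: w.
  have [w wE] := generator_nilpotent; exists (res E UU0 w).
  by rewrite -!linearZ /= wE.
have [t0 t1 Ta _] := sT.
have := basis_mod_b_theta (iota := @ocst K X U) aP aC (@const_actI K X E U) t0 t1 bas nil.
move=> /(push_basis_mod_b sT); congr basis_mod_b; apply/funext => i.
by rewrite /push_frame pushE rmorphXn /= Ta.
Qed.

Lemma push_frame_inj (U : opens X) (UU0 : U `<=` U0) :
  injective (b_comb_of (@poact K X E theta Theta sT Eloc U) (push_frame UU0)).
Proof.
have [bI _ _] := model_b_adic UU0.
apply: (b_comb_inj (@pactP K X E Theta U) (@poact_rec K X E theta Theta sT Eloc U) _ _
  (push_frame_mod_b UU0)); first exact: (psec_separated sT Eloc).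
exact: (push_b_injective sT bI).
Qed.

Lemma push_frame_surj (U : opens X) (UU0 : U `<=` U0) s :
  exists S, s = b_comb_of (@poact K X E theta Theta sT Eloc U) (push_frame UU0) S.
Proof.
apply: (b_comb_surj (@poact_rec K X E theta Theta sT Eloc U) _ (push_frame_mod_b UU0)).
exact: (psec_separated sT Eloc).
Qed.

Lemma push_map_frame (U : opens X) (UU0 : U `<=` U0) S :
  push_map U (b_comb_of (@poact K X E theta Theta sT Eloc U) (push_frame UU0) S) =
  O_comb (res XiS UU0 push_generator) S.
Proof.
rewrite /b_comb_of [LHS](raddf_sum (push_map U)); apply: eq_bigr => i _.
apply: etrans (push_map_oact UU0 (S i) (push_frame UU0 i)) _.
by rewrite /push_frame push_mapZ push_map_res.
Qed.

Lemma push_map_range (U : opens X) : U `<=` U0 -> range (push_map U) = generated push_generator (U := U).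
Proof.
move=> UU0; rewrite eqEsubset; split=> [_ [s _ <-] G Gsub Ggen|s].
  have [S ->] := push_frame_surj UU0 s; rewrite push_map_frame.
  have [[G0 GP] GO _ _] := Gsub U UU0; have [_ _ Gres _] := Gsub U0 (@subset_refl _ _).
  have GZ u y : G U y -> G U (u *: y) by move=> Gy; rewrite -[_ *: _]addr0; exact: GP.
  rewrite /O_comb; apply: big_ind => // [a b Ga Gb|i _]; first by rewrite -[a]scale1r; exact: GP.
  by apply/GO/GZ/Gres.
(* Conversely, the images form a sub-sheaf containing the generator, hence contain the generated
   one. *)
move=> gen; apply: (gen (fun W => range (push_map W))); last by exists (generator : sec F U0).
move=> {s gen UU0 U} W WU0; split.
- split; first by exists 0 => //; rewrite raddf0.
  move=> u _ _ [s _ <-] [t _ <-]; exists (u *: s + t) => //.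
  by rewrite push_mapD push_mapZ.
- by move=> S _ [s _ <-]; exists (oact S s) => //; rewrite push_map_oact.
- by move=> Y YW _ [s _ <-]; exists (res F YW s) => //; rewrite push_map_res.
(* Local preimages agree on overlaps by injectivity of [push_map], so they glue to a section of
   F. *)
- move=> s loc.
  have /(_ _)/cid D (y : {y : X | oset W y}) := loc _ (projT2 y).
  pose Y y := projT1 (D y).
  have pre y : exists (YW : Y y `<=` W) (t : sec F (Y y)), oset (Y y) (projT1 y) /\
      push_map (Y y) t = res XiS YW s.
    by have [YW [Yy [t _ tE]]] := projT2 (D y); exists YW, t.
  have /(_ _)/cid pre' := pre; pose YW y := projT1 (pre' y).
  have /(_ _)/cid t y := projT2 (pre' y).
  have [| |t0 t0E] := @sec_glue _ _ F W _ Y YW (fun y => projT1 (t y)).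
  + by move=> y Wy; exists (exist _ y Wy); have [] := projT2 (t (exist _ y Wy)).
  + move=> y z Q Qy Qz; have QU0 : Q `<=` U0.
      by apply: subset_trans WU0; apply: subset_trans Qy (YW y).
    apply: (push_map_inj QU0).
    have YU0 w : Y w `<=` U0 by apply: subset_trans (YW w) WU0.
    rewrite !push_map_res//.
    have [_ ->] := projT2 (t y); have [_ ->] := projT2 (t z).
    have QW : Q `<=` W by apply: subset_trans Qy (YW y).
    by rewrite (res_comp _ _ QW) (res_comp _ _ QW).
  + exists t0 => //; apply: sec_sep => y Wy; pose w : {y : X | oset W y} := exist _ y Wy.
    exists (Y w), (YW w); split; first by have [] := projT2 (t w).
    by rewrite -push_map_res// t0E; have [] := projT2 (t w).
Qed.

Lemma push_admissible : k_admissible k push_generator.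
Proof.
split=> [U UU0|x Ux].
  have fE S : push_map U (b_comb_of (@poact K X E theta Theta sT Eloc U) (push_frame UU0) S) =
    O_comb (res XiS UU0 push_generator) S := push_map_frame UU0 S.
  split.
    by move=> S T; rewrite -!fE => /(push_map_inj UU0) /push_frame_inj.
  rewrite -push_map_range// eqEsubset; split=> [_ [S _ <-]|_ [s _ <-]].
    by rewrite -fE; eexists.
  by have [S ->] := push_frame_surj UU0 s; exists S => //; rewrite fE.
(* The fiber of the new sheaf at x is the image under Psi of the old one, hence the pushforward of
   M. *)
have [M [g [m0 [gI gR fr _ _]]]] := fiber_generator Ux.
have gL : linear g by exact: linearP.
pose h (y : pushm Theta M) : XiV := Psi (g y).
have hL : linear h.
  move=> u y z; rewrite /h pushE gL xi_transportD xi_transportP TP//.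
pose mx := GRing.isLinear.Build (Ahat K) (pushm Theta M) XiV *:%R h hL.
pose H : {linear pushm Theta M -> XiV} := HB.pack h mx.
exists (pushm Theta M), H; split.
- by move=> y z /xi_transport_inj /gI.
- rewrite eqEsubset; split=> [_ [y _ <-]|_ [U [Ux' [s [UU0 sgen ->]]]]].
    have : ev_image phi x (g y) by rewrite -gR; exists y.
    move=> [U [Ux' [s [UU0 sgen yE]]]]; move: sgen; rewrite -fR// => -[t _ tE].
    exists U, Ux', (push_map U (t : sec F U)); split=> //; first by rewrite -push_map_range//; exists t.
    by rewrite /H /= /h yE -tE.
  move: sgen; rewrite -push_map_range// => -[t _ <-].
  have : ev_image phi x (xi_ev Ux' (f U t)).
    by exists U, Ux', (f U t); split=> //; rewrite -fR//; exists t.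
  by rewrite -gR => -[y _ yE]; exists y => //; rewrite /H /= /h yE.
- have bT : bijective Theta by exists Phi.
  exact: (fresco_push lam0 gL gI sT bT fr).
Qed.

Lemma push_iso_over : iso_over F U0 (generated push_generator).
Proof.
exists push_map => U UU0; split.
- exact: push_map_inj.
- exact: push_map_range.
- exact: push_map_oact.
- by move=> W WU s; exact: push_map_res.
Qed.
End Push.
End LocalModel.

Unset Implicit Arguments.
Theorem theorem3p1p10 (R : realType) (X : complexSpace R[i]) (k : nat)
  (Lam : set rat) (E : AXsheaf X)
  (theta : pseries R[i]) (Theta : {lrmorphism Ahat R[i] -> Ahat R[i]}) :
  holomorphic_family k E ->
  (forall x : X, fresco k (tildem (value E x)) /\ primitive Lam (tildem (value E x))) ->
  change_of_variable theta ->
  induced_automorphism theta Theta ->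
  (forall x : X, fresco k (tildem (pushm Theta (value E x)))) /\
  exists F : AXsheaf X,
    [/\ theta_pushforward Theta E F, holomorphic_family k F
      & forall x : X, isomorphic (value F x) (pushm Theta (value E x))].
Proof.
move=> hol fr [t0 t1] [bT _ Ta Tb].
have sT : substitution theta Theta by [].
have [Phi [eta [TP PT sP]]] := substitution_inv sT bT.
have Eloc : forall x : X, exists2 U0 : opens X, oset U0 x & forall U : opens X, U `<=` U0 ->
    [/\ b_injective (sec E U), b_separated (sec E U) & b_complete (sec E U)].
  move=> x; have [U0 Ux [m [lam [N [V [phi [lamI lam01 adm [f fH]]]]]]]] := hol x.
  exists U0 => // U UU0.
  by apply: (model_b_adic adm (f := f)) UU0 => W WU0; have [] := fH W WU0.
split=> [x|].
  have [U0 Ux [m [lam [N [V [phi [lamI lam01 adm [f fH]]]]]]]] := hol x.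
  have lam0 i : 0 < lam i by case/andP: (lam01 i).
  apply: (value_push_fresco lam0 adm (f := f) _ _ _ sT TP PT Ux); last by have [] := fr x.
  - by move=> W WU0; have [] := fH W WU0.
  - by move=> W WU0; have [] := fH W WU0.
  - by move=> W WU0; have [] := fH W WU0.
exists (push_sheaf sT Eloc); split.
(* The comparison map is the identity on sections: only the action of [O_X[[b]]] was rebuilt, and it
   agrees with the old one on functions. *)
- exists (fun U => idfun : {linear pushm Theta (sec E U) -> pushm Theta (sec E U)}) => U; split.
  + by exists idfun.
  + by move=> g s; exact: (esym (push_sheaf_const sT Eloc g s)).
  + by [].
- move=> x; have [U0 Ux [m [lam [N [V [phi [lamI lam01 adm [f fH]]]]]]]] := hol x.
  have lam0 i : 0 < lam i by case/andP: (lam01 i).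
  have fI : forall U : opens X, U `<=` U0 -> injective (f U) by move=> W WU0; have [] := fH W WU0.
  have fR : forall U : opens X, U `<=` U0 -> range (f U) = generated phi (U := U).
    by move=> W WU0; have [] := fH W WU0.
  have fO : forall U : opens X, U `<=` U0 -> forall (S : pseries (OX U)) s,
    f U (oact S s) = oact S (f U s) by move=> W WU0; have [] := fH W WU0.
  have fres : forall U : opens X, U `<=` U0 -> forall (W : opens X) (WU : W `<=` U) s,
    f W (res E WU s) = res _ WU (f U s) by move=> W WU0; have [] := fH W WU0.
  exists U0 => //; exists m, lam, N, V, (push_generator fR sT sP TP Eloc); split=> //.
  + exact: (push_admissible lam0 adm fI fR fO fres sT sP TP PT Eloc).
  + exact: (push_iso_over adm fI fR fO fres sT sP TP Eloc).
- move=> x; exact: value_push_iso.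
Qed.
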